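(* Let $n\ge3$, let $\Omega\subset\mathbb{R}^n$ be a bounded domain with smooth boundary, let $u$ solve $\Delta u=-n$ in $\Omega$, $u=0$ on $\partial\Omega$, and let $N$ be a connected component of $\Omega\setminus\mathrm{MAX}(u)$. Assume that the expected core radius $R=R(u,N)$ lies in $[0,R_{\max})$ and that Normalisation 1 holds, i.e. $u_{\max}=(u_R)_{\max}=\frac12(1-\frac n{n-2}R^2)$. Then $$W\le W_R\quad\text{on }N.$$ Moreover, if there exists $p\in N$ with $W(p)=W_R(p)$, then $(\Omega,u)$ is equivalent to $(\Omega_R,u_R)$.
   Context: $u_{\max}=\max_\Omega u$, $\mathrm{MAX}(u)=\{u=u_{\max}\}$. Equivalence: $\bar\Omega=\{\lambda x+c\}$, $\bar u(y)=\lambda^2u((y-c)/\lambda)$, $\lambda>0$, $c\in\mathbb{R}^n$. NWSS: $\tau(u,S)=\max_S|\nabla u|/\sqrt{2u_{\max}}$ for a component $S$ of $\partial\Omega$; $\tau(u,N)=\max$ of $\tau(u,S)$ over components $S$ of $\partial\Omega\cap\overline N$. Model solutions: $R_{\max}=\sqrt{(n-2)/n}$; for $R\in(0,R_{\max})$, $r_1<R<r_2$ are the positive zeros of $f_R(r)=1-r^2-\frac{2R^n}{(n-2)r^{n-2}}$ (for $R=0$, $r_2=1$); $u_R(r)=\frac{1-r^2}{2}-\frac{R^n}{(n-2)r^{n-2}}$ as a function of $r=|x|$, on $\Omega_R=\{r_1<|x|<r_2\}$ (for $R=0$, $u_0=(1-r^2)/2$ on $B_1(0)$); $(u_R)_{\max}=\frac12(1-\frac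 n{n-2}R^2)$. $\tau_1:(0,R_{\max}]\to[\sqrt n,\infty)$, $\tau_1(R)=\frac{r_1(R^n/r_1^n-1)}{\sqrt{1-nR^2/(n-2)}}$, $\tau_1(R_{\max})=\sqrt n$, strictly decreasing; $\tau_2:[0,R_{\max})\to[1,\sqrt n)$, $\tau_2(0)=1$, $\tau_2(R)=\frac{r_2(1-R^n/r_2^n)}{\sqrt{1-nR^2/(n-2)}}$, strictly increasing. $R(u,N)=\tau_2^{-1}(\tau(u,N))$ if $\tau(u,N)<\sqrt n$, $\tau_1^{-1}(\tau(u,N))$ if $\tau(u,N)\ge\sqrt n$. Pseudo-radial function: $u_R$ is increasing on $[r_1,R]$ and decreasing on $[R,r_2]$; let $\psi_-:[0,(u_R)_{\max}]\to[r_1,R]$ and $\psi_+:[0,(u_R)_{\max}]\to[R,r_2]$ be the inverses of these restrictions. Define $\Psi=\psi_+\circ u$ on $\overline N$ if $\tau(u,N)<\sqrt n$ and $\Psi=\psi_-\circ u$ on $\overline N$ if $\tau(u,N)>\sqrt n$. Set $W=|\nabla u|^2$ and $W_R=|u_R'|^2\circ\Psi=\big(\frac{\Psi^n-R^n}{\Psi^{n-1}}\big)^2$. *)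

(* Defs.v *)
From HB Require Import structures.
From mathcomp Require Import all_boot all_order all_algebra.
From mathcomp Require Import all_classical all_reals all_analysis.
Set Implicit Arguments. Unset Strict Implicit. Unset Printing Implicit Defensive.
Import Order.TTheory GRing.Theory Num.Theory.
Import numFieldNormedType.Exports.
Local Open Scope classical_set_scope.
Local Open Scope ring_scope.

Section Defs.
Variables (R : realType) (n : nat).
Local Notation V := 'rV[R]_n.

Definition ebasis (i : 'I_n) : V := delta_mx ord0 i.

Definition partial (i : 'I_n) (f : V -> R) : V -> R :=
  fun x => 'D_(ebasis i) f x.

Fixpoint iterD (s : seq 'I_n) (f : V -> R) : V -> R :=
  match s with [::] => f | i :: s' => partial i (iterD s' f) end.

Definition smooth_on (U : set V) (f : V -> R) : Prop :=
  forall s : seq 'I_n,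
    (forall x, U x -> {for x, continuous (iterD s f)}) /\
    (forall i x, U x -> derivable (iterD s f) x (ebasis i)).

Definition laplacian (f : V -> R) (x : V) : R :=
  \sum_(i < n) partial i (partial i f) x.

Definition Wgrad (f : V -> R) (x : V) : R := \sum_(i < n) (partial i f x) ^+ 2.
Definition gradnorm (f : V -> R) (x : V) : R := Num.sqrt (Wgrad f x).

Definition enorm (x : V) : R := Num.sqrt (\sum_(i < n) (x ord0 i) ^+ 2).

Definition smooth_bounded_domain (Om : set V) : Prop :=
  open Om /\ connected Om /\ Om !=set0 /\ bounded_set Om /\
  exists rho : V -> R, smooth_on setT rho /\
    Om = [set x | rho x < 0] /\
    (forall x, rho x = 0 -> exists i, partial i rho x != 0).

Definition bdry (Om : set V) : set V := closure Om `\` Om.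

Definition solves_torsion (Om : set V) (u : V -> R) : Prop :=
  (exists U : set V, open U /\ closure Om `<=` U /\ smooth_on U u) /\
  (forall x, Om x -> laplacian u x = - n%:R) /\
  (forall x, bdry Om x -> u x = 0).

Definition umax (Om : set V) (u : V -> R) : R := sup (u @` Om).

Definition MAXset (Om : set V) (u : V -> R) : set V :=
  [set x | Om x /\ u x = umax Om u].

Definition is_component (A : set V) (N : set V) : Prop :=
  exists x0, A x0 /\ N = connected_component A x0.

Definition tauS (Om : set V) (u : V -> R) (S : set V) : R :=
  sup (gradnorm u @` S) / Num.sqrt (2 * umax Om u).

Definition tauN (Om : set V) (u : V -> R) (N : set V) : R :=
  sup [set tauS Om u S | S in is_component (bdry Om `&` closure N)].

Definition Rmax : R := Num.sqrt ((n%:R - 2) / n%:R).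

Definition fR (Rc r : R) : R :=
  1 - r ^+ 2 - 2 * Rc ^+ n / ((n%:R - 2) * r ^+ (n - 2)).

Definition uRr (Rc r : R) : R :=
  if Rc == 0 then (1 - r ^+ 2) / 2
  else (1 - r ^+ 2) / 2 - Rc ^+ n / ((n%:R - 2) * r ^+ (n - 2)).

Definition uRmax (Rc : R) : R := (1 - n%:R / (n%:R - 2) * Rc ^+ 2) / 2.

Definition r1 (Rc : R) : R := xget 0 [set r | 0 < r < Rc /\ fR Rc r = 0].
Definition r2 (Rc : R) : R :=
  if Rc == 0 then 1 else xget 0 [set r | Rc < r /\ fR Rc r = 0].

Definition OmegaR (Rc : R) : set V :=
  if Rc == 0 then [set x | enorm x < 1]
  else [set x | r1 Rc < enorm x < r2 Rc].

Definition uR (Rc : R) (x : V) : R := uRr Rc (enorm x).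

Definition tau1 (Rc : R) : R :=
  if Rc == Rmax then Num.sqrt n%:R
  else r1 Rc * (Rc ^+ n / r1 Rc ^+ n - 1) /
       Num.sqrt (1 - n%:R * Rc ^+ 2 / (n%:R - 2)).

Definition tau2 (Rc : R) : R :=
  if Rc == 0 then 1
  else r2 Rc * (1 - Rc ^+ n / r2 Rc ^+ n) /
       Num.sqrt (1 - n%:R * Rc ^+ 2 / (n%:R - 2)).

(* Rc = R(u,N): tau2^{-1}(tau) if tau < sqrt n, tau1^{-1}(tau) otherwise
   (written relationally; tau1, tau2 are strictly monotone bijections) *)
Definition is_core_radius (Om : set V) (u : V -> R) (N : set V) (Rc : R) : Prop :=
  let t := tauN Om u N in
  (t < Num.sqrt n%:R /\ 0 <= Rc < Rmax /\ tau2 Rc = t) \/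
  (Num.sqrt n%:R <= t /\ 0 < Rc <= Rmax /\ tau1 Rc = t).

Definition psi_plus (Rc t : R) : R :=
  xget 0 [set r | Rc <= r <= r2 Rc /\ uRr Rc r = t].
Definition psi_minus (Rc t : R) : R :=
  xget 0 [set r | r1 Rc <= r <= Rc /\ uRr Rc r = t].

Definition Psi (Om : set V) (u : V -> R) (N : set V) (Rc : R) (x : V) : R :=
  if tauN Om u N < Num.sqrt n%:R then psi_plus Rc (u x) else psi_minus Rc (u x).

Definition WR (Om : set V) (u : V -> R) (N : set V) (Rc : R) (x : V) : R :=
  let p := Psi Om u N Rc x in ((p ^+ n - Rc ^+ n) / p ^+ (n - 1)) ^+ 2.

Definition equivalent (Om : set V) (u : V -> R) (Om' : set V) (u' : V -> R) : Prop :=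
  exists (lam : R) (c : V), 0 < lam /\
    Om' = [set lam *: x + c | x in Om] /\
    (forall y, Om' y -> u' y = lam ^+ 2 * u (lam^-1 *: (y - c))).

End Defs.

(* Main.v *)
(** Write [W = |grad u|^2] and let [r(t)] be the inverse, on the branch of the
    model [u_R] singled out by [tau], of the radial profile. With [y = r^2] and
    [q = R^n / r^n] one has [y' = -2/(1-q)], [q' = n q/(y (1-q))] and
    [W_R = y (1-q)^2], all as functions of [t = u].

    Inequality. At a positive interior maximum of [(W - W_R)/|1-q|] (for [R = 0],
    of [(W - W_R)/(1 + 2u)]) the Hessian of [u] has [grad u] as an eigenvector,
    and the trace Cauchy-Schwarz inequality on the orthogonal complement makes
    the Laplacian of this P-function strictly positive, which is absurd. The
    P-function is nonpositive on the boundary by definition of [tau], and tends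
    to [0] at the maximum set because [W] and [(1-q)^2] are both comparable with
    [u_max - u] there.

    Rigidity. If [W = W_R] at one point, Hopf's strong maximum principle applied
    to [W - W_R] gives equality on [N]; then [Hess u = A(u) Id + B(u) du (x) du],
    so [x + grad u/(1-q)] is a constant [c] and [u = u_R(|x-c|)] on [N]. The
    functions [<x-c, grad u> + (n-2) u + (n/2)|x-c|^2 - (n-2)/2] and
    [(x-c)_i u_j - (x-c)_j u_i] are harmonic on the whole domain and vanish on
    [N], hence everywhere by unique continuation (analyticity, from Bernstein's
    derivative estimates). This determines [u] along the domain, which is then
    open and closed in the connected set [Omega_R + c]. *)

(* The weight [1/|1-q|] plays two parts. For [q > 0] it makes the Laplacian at a critical point
   strictly positive, so that the second-derivative test alone excludes a positive interior maximum;
   and at the core it blows up no faster than [(u_max - u)^(-1/2)], more slowly than [W] decays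
   there. For [R = 0] it is constant, and the gain vanishes identically together with [q]; the
   weight [1/(1+2u)] restores it. Leaving [N] is the obstacle in the rigidity part. For [R > 0] the
   function [u_R(|x-c|)] is singular at [c], and nothing says beforehand that [c] lies outside the
   domain, so [u - u_R(|x-c|)] cannot be continued as a harmonic function on the whole domain. The
   Euler and rotation identities eliminate the singular term: they involve only [u], its derivatives
   and polynomials in [x], and so make sense everywhere. The exclusion of [c] comes last, because
   [r^(n-2) (u - (1-r^2)/2)] turns out to be a nonzero constant. *)
Require Import Defs.
From HB Require Import structures.
From mathcomp Require Import all_boot all_order all_algebra.
From mathcomp Require Import all_classical all_reals all_analysis.
From mathcomp Require Import ring lra.
Import Order.TTheory GRing.Theory Num.Theory.
Import numFieldNormedType.Exports.
Local Open Scope classical_set_scope.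
Local Open Scope ring_scope.
Set Implicit Arguments. Unset Strict Implicit. Unset Printing Implicit Defensive.

(** * Pointwise calculus *)

(* Pointwise forms of the [is_derive] instances, which are stated for sums and
   products in the ring of functions. *)
Section PointwiseDerivatives.
Context {R : realType} {V : normedModType R}.
Implicit Types (f g : V -> R) (x v : V).

Lemma isd_cst (a : R) x v : is_derive x v (fun=> a) 0.
Proof. exact: is_derive_cst. Qed.

Lemma isdD f g x v a b : is_derive x v f a -> is_derive x v g b ->
  is_derive x v (fun y => f y + g y) (a + b).
Proof. by move=> ? ?; exact: is_deriveD. Qed.

Lemma isdN f x v a : is_derive x v f a -> is_derive x v (fun y => - f y) (- a).
Proof. by move=> ?; exact: is_deriveN. Qed.

Lemma isdB f g x v a b : is_derive x v f a -> is_derive x v g b ->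
  is_derive x v (fun y => f y - g y) (a - b).
Proof. by move=> ? ?; exact: is_deriveB. Qed.

Lemma isdM f g x v a b : is_derive x v f a -> is_derive x v g b ->
  is_derive x v (fun y => f y * g y) (a * g x + f x * b).
Proof.
move=> [fa <-] [gb <-].
have -> : (fun y => f y * g y) = f * g by [].
split; first exact: (@derivableM _ _ f g x v fa gb).
by rewrite (@deriveM _ _ f g x v fa gb) /GRing.scale /= addrC (mulrC ('D_v f x)).
Qed.

Lemma isdMc f x v a c : is_derive x v f a ->
  is_derive x v (fun y => c * f y) (c * a).
Proof. by move=> ?; exact: is_deriveZ. Qed.

Lemma isdX f n x v a : is_derive x v f a ->
  is_derive x v (fun y => f y ^+ n) (n%:R * f x ^+ n.-1 * a).
Proof.
elim: n => [|n ih] fa; first by rewrite !mul0r; exact: isd_cst.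
have -> : (fun y => f y ^+ n.+1) = (fun y => f y * f y ^+ n).
  by apply/funext => y; rewrite exprS.
have /is_derive_eq := isdM fa (ih fa); apply.
case: n {ih} => [|n] /=; first by rewrite expr0; ring.
by rewrite exprS -[n.+2%:R]natr1; ring.
Qed.

Lemma isdV f x v a : f x != 0 -> is_derive x v f a ->
  is_derive x v (fun y => (f y)^-1) (- a / f x ^+ 2).
Proof.
move=> f0 [fa <-]; split; first exact: derivableV.
by rewrite deriveV // /GRing.scale /= mulNr mulNr mulrC.
Qed.

Lemma isd_sum (I : finType) (f : I -> V -> R) x v (a : I -> R) :
  (forall i, is_derive x v (f i) (a i)) ->
  is_derive x v (fun y => \sum_i f i y) (\sum_i a i).
Proof.
move=> fa; elim: (index_enum I) => [|i r ih].
  by rewrite big_nil; under eq_fun do rewrite big_nil; exact: isd_cst.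
by rewrite big_cons; under eq_fun do rewrite big_cons; exact: isdD.
Qed.

(** The two difference quotients are the same function of the increment. This lemma and its converse
    reduce the chain rule, the mean value theorem and the maximum tests to functions of one real
    variable. *)
Lemma is_derive_line f x v t d : is_derive (x + t *: v) v f d ->
  is_derive t (1 : R) (fun s : R => f (x + s *: v)) d.
Proof.
have E : (fun h : R => h^-1 *: (((fun s => f (x + s *: v)) \o shift t) (h *: 1)
      - f (x + t *: v))) =
    (fun h => h^-1 *: ((f \o shift (x + t *: v)) (h *: v) - f (x + t *: v))).
  apply/funext => h /=; congr (_ *: (f _ - _)).
  by rewrite scalerDl [_ *: 1]mulr1 addrCA.
by move=> [df <-]; split; rewrite /derivable /derive E.
Qed.

Lemma is_derive_of_line f x v d : is_derive (0 : R) (1 : R) (fun s => f (x + s *: v)) d ->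
  is_derive x v f d.
Proof.
have E : (fun h : R => h^-1 *: (((fun s => f (x + s *: v)) \o shift 0) (h *: 1)
      - f (x + 0 *: v))) =
    (fun h => h^-1 *: ((f \o shift x) (h *: v) - f x)).
  apply/funext => h /=; rewrite scale0r !addr0; congr (_ *: (f _ - _)).
  by rewrite [_ *: 1]mulr1 addrC.
by move=> [df <-]; split; rewrite /derivable /derive -E.
Qed.

Lemma isd_comp (phi : R -> R) f x v a p :
  is_derive (f x) (1 : R) phi p -> is_derive x v f a ->
  is_derive x v (fun y => phi (f y)) (p * a).
Proof.
move=> dp df; apply: is_derive_of_line.
apply: (@is_derive1_comp _ phi (fun s => f (x + s *: v))).
  by rewrite scale0r addr0.
by apply: is_derive_line; rewrite scale0r addr0.
Qed.

Lemma isd_near f g x v a : (\near x, f x = g x) ->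
  is_derive x v f a -> is_derive x v g a.
Proof. exact: near_eq_is_derive. Qed.

Lemma isd_open (O : set V) f g x v a : open O -> O x ->
  (forall y, O y -> f y = g y) -> is_derive x v f a -> is_derive x v g a.
Proof.
move=> oO Ox fg; apply: isd_near; near=> y; apply: fg; near: y.
exact: open_nbhs_nbhs.
Unshelve. all: by end_near. Qed.

End PointwiseDerivatives.

Section OneVariable.
Context {R : realType}.
Implicit Types (g dg : R -> R) (a b h s x d e : R).

Lemma isd1_continuous g (x d : R) : is_derive x 1 g d -> {for x, continuous g}.
Proof.
by case=> dgx _; apply/differentiable_continuous/derivable1_diffP.
Qed.

(** The endpoints come in either order because increments along a coordinate axis have no known
    sign. *)
Lemma MVT_sym g dg a b :
  (forall s, Num.min a b <= s <= Num.max a b -> is_derive s 1 g (dg s)) ->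
  exists2 c, Num.min a b <= c <= Num.max a b & g b - g a = dg c * (b - a).
Proof.
wlog ab : a b / a <= b => [H|].
  case/orP: (le_total a b) => ab; first exact: H.
  rewrite minC maxC => dgs; have [c cab E] := H b a ab dgs.
  by exists c => //; rewrite -(opprB (g a)) E -mulrN opprB.
rewrite (min_idPl ab) (max_idPr ab) => dgs.
have [||c] := @MVT_segment _ g dg a b ab.
- by move=> x; rewrite in_itv /= => /andP[? ?]; apply: dgs; rewrite !ltW.
- apply: derivable_within_continuous => x; rewrite in_itv /= => xab.
  by case: (dgs x xab).
by rewrite in_itv /= => cab E; exists c.
Qed.

Lemma MVT_norm g dg h : (forall s, `|s| <= `|h| -> is_derive s 1 g (dg s)) ->
  exists2 c, `|c| <= `|h| & g h - g 0 = dg c * h.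
Proof.
have le s : Num.min 0 h <= s <= Num.max 0 h -> `|s| <= `|h|.
  case: (leP 0 h) => h0 /andP[s0 sh].
    by rewrite !ger0_norm.
  by rewrite !ler0_norm ?lerN2 // ltW.
move=> dgs; have [|c cab E] := @MVT_sym g dg 0 h.
  by move=> s /le; exact: dgs.
by exists c; [exact: le|rewrite E subr0].
Qed.

Lemma near0_norm (P : R -> Prop) : (\forall s \near 0, P s) ->
  exists2 e, 0 < e & forall s, `|s| < e -> P s.
Proof.
move=> /nbhs_ballP[e /= e0 eP]; exists e => // s se; apply: eP.
by rewrite /ball /= sub0r normrN.
Qed.

(** If [d2] were positive, [dg] would be positive just to the right of 0, and the mean value theorem
    would produce a value above [g 0]. Only differentiability of [dg] at 0 itself enters. *)
Lemma local_max_tests g dg d2 :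
  (\forall s \near (0 : R), is_derive (s : R) 1 g (dg s)) -> is_derive (0 : R) 1 dg d2 ->
  (\forall s \near (0 : R), g s <= g 0) -> dg 0 = 0 /\ d2 <= 0.
Proof.
move=> /near0_norm[e1 e10 dgs] dd /near0_norm[e2 e20 gmax].
pose e := Num.min e1 e2.
have e0 : 0 < e by rewrite lt_min e10.
have dgs' s : `|s| < e -> is_derive s 1 g (dg s).
  by rewrite lt_min => /andP[/dgs].
have gmax' s : `|s| < e -> g s <= g 0.
  by rewrite lt_min => /andP[_ /gmax].
have mem0 : 0 \in `]-e, e[%R by rewrite in_itv /= oppr_lt0 e0.
have dg0 : dg 0 = 0.
  have := @derive1_at_max _ g (-e) e 0 _ _ mem0 _.
  case; [by rewrite (le_trans _ (ltW e0)) // oppr_le0 ltW | | |].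
  - by move=> t; rewrite in_itv /= -ltr_norml => /dgs' [].
  - by move=> t; rewrite in_itv /= -ltr_norml => /gmax'.
  - move=> _ D0; have [_ <-] : is_derive (0 : R) 1 g (dg 0) by apply: dgs'; rewrite normr0.
    exact: D0.
split=> //; rewrite leNgt; apply/negP => d20.
case: dd => dd D2.
have : (fun h : R => h^-1 *: ((dg \o shift 0) (h *: 1) - dg 0)) @ 0^' --> d2.
  by rewrite -D2.
move/cvgr_gt => /(_ 0 d20) /=; rewrite near_withinE /=.
move=> /near0_norm[e3 e30 pos].
pose h := Num.min e e3 / 2.
have m0 : 0 < Num.min e e3 by rewrite lt_min e0.
have h0 : 0 < h by rewrite divr_gt0.
have hm : h < Num.min e e3 by rewrite ltr_pdivrMr // ltr_pMr // ltr1n.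
have [he he3] : h < e /\ h < e3 by move: hm; rewrite lt_min => /andP[].
have [||c] := @MVT _ g dg 0 h h0.
- move=> x; rewrite in_itv /= => /andP[x0 xh]; apply: dgs'.
  by rewrite gtr0_norm // (lt_trans xh).
- apply: derivable_within_continuous => x; rewrite in_itv /= => /andP[x0 xh].
  by case: (dgs' x) => //; rewrite ger0_norm // (le_lt_trans xh).
rewrite in_itv /= subr0 => /andP[c0 ch] E.
have := pos c; rewrite gtr0_norm // (lt_trans ch he3) => /(_ isT).
rewrite gt_eqF // => /(_ isT); rewrite dg0 subr0 [_ *: 1]mulr1 addr0.
rewrite [_ *: _]mulrC pmulr_lgt0 ?invr_gt0 // => dgc.
have := gmax' h; rewrite gtr0_norm // => /(_ he).
by rewrite -subr_le0 E leNgt mulr_gt0.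
Qed.

End OneVariable.

Section PointwiseContinuity.
Context {R : realType} {T : topologicalType}.
Implicit Types (f g : T -> R) (x : T).

Lemma cts_cst (a : R) x : {for x, continuous (fun=> a : R)}.
Proof. exact: cst_continuous. Qed.

Lemma ctsD f g x : {for x, continuous f} -> {for x, continuous g} ->
  {for x, continuous (fun y => f y + g y)}.
Proof. by move=> cf cg; exact: (cvgD cf cg). Qed.

Lemma ctsN f x : {for x, continuous f} -> {for x, continuous (fun y => - f y)}.
Proof. by move=> cf; exact: (cvgN cf). Qed.

Lemma ctsB f g x : {for x, continuous f} -> {for x, continuous g} ->
  {for x, continuous (fun y => f y - g y)}.
Proof. by move=> cf cg; exact: (cvgB cf cg). Qed.

Lemma ctsM f g x : {for x, continuous f} -> {for x, continuous g} ->
  {for x, continuous (fun y => f y * g y)}.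
Proof. by move=> cf cg; exact: (cvgM cf cg). Qed.

Lemma ctsX f n x : {for x, continuous f} -> {for x, continuous (fun y => f y ^+ n)}.
Proof.
move=> cf; suff H : continuous_at x (fun y => f y ^+ n) by exact: H.
elim: n => [|n ih]; first exact: cst_continuous.
have -> : (fun y => f y ^+ n.+1) = (fun y => f y * f y ^+ n).
  by apply/funext => y; rewrite exprS.
by apply: ctsM; [exact: cf|exact: ih].
Qed.

Lemma cts_sum (I : finType) (f : I -> T -> R) x :
  (forall i, {for x, continuous (f i)}) -> {for x, continuous (fun y => \sum_i f i y)}.
Proof.
move=> cf; suff H r : continuous_at x (fun y => \sum_(i <- r) f i y) by exact: H.
elim: r => [|i r ih].
  have -> : (fun y => \sum_(i <- [::]) f i y) = (fun=> 0 : R).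
    by apply/funext => y; rewrite big_nil.
  exact: cst_continuous.
have -> : (fun y => \sum_(j <- i :: r) f j y) = (fun y => f i y + \sum_(j <- r) f j y).
  by apply/funext => y; rewrite big_cons.
by apply: ctsD; [exact: cf|exact: ih].
Qed.

Lemma cts_comp (phi : R -> R) f x : {for x, continuous f} ->
  {for f x, continuous phi} -> {for x, continuous (fun y => phi (f y))}.
Proof. by move=> cf cp; exact: (continuous_comp cf cp). Qed.

End PointwiseContinuity.

(** * Connectedness and calculus in coordinates *)

Section Connectedness.
Context {R : realType}.

(** The open-and-closed argument behind every propagation below. Both conditions on [Z] are tested
    only at points of [N], so [Z] may be arbitrary elsewhere. *)
Lemma connected_clopen_sub (T : topologicalType) (N Z : set T) :
  connected N -> N `&` Z !=set0 ->
  (forall x, N x -> Z x -> \forall y \near x, Z y) ->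
  (forall x, N x -> closure (N `&` Z) x -> Z x) -> N `<=` Z.
Proof.
move=> cN NZ0 opZ clZ.
suff <- : N `&` Z = N by apply: subIsetr.
apply: cN => //.
- exists Z°; first exact: open_interior.
  apply/seteqP; split=> x [Nx Zx]; split=> //; first exact: opZ.
  exact: interior_subset.
- exists (closure (N `&` Z)); first exact: closed_closure.
  apply/seteqP; split=> x [Nx Zx]; split=> //; last exact: clZ.
  exact: subset_closure.
Qed.

Context {V : normedModType R}.

Lemma star_connected (A : set V) x : A x ->
  (forall y t, A y -> 0 <= t <= 1 -> A (x + t *: (y - x))) -> connected A.
Proof.
move=> Ax star.
pose seg (y : V) : set V := [set x + t *: (y - x) | t in `[0%R, 1%R]].
have -> : A = \bigcup_(y in A) seg y.
  apply/seteqP; split=> [y Ay|z [y Ay [t]]].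
    exists y => //; exists 1; first by rewrite /= in_itv /= ler01 lexx.
    by rewrite scale1r addrC subrK.
  by rewrite /= in_itv /= => t01 <-; exact: star.
apply: bigcup_connected => [|y Ay].
  exists x => y Ay; exists 0; first by rewrite /= in_itv /= ler01 lexx.
  by rewrite scale0r addr0.
apply: connected_continuous_connected; first exact: segment_connected.
apply: continuous_subspaceT => t.
by apply: cvgD; [exact: cvg_cst|apply: cvgZr_tmp; exact: cvg_id].
Qed.

Lemma connected_ball (x : V) (e : R) : connected (ball x e).
Proof.
have [e0|e0] := ltP 0 e; last first.
  suff -> : ball x e = set0 by exact: connected0.
  apply/seteqP; split=> // y; rewrite -ball_normE /ball_ /= => ye.
  by have := le_lt_trans (normr_ge0 _) ye; rewrite ltNge e0.
apply: (@star_connected _ x); first exact: ballxx.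
move=> y t; rewrite -ball_normE /ball_ /= => ye /andP[t0 t1].
rewrite opprD addrA subrr add0r normrN normrZ ger0_norm // distrC.
by apply: le_lt_trans ye; rewrite ler_piMl.
Qed.

(** A small ball around the limit point is connected, lies in [A] and meets the component. *)
Lemma closure_component (A : set V) x0 : open A ->
  closure (connected_component A x0) `&` A `<=` connected_component A x0.
Proof.
move=> oA x [clx Ax].
have /nbhs_ballP[e /= e0 eA] : nbhs x A by exact: open_nbhs_nbhs.
have [y [Ny By]] := clx _ (nbhsx_ballx x e e0).
apply: (connected_component_trans Ny).
apply: (@connected_component_max _ A (ball x e)) => //.
- exact: connected_ball.
- exact: ballxx.
Qed.

Lemma open_component (A : set V) x0 : open A -> open (connected_component A x0).
Proof.
move=> oA; rewrite openE => x Nx.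
have Ax := connected_component_sub Nx.
have /nbhs_ballP[e /= e0 eA] : nbhs x A by exact: open_nbhs_nbhs.
rewrite /interior; apply/nbhs_ballP; exists e => //= y By.
apply: (connected_component_trans Nx).
apply: (@connected_component_max _ A (ball x e)) => //.
- exact: ballxx.
- exact: connected_ball.
Qed.

End Connectedness.

Section Coordinates.
Context {R : realType} {n : nat}.
Local Notation V := 'rV[R]_n.
Local Notation e_ := (ebasis R).
Implicit Types (f g : V -> R) (x y : V) (U : set V).

Lemma rV_ballP x y (r : R) :
  ball x r y <-> 0 < r /\ (forall i, `|x ord0 i - y ord0 i| < r).
Proof.
split=> [[r0 b]|[r0 b]]; split=> //; first by move=> i; exact: b.
by move=> i j; rewrite (ord1 i); exact: b.
Qed.

Lemma ebasisE (i j : 'I_n) : e_ i ord0 j = (j == i)%:R.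
Proof. by rewrite /ebasis mxE eqxx. Qed.

Lemma line_coord x (s : R) (i j : 'I_n) :
  (x + s *: e_ i) ord0 j = x ord0 j + s * (j == i)%:R.
Proof. by rewrite !mxE eqxx. Qed.

Lemma ball_line x y (s r : R) (i : 'I_n) : ball x r y ->
  `|x ord0 i - (y ord0 i + s)| < r -> ball x r (y + s *: e_ i).
Proof.
move=> /rV_ballP[r0 xy] ys; apply/rV_ballP; split=> // j; rewrite line_coord.
by case: eqVneq => [->|_]; rewrite ?mulr1 // mulr0 addr0.
Qed.

Lemma open_line U x i : open U -> U x ->
  \forall s \near (0 : R), U (x + s *: e_ i).
Proof.
move=> oU Ux; have /nbhs_ballP[r /= r0 rU] : nbhs x U by exact: open_nbhs_nbhs.
apply/nbhs_ballP; exists r => // s; rewrite /ball /= sub0r normrN => sr.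
by apply/rU/ball_line; [exact: ballxx|rewrite opprD addrA subrr sub0r normrN].
Qed.

Lemma partial_val f x i a : is_derive x (e_ i) f a -> partial i f x = a.
Proof. by case. Qed.

Lemma partial_open U f g x i : open U -> U x -> (forall y, U y -> f y = g y) ->
  partial i f x = partial i g x.
Proof.
move=> oU Ux fg; rewrite /partial; apply: near_eq_derive; near=> y.
apply: fg; near: y; exact: open_nbhs_nbhs.
Unshelve. all: by end_near. Qed.

(** Coordinates are switched from [x] to [y] one at a time. Every intermediate point mixes
    coordinates of [x] and [y], so the walk stays in any ball around [x] that contains [y], balls
    here being cubes. Partial derivatives then suffice, without total differentiability. *)
Lemma coordinate_walk (P : V -> Prop) x y : P x ->
  (forall z (i : 'I_n), P z -> (forall j, z ord0 j = x ord0 j \/ z ord0 j = y ord0 j) ->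
     z ord0 i = x ord0 i -> P (z + (y ord0 i - x ord0 i) *: e_ i)) -> P y.
Proof.
move=> Px step.
pose z k : V := \row_j (if (j < k)%N then y ord0 j else x ord0 j).
have Pz k : (k <= n)%N -> P (z k).
  elim: k => [|k ih] kn.
    by have -> : z 0%N = x by apply/rowP => j; rewrite mxE.
  have -> : z k.+1 = z k + (y ord0 (Ordinal kn) - x ord0 (Ordinal kn)) *: e_ (Ordinal kn).
    apply/rowP => j; rewrite line_coord !mxE ltnS leq_eqVlt.
    have -> : (nat_of_ord j == k) = (j == Ordinal kn) by [].
    case: eqVneq => [->|_] /=; first by rewrite ltnn mulr1 addrC subrK.
    by rewrite mulr0 addr0.
  apply: step; first by apply: ih; exact: ltnW.
    by move=> j; rewrite mxE; case: ifP => _; [right|left].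
  by rewrite mxE /= ltnn.
have -> : y = z n by apply/rowP => j; rewrite mxE ltn_ord.
exact: Pz.
Qed.

Lemma ball_zero_grad f x (r : R) :
  (forall y i, ball x r y -> is_derive y (e_ i) f 0) ->
  forall y, ball x r y -> f y = f x.
Proof.
move=> df y xy; have /rV_ballP[r0 xyi] := xy.
suff [] : ball x r y /\ f y = f x by [].
apply: (@coordinate_walk (fun z => ball x r z /\ f z = f x) x y).
  by split=> //; exact: ballxx.
move=> z i [bz <-] _ zi; set h := _ - _.
have bl s : `|s| <= `|h| -> ball x r (z + s *: e_ i).
  move=> sh; apply: ball_line => //; rewrite zi opprD addrA subrr sub0r normrN.
  by apply: le_lt_trans sh _; rewrite /h distrC; exact: xyi.
split; first exact: bl.
have [|c _] := @MVT_norm R (fun s => f (z + s *: e_ i)) (fun=> 0) h.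
  by move=> s /bl bs; apply: is_derive_line; exact: df.
by rewrite mul0r scale0r addr0 => /eqP; rewrite subr_eq0 => /eqP.
Qed.

Lemma zero_grad_cst (N : set V) f : open N -> connected N ->
  (forall x i, N x -> is_derive x (e_ i) f 0) ->
  forall x y, N x -> N y -> f x = f y.
Proof.
move=> oN cN df x y Nx Ny.
have loc z : N z -> exists2 r : R, 0 < r & forall w, ball z r w -> N w /\ f w = f z.
  move=> Nz; have /nbhs_ballP[r /= r0 rN] : nbhs z N by exact: open_nbhs_nbhs.
  exists r => // w bw; split; first exact: rN.
  by apply: ball_zero_grad bw => v i /rN; exact: df.
suff /(_ y Ny) : N `<=` [set z | f x = f z] by [].
apply: connected_clopen_sub => //; first by exists x.
- move=> z Nz /= fz; have [r r0 H] := loc z Nz.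
  by apply/nbhs_ballP; exists r => //= w /H[_ fw]; rewrite /= fw.
- move=> z Nz clz; have [r r0 H] := loc z Nz.
  by have [w [[Nw /= fw] /H[_ <-]]] := clz _ (nbhsx_ballx z r r0).
Qed.

Lemma local_max_partials U f (f1 : 'I_n -> V -> R) (f2 : 'I_n -> R) x :
  open U -> U x -> (forall i y, U y -> is_derive y (e_ i) f (f1 i y)) ->
  (forall i, is_derive x (e_ i) (f1 i) (f2 i)) ->
  (\forall y \near x, f y <= f x) -> forall i, f1 i x = 0 /\ f2 i <= 0.
Proof.
move=> oU Ux df ddf mx i.
have E0 : x + 0 *: e_ i = x by rewrite scale0r addr0.
have := @local_max_tests R (fun s => f (x + s *: e_ i)) (fun s => f1 i (x + s *: e_ i)) (f2 i).
rewrite E0; apply.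
- near=> s; apply: is_derive_line; apply: df; near: s; exact: open_line.
- by apply: is_derive_line; rewrite E0.
- have : open [set y | f y <= f x]° by exact: open_interior.
  move=> /(@open_line _ x i) /(_ mx); apply: filterS => s /=.
  exact: interior_subset.
Unshelve. all: by end_near. Qed.

End Coordinates.

(** * Stability of smoothness and symmetry of second derivatives *)

Section Smooth.
Context {R : realType} {n : nat}.
Local Notation V := 'rV[R]_n.
Local Notation e_ := (ebasis R).
Implicit Types (f g : V -> R) (x y : V) (U : set V).

Lemma continuous_open_eq U f g x : open U -> U x -> (forall y, U y -> f y = g y) ->
  {for x, continuous f} -> {for x, continuous g}.
Proof.
move=> oU Ux fg cf.
have nfg : \forall y \near x, f y = g y.
  by near=> y; apply: fg; near: y; exact: open_nbhs_nbhs.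
have : f @ x --> f x by exact: cf.
rewrite (fg x Ux) => {}cf; apply: cvg_trans cf.
exact: (near_eq_cvg nfg).
Unshelve. all: by end_near. Qed.

Lemma smooth_isd U f x i : smooth_on U f -> U x ->
  is_derive x (e_ i) f (partial i f x).
Proof. by move=> sf Ux; apply: derivableP; have [_ /(_ i x Ux)] := sf [::]. Qed.

Lemma smooth_continuous U f x : smooth_on U f -> U x -> {for x, continuous f}.
Proof. by move=> sf Ux; have [/(_ x Ux)] := sf [::]. Qed.

Lemma iterD_rcons s i f : Defs.iterD (rcons s i) f = Defs.iterD s (partial i f).
Proof. by elim: s => //= j s ->. Qed.

Lemma smooth_partial U f i : smooth_on U f -> smooth_on U (partial i f).
Proof. by move=> sf s; rewrite -iterD_rcons; exact: sf. Qed.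

Lemma smooth_sub U U' f : U' `<=` U -> smooth_on U f -> smooth_on U' f.
Proof.
by move=> UU sf s; have [c d] := sf s; split=> [x /UU|i x /UU]; [exact: c|exact: d].
Qed.

(* [Ck] is stable by products through an induction on [k], which [smooth_on]
   does not offer directly. *)
Fixpoint Ck (k : nat) U f : Prop :=
  (forall x, U x -> {for x, continuous f}) /\
  if k is k'.+1 then forall i, exists g : V -> R,
    (forall x, U x -> is_derive x (e_ i) f (g x)) /\ Ck k' U g
  else True.

Lemma CkS k U f : Ck k.+1 U f -> Ck k U f.
Proof.
elim: k f => [|k ih] f [cf df]; split=> //.
by move=> i; have [g [dg /ih cg]] := df i; exists g.
Qed.

Lemma smooth_Ck U f k : smooth_on U f -> Ck k U f.
Proof.
elim: k f => [|k ih] f sf; split=> //.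
- by move=> x; exact: smooth_continuous.
- by move=> x; exact: smooth_continuous.
move=> i; exists (partial i f); split; last exact/ih/smooth_partial.
by move=> x; exact: smooth_isd.
Qed.

(** The last index of a list is differentiated first by [iterD], so the induction peels lists from
    the right. Each derivative costs one order, and one more is kept for derivability. *)
Lemma Ck_smooth U f : open U -> (forall k, Ck k U f) -> smooth_on U f.
Proof.
move=> oU.
have Ck_eq k h1 h2 : (forall x, U x -> h1 x = h2 x) -> Ck k U h1 -> Ck k U h2.
  elim: k h1 h2 => [|k ih] h1 h2 E [c d]; split=> //.
  - by move=> x Ux; apply: continuous_open_eq oU Ux E (c x Ux).
  - by move=> x Ux; apply: continuous_open_eq oU Ux E (c x Ux).
  - move=> i; have [g [dg cg]] := d i; exists g; split=> // x Ux.
    exact: isd_open oU Ux E (dg x Ux).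
suff H s k h : Ck (k + size s).+1 U h -> Ck k.+1 U (Defs.iterD s h).
  move=> cf s; have [c d] := H s 0%N f (cf _); split=> // i x Ux.
  by have [g [/(_ x Ux)[]]] := d i.
elim/last_ind: s h k => [|s i ih] h k; first by rewrite addn0.
rewrite size_rcons iterD_rcons => -[_ /(_ i)[g [dg cg]]]; apply: ih.
rewrite -addnS; apply: (@Ck_eq _ g) => [x Ux|]; last exact: cg.
by rewrite (partial_val (dg x Ux)).
Unshelve. all: by end_near. Qed.

Lemma smooth_cst U c : open U -> smooth_on U (fun=> c).
Proof.
move=> oU; apply: Ck_smooth => // k; elim: k c => [|k ih] c; split=> //.
- by move=> x _; exact: cst_continuous.
- by move=> x _; exact: cst_continuous.
by move=> i; exists (fun=> 0); split=> // x _; exact: isd_cst.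
Qed.

Lemma smoothD U f g : open U -> smooth_on U f -> smooth_on U g ->
  smooth_on U (fun x => f x + g x).
Proof.
move=> oU sf sg; apply: Ck_smooth => // k.
elim: k f g sf sg => [|k ih] f g sf sg; split=> //.
- by move=> x Ux; apply: ctsD; [exact: smooth_continuous sf Ux|exact: smooth_continuous sg Ux].
- by move=> x Ux; apply: ctsD; [exact: smooth_continuous sf Ux|exact: smooth_continuous sg Ux].
move=> i; exists (fun x => partial i f x + partial i g x); split.
  by move=> x Ux; apply: isdD; exact: smooth_isd Ux.
by apply: ih; exact: smooth_partial.
Qed.

Lemma smoothM U f g : open U -> smooth_on U f -> smooth_on U g ->
  smooth_on U (fun x => f x * g x).
Proof.
move=> oU; suff H k : forall f g, Ck k U f -> Ck k U g -> Ck k U (fun x => f x * g x).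
  by move=> sf sg; apply: Ck_smooth => // k; apply: H; exact: smooth_Ck.
have CD m h1 h2 : Ck m U h1 -> Ck m U h2 -> Ck m U (fun x => h1 x + h2 x).
  elim: m h1 h2 => [|m ih] h1 h2 [c1 d1] [c2 d2]; split=> //.
  - by move=> x Ux; apply: ctsD; [exact: c1|exact: c2].
  - by move=> x Ux; apply: ctsD; [exact: c1|exact: c2].
  move=> i; have [g1 [dg1 cg1]] := d1 i; have [g2 [dg2 cg2]] := d2 i.
  exists (fun x => g1 x + g2 x); split; last exact: ih.
  by move=> x Ux; apply: isdD; [exact: dg1|exact: dg2].
elim: k => [|k ih] {}f {}g cf cg.
  by split=> // x Ux; apply: ctsM; [exact: cf.1|exact: cg.1].
split=> [x Ux|i]; first by apply: ctsM; [exact: cf.1|exact: cg.1].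
have [f1 [df1 cf1]] := cf.2 i; have [g1 [dg1 cg1]] := cg.2 i.
exists (fun x => f1 x * g x + f x * g1 x); split.
  by move=> x Ux; apply: isdM; [exact: df1|exact: dg1].
by apply: CD; apply: ih => //; exact: CkS.
Qed.

Lemma smooth_sum (I : finType) U (f : I -> V -> R) : open U ->
  (forall i, smooth_on U (f i)) -> smooth_on U (fun x => \sum_i f i x).
Proof.
move=> oU sf; elim: (index_enum I) => [|i r ih].
  have -> : (fun x => \sum_(i <- [::]) f i x) = (fun=> 0).
    by apply/funext => x; rewrite big_nil.
  exact: smooth_cst.
have -> : (fun x => \sum_(j <- i :: r) f j x) = (fun x => f i x + \sum_(j <- r) f j x).
  by apply/funext => x; rewrite big_cons.
by apply: smoothD oU (sf i) ih.
Qed.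

Lemma isd_coord x (i j : 'I_n) :
  is_derive x (e_ i) (fun y : V => y ord0 j) (j == i)%:R.
Proof.
apply: is_derive_of_line.
have -> : (fun s : R => (x + s *: e_ i) ord0 j) =
          (fun s => x ord0 j + (j == i)%:R * s).
  by apply/funext => s; rewrite line_coord mulrC.
have := isdD (isd_cst (x ord0 j) (0 : R) (1 : R))
             (isdMc (j == i)%:R (@is_derive_id _ _ (0 : R) (1 : R))).
by rewrite add0r mulr1.
Qed.

Lemma coord_cts x (j : 'I_n) : {for x, continuous (fun y : V => y ord0 j)}.
Proof. exact: coord_continuous. Qed.

Lemma smooth_coord U (j : 'I_n) : open U -> smooth_on U (fun y : V => y ord0 j).
Proof.
move=> oU; apply: Ck_smooth => // -[|k]; split=> //.
- by move=> x _; exact: coord_cts.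
- by move=> x _; exact: coord_cts.
move=> i; exists (fun=> (j == i)%:R); split; first by move=> x _; exact: isd_coord.
exact/smooth_Ck/smooth_cst.
Qed.

(* Both mixed partials are limits of the same second difference quotient. *)
Lemma partialC U f x i j : open U -> smooth_on U f -> U x ->
  partial i (partial j f) x = partial j (partial i f) x.
Proof.
have close (e p q p' q' : R) : `|q' - q| < e / 2 -> `|p' - p| < e / 2 -> q' = p' ->
    `|p - q| <= e.
  move=> + + E'; rewrite E' !ltr_norml ler_norml => /andP[? ?] /andP[? ?].
  by apply/andP; split; lra.
move=> oU sf Ux.
have /nbhs_ballP[r /= r0 rU] : nbhs x U by exact: open_nbhs_nbhs.
(* When the two indices coincide, one coordinate moves by up to [2h]; radius [3h] contains the point
   strictly. *)
have lin i1 j1 s t h : `|s| <= h -> `|t| <= h -> 0 < h ->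
    ball x (h *+ 3) (x + s *: e_ j1 + t *: e_ i1).
  move=> sh th h0; apply/rV_ballP; split=> [|k]; first by rewrite mulrn_wgt0.
  rewrite !line_coord.
  have b1 (w : R) (b : bool) : `|w| <= h -> `|w * b%:R| <= h.
    by case: b => wh; rewrite ?mulr1 // mulr0 normr0 ltW.
  rewrite !opprD !addrA subrr sub0r.
  apply: le_lt_trans (_ : h + h < _); last by rewrite !mulrS mulr0n; lra.
  by apply: le_trans (ler_normB _ _) _; rewrite normrN; apply: lerD; exact: b1.
have sq i1 j1 h : 0 < h -> h *+ 3 <= r -> exists2 y, ball x (h *+ 3) y &
    f (x + h *: e_ j1 + h *: e_ i1) - f (x + h *: e_ i1)
      - f (x + h *: e_ j1) + f x = partial j1 (partial i1 f) y * h * h.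
  move=> h0 hr.
  have Ul s t : `|s| <= h -> `|t| <= h -> U (x + s *: e_ j1 + t *: e_ i1).
    by move=> sh th; apply: rU; apply: le_ball hr _ _; exact: lin.
  have hh : `|h| <= h by rewrite gtr0_norm.
  have [|c ch] := @MVT_norm R
      (fun s => f (x + h *: e_ j1 + s *: e_ i1) - f (x + s *: e_ i1))
      (fun s => partial i1 f (x + h *: e_ j1 + s *: e_ i1)
                - partial i1 f (x + s *: e_ i1)) h.
    move=> s sh; have sh' : `|s| <= h := le_trans sh hh.
    apply: isdB; apply: is_derive_line; apply: smooth_isd sf _; first exact: Ul.
    by have := @Ul 0 s; rewrite scale0r addr0 normr0; apply => //; exact: ltW.
  rewrite !scale0r !addr0 => E.
  have ch' : `|c| <= h := le_trans ch hh.
  have [|d dh] := @MVT_norm R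
      (fun s => partial i1 f (x + c *: e_ i1 + s *: e_ j1))
      (fun s => partial j1 (partial i1 f) (x + c *: e_ i1 + s *: e_ j1)) h.
    move=> s sh; apply: is_derive_line; apply: smooth_isd (smooth_partial i1 sf) _.
    by rewrite addrAC; apply: Ul => //; exact: le_trans sh hh.
  rewrite !scale0r !addr0 => E'.
  have dh' : `|d| <= h := le_trans dh hh.
  exists (x + c *: e_ i1 + d *: e_ j1); last first.
    have {}E' : partial i1 f (x + h *: e_ j1 + c *: e_ i1) - partial i1 f (x + c *: e_ i1)
        = partial j1 (partial i1 f) (x + c *: e_ i1 + d *: e_ j1) * h.
      by rewrite -E' (addrAC x).
    by rewrite -E' -E; ring.
  by rewrite addrAC; exact: lin.
have sij := smooth_partial i (smooth_partial j sf).
have sji := smooth_partial j (smooth_partial i sf).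
apply/eqP; rewrite -subr_eq0 -normr_le0; apply/ler_addgt0Pl => e e0; rewrite addr0.
have e20 : 0 < e / 2 by rewrite divr_gt0.
have /cvgr_distC_lt /(_ _ e20) := smooth_continuous sij Ux.
have /cvgr_distC_lt /(_ _ e20) := smooth_continuous sji Ux.
move=> /nbhs_ballP[r1 /= r10 H1] /nbhs_ballP[r2 /= r20 H2].
pose h := Num.min r (Num.min r1 r2) / 3.
have m0 : 0 < Num.min r (Num.min r1 r2) by rewrite !lt_min r0 r10.
have h0 : 0 < h by rewrite divr_gt0.
have h3 : h *+ 3 = Num.min r (Num.min r1 r2) by rewrite -mulr_natr divfK.
have [hr hr1 hr2] : [/\ h *+ 3 <= r, h *+ 3 <= r1 & h *+ 3 <= r2].
  by rewrite h3; split; rewrite ?ge_min lexx ?orbT.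
have [y1 by1 E1] := sq i j h h0 hr; have [y2 by2 E2] := sq j i h h0 hr.
have A1 := H1 y1 (le_ball hr1 by1); have A2 := H2 y2 (le_ball hr2 by2).
have E : partial j (partial i f) y1 = partial i (partial j f) y2.
  apply: (mulIf (lt0r_neq0 h0)); apply: (mulIf (lt0r_neq0 h0)).
  apply: etrans (esym E1) (etrans _ E2); rewrite (addrAC x (h *: e_ i)).
  by congr (_ + _); exact: addrAC.
exact: close A1 A2 E.
Qed.

End Smooth.

(** * The strong maximum principle *)

Section CompactExtrema.
Context {R : realType} {T : topologicalType}.
Implicit Types (K : set T) (f : T -> R).

Lemma compact_max K f : K !=set0 -> compact K ->
  (forall x, K x -> {for x, continuous f}) ->
  exists2 c, K c & forall x, K x -> f x <= f c.
Proof.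
move=> K0 cK cf; have [|c Kc H] := compact_EVT_max K0 cK (f := f).
  by apply: continuous_in_subspaceT => x; rewrite inE; exact: cf.
by exists c => [|x Kx]; [rewrite inE in Kc|apply: H; rewrite inE].
Qed.

Lemma compact_min K f : K !=set0 -> compact K ->
  (forall x, K x -> {for x, continuous f}) ->
  exists2 c, K c & forall x, K x -> f c <= f x.
Proof.
move=> K0 cK cf; have [x Kx|c Kc H] := compact_max (f := fun x => - f x) K0 cK.
  by apply: ctsN; exact: cf.
by exists c => // x /H; rewrite lerN2.
Qed.

Lemma compact_norm_bound K f : compact K ->
  (forall x, K x -> {for x, continuous f}) ->
  exists2 M : R, 0 <= M & forall x, K x -> `|f x| <= M.
Proof.
move=> cK cf; have [[x0 Kx0]|/set0P/negP/negPn/eqP ->] := pselect (K !=set0); last first.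
  by exists 0.
have K0 : K !=set0 by exists x0.
have [c1 _ H1] := compact_max K0 cK cf; have [c2 _ H2] := compact_min K0 cK cf.
exists (`|f c1| + `|f c2|) => [|x Kx]; first by rewrite addr_ge0.
have := ler_norm (f c1); have := ler_norm (- f c2); rewrite normrN.
have := H1 x Kx; have := H2 x Kx; have := normr_ge0 (f c1); have := normr_ge0 (f c2).
by rewrite ler_norml => *; apply/andP; split; lra.
Qed.

End CompactExtrema.

Section Euclidean.
Context {R : realType} {n : nat}.
Local Notation V := 'rV[R]_n.
Local Notation e_ := (ebasis R).
Implicit Types (x y z a : V) (U : set V).

Definition sqdist a x : R := \sum_i (x ord0 i - a ord0 i) ^+ 2.

Lemma sqdist_ge0 a x : 0 <= sqdist a x.
Proof. by apply: sumr_ge0 => i _; exact: sqr_ge0. Qed.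

Lemma sqdistC a x : sqdist a x = sqdist x a.
Proof. by apply: eq_bigr => i _; rewrite -sqrrN opprB. Qed.

Lemma sqdistxx a : sqdist a a = 0.
Proof. by rewrite /sqdist big1 // => i _; rewrite subrr expr0n. Qed.

Lemma sqdist_coord a x i : (x ord0 i - a ord0 i) ^+ 2 <= sqdist a x.
Proof.
by rewrite /sqdist (bigD1 i) //= lerDl; apply: sumr_ge0 => j _; exact: sqr_ge0.
Qed.

Lemma sqdist_eq0 a x : sqdist a x = 0 -> x = a.
Proof.
move=> E; apply/rowP => i; apply/eqP; rewrite -subr_eq0 -sqrf_eq0 eq_le sqr_ge0 andbT.
by rewrite -E sqdist_coord.
Qed.

Lemma sqdist_tri a x y : sqdist a y <= 2 * sqdist a x + 2 * sqdist x y.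
Proof.
rewrite /sqdist !mulr_sumr -big_split /=; apply: ler_sum => i _.
have := sqr_ge0 ((x ord0 i - a ord0 i) - (y ord0 i - x ord0 i)).
by rewrite !expr2 => *; nra.
Qed.

Lemma sqdist_ball a x (r : R) : 0 < r -> sqdist a x < r ^+ 2 -> ball a r x.
Proof.
move=> r0 ar; apply/rV_ballP; split=> // i; rewrite distrC.
rewrite -(ltr_pXn2r (n := 2)) ?nnegrE //; last exact: ltW.
by rewrite real_normK ?num_real //; apply: le_lt_trans ar; exact: sqdist_coord.
Qed.

Lemma sqdist_cts a x : {for x, continuous (sqdist a)}.
Proof.
by apply: cts_sum => i; apply: ctsX; apply: ctsB; [exact: coord_cts|exact: cts_cst].
Qed.

Lemma isd_coordB a x i j :
  is_derive x (e_ i) (fun y : V => y ord0 j - a ord0 j) (j == i)%:R.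
Proof.
by have := isdB (isd_coord x i j) (isd_cst (a ord0 j) x (e_ i)); rewrite subr0.
Qed.

Lemma isd_sqdist a x i : is_derive x (e_ i) (sqdist a) (2 * (x ord0 i - a ord0 i)).
Proof.
have := isd_sum (fun j => isdX 2 (isd_coordB a x i j)).
rewrite (bigD1 i) //= big1 ?addr0 ?eqxx ?mulr1 ?expr1 // => j /negPf ->.
by rewrite mulr0.
Qed.

Lemma isd_sqdist2 a x i :
  is_derive x (e_ i) (fun y : V => 2 * (y ord0 i - a ord0 i)) 2.
Proof. by have := isdMc 2 (isd_coordB a x i i); rewrite eqxx mulr1. Qed.

Lemma compact_sqball a (c : R) : compact [set x | sqdist a x <= c].
Proof.
apply: bounded_closed_compact.
  exists (`|a| + (`|c| + 1)); split; first exact: num_real.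
  move=> M hM x /= xc; apply: le_trans (ltW hM).
  rewrite -[x](subrK a) addrC; apply: le_trans (ler_normD _ _) _; rewrite lerD2l.
  have : ball a (`|c| + 1) x.
    apply: sqdist_ball; first by have := normr_ge0 c; lra.
    apply: le_lt_trans xc _; have := ler_norm c; have := normr_ge0 c.
    by rewrite expr2 => *; nra.
  by rewrite -ball_normE /ball_ /= distrC => /ltW.
apply: (@closed_comp _ _ (sqdist a) [set y | y <= c]); last exact: closed_le.
by move=> x _; exact: sqdist_cts.
Qed.

Lemma open_sqball U a : open U -> U a ->
  exists2 r : R, 0 < r & [set x | sqdist a x < r ^+ 2] `<=` U.
Proof.
move=> oU Ua; have /nbhs_ballP[r /= r0 rU] : nbhs a U by exact: open_nbhs_nbhs.
by exists r => // x /= /(sqdist_ball r0); exact: rU.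
Qed.

Lemma nbhs_sqball a z (c : R) : sqdist a z < c -> \forall x \near z, sqdist a x < c.
Proof. by move=> H; exact: (cvgr_lt _ (@sqdist_cts a z) _ H). Qed.

End Euclidean.

Section StrongMaximum.
Context {R : realType} {n : nat}.
Local Notation V := 'rV[R]_n.
Local Notation e_ := (ebasis R).
Variables (N : set V) (w C : V -> R) (w1 w2 b : 'I_n -> V -> R).
Hypotheses (oN : open N)
  (dw : forall i x, N x -> is_derive x (e_ i) w (w1 i x))
  (ddw : forall i x, N x -> is_derive x (e_ i) (w1 i) (w2 i x))
  (cw : forall x, N x -> {for x, continuous w})
  (cb : forall i x, N x -> {for x, continuous (b i)})
  (cC : forall x, N x -> {for x, continuous C})
  (w_le0 : forall x, N x -> w x <= 0)
  (Lw : forall x, N x -> C x * w x <= \sum_i w2 i x + \sum_i b i x * w1 i x).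

(* Hopf's barrier [exp (- al |x - m|^2) - exp (- al t)], with [al] large, on the
   ball of squared radius [t / 4] around the touching point [z]. *)
Lemma no_interior_touching (m z : V) (t : R) : 0 < t -> sqdist m z = t ->
  w z = 0 -> (forall x, sqdist z x <= t / 4 -> N x) ->
  (forall x, sqdist m x <= t -> sqdist z x <= t / 4 -> x <> z -> w x < 0) -> False.
Proof.
move=> t0 mz wz zN neg.
pose B : set V := [set x | sqdist z x <= t / 4].
have cB : compact B by exact: compact_sqball.
have [K K0 HK] : exists2 K : R, 0 <= K & forall x, B x ->
    `|C x| <= K /\ forall i, `|b i x| <= K.
  have [K1 K10 H1] : exists2 M : R, 0 <= M & forall x, B x -> `|C x| <= M.
    by apply: compact_norm_bound => // x /zN; exact: cC.
  have H2 i : exists M : R, 0 <= M /\ forall x, B x -> `|b i x| <= M.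
    have [|M M0 H] := @compact_norm_bound _ _ B (b i) cB; last by exists M.
    by move=> x /zN; exact: cb.
  have {H2}[M H2] := choice H2.
  exists (K1 + \sum_i M i); first by rewrite addr_ge0 // sumr_ge0 // => i _; have [] := H2 i.
  have S0 : 0 <= \sum_i M i by rewrite sumr_ge0 // => i _; have [] := H2 i.
  move=> x Bx; split; first by apply: le_trans (H1 x Bx) _; rewrite lerDl.
  move=> i; apply: le_trans ((H2 i).2 x Bx) _; rewrite (bigD1 i) //= addrCA lerDl.
  by rewrite addr_ge0 // sumr_ge0 // => j _; have [] := H2 j.
(* With [al * t = k + t] and [al >= 1], the final inequality becomes [al * (K + t) <= K], which is
   false for [t > 0]. *)
pose k := 2 * n%:R + 2 * K * (n%:R + t) + K.
have n0 : 0 <= n%:R :> R by rewrite ler0n.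
have k0 : 0 <= k by rewrite /k !addr_ge0 // ?mulr_ge0 // ?addr_ge0 // ltW.
pose al := k / t + 1.
have al1 : 1 <= al by rewrite lerDr divr_ge0 // ltW.
have alt : al * t = k + t by rewrite /al mulrDl divfK ?mul1r // gt_eqF.
pose E (x : V) : R := expR (- al * sqdist m x).
pose v (x : V) : R := E x - expR (- al * t).
pose v1 (i : 'I_n) (x : V) : R := - al * (2 * (x ord0 i - m ord0 i)) * E x.
pose v2 (i : 'I_n) (x : V) : R := (- al * 2 + (al * (2 * (x ord0 i - m ord0 i))) ^+ 2) * E x.
have dE i x : is_derive x (e_ i) E (v1 i x).
  rewrite /v1 mulrC; apply: (@isd_comp _ _ expR (fun x => - al * sqdist m x)).
  by apply: isdMc; exact: isd_sqdist.
have dv i x : is_derive x (e_ i) v (v1 i x).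
  by have := isdB (dE i x) (isd_cst (expR (- al * t)) x (e_ i)); rewrite subr0.
have ddv i x : is_derive x (e_ i) (v1 i) (v2 i x).
  have /is_derive_eq := isdM (isdMc (- al) (isd_sqdist2 m x i)) (dE i x).
  by apply; rewrite /v1 /v2; ring.
have cE x : {for x, continuous E}.
  apply: (@cts_comp _ _ expR (fun x => - al * sqdist m x)); last exact: continuous_expR.
  by apply: ctsM; [exact: cts_cst|exact: sqdist_cts].
have cv x : {for x, continuous v} by apply: ctsB; [exact: cE|exact: cts_cst].
have E0 x : 0 < E x by exact: expR_gt0.
have v_neg x : t < sqdist m x -> v x < 0.
  by move=> tx; rewrite subr_lt0 ltr_expR ltr_nM2l //; lra.
have v_lt1 x : v x < 1.
  rewrite /v ltrBlDr; apply: le_lt_trans (_ : 1 < _).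
    rewrite -expR0 ler_expR mulNr oppr_le0 mulr_ge0 ?sqdist_ge0 //; lra.
  by rewrite ltrDl expR_gt0.
have vz : v z = 0 by rewrite /v /E mz subrr.
pose P : set V := [set x | sqdist m x <= t] `&` [set x | sqdist z x = t / 4].
(* On the part of the sphere around [z] inside the closed ball around [m], compactness gives the gap
   [eta]; as [v < 1], the choice [ep = eta / 2] keeps [F] negative there. On the rest of the sphere
   [v < 0] and [w <= 0]. *)
have [eta eta0 Heta] : exists2 eta : R, 0 < eta & forall x, P x -> w x <= - eta.
  have [[x0 Px0]|/set0P/negP/negPn/eqP ->] := pselect (P !=set0); last by exists 1.
  have cP : compact P.
    apply: compact_closedI; first exact: compact_sqball.
    apply: (@closed_comp _ _ (sqdist z) [set y | y = t / 4]); last exact: closed_eq.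
    by move=> x _; exact: sqdist_cts.
  have PB x : P x -> B x by move=> [_ /= e]; rewrite /B /= e.
  have [|x Px|c [c1 /= c2] H] := @compact_max _ _ P w _ cP; first by exists x0.
    exact/cw/zN/PB.
  have wc : w c < 0.
    apply: neg => //; first by rewrite c2.
    by move=> cz; move: c2; rewrite cz sqdistxx => /esym/eqP; rewrite gt_eqF // divr_gt0.
  by exists (- w c) => [|x /H]; rewrite ?oppr_gt0 ?opprK.
pose ep := eta / 2.
have ep0 : 0 < ep by rewrite divr_gt0.
pose F (x : V) : R := w x + ep * v x.
have Bz : B z by rewrite /B /= sqdistxx; apply: divr_ge0 => //; exact: ltW.
have [|x Bx|q Bq Hq] := @compact_max _ _ B F _ cB; first by exists z.
  by apply: ctsD; [exact/cw/zN|apply: ctsM; [exact: cts_cst|exact: cv]].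
have Fz : F z = 0 by rewrite /F wz vz mulr0 addr0.
have Fq : 0 <= F q by rewrite -Fz; exact: Hq.
have wq := w_le0 (zN q Bq).
have vq : 0 <= v q.
  by rewrite -(pmulr_rge0 _ ep0); move: Fq; rewrite /F => Fq; lra.
have mq : sqdist m q <= t.
  by rewrite leNgt; apply/negP => /v_neg; rewrite ltNge vq.
have zq : sqdist z q < t / 4.
  rewrite lt_neqAle Bq andbT; apply/eqP => zq.
  have := Heta q (conj mq zq) => wq'.
  have : ep * v q <= ep by rewrite ger_pMr // ltW.
  by move: Fq; rewrite /F /ep => *; lra.
have oB : open [set x | sqdist z x < t / 4].
  apply: (@open_comp _ _ (sqdist z) [set y | y < t / 4]); last exact: open_lt.
  by move=> x _; exact: sqdist_cts.
have BN x : sqdist z x < t / 4 -> N x by move=> /ltW /zN.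
have crit i : w1 i q + ep * v1 i q = 0 /\ w2 i q + ep * v2 i q <= 0.
  apply: (@local_max_partials _ _ [set x | sqdist z x < t / 4] F
     (fun i x => w1 i x + ep * v1 i x) (fun i => w2 i q + ep * v2 i q) q oB zq).
  - by move=> {}i y /BN Ny; exact: isdD (dw i Ny) (isdMc ep (dv i y)).
  - by move=> {}i; exact: isdD (ddw i (BN q zq)) (isdMc ep (ddv i q)).
  - by apply: filterS (nbhs_sqball zq) => x xz; apply: Hq; exact: ltW.
have [Cq bq] := HK q Bq.
(* The maximum point stays away from [m], where the gradient of the barrier vanishes and its
   Laplacian has the wrong sign. *)
have s4 : t / 4 <= sqdist m q.
  by have := sqdist_tri m q z; rewrite mz (sqdistC q z); lra.
have L := Lw (BN q zq).
have S1 : \sum_i w2 i q <= - ep * \sum_i v2 i q.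
  rewrite mulr_sumr; apply: ler_sum => i _; have := (crit i).2; lra.
have S2 : \sum_i b i q * w1 i q = - ep * \sum_i b i q * v1 i q.
  rewrite mulr_sumr; apply: eq_bigr => i _; have := (crit i).1 => ?.
  have -> : w1 i q = - ep * v1 i q by lra.
  ring.
(* No sign of [C] is assumed: [0 <= F q] bounds [|w q|] by [ep * v q], hence the barrier absorbs the
   zeroth-order term. *)
have CL : - (ep * K * E q) <= C q * w q.
  have : `|C q * w q| <= ep * K * E q.
    rewrite normrM mulrAC mulrC; apply: ler_pM => //.
    rewrite ler0_norm //; apply: le_trans (_ : ep * v q <= _).
      by move: Fq; rewrite /F => ?; lra.
    by rewrite ler_pM2l // lerBlDr lerDl expR_ge0.
  by rewrite ler_norml => /andP[].
have S3 : \sum_i v2 i q = (- (2 * al * n%:R) + 4 * al ^+ 2 * sqdist m q) * E q.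
  rewrite -mulr_suml big_split /= sumr_const card_ord -mulr_natl; congr ((_ + _) * _).
    by ring.
  by rewrite /sqdist mulr_sumr; apply: eq_bigr => i _; ring.
have S4 : - (2 * al * K * (n%:R + t) * E q) <= \sum_i b i q * v1 i q.
  have -> : \sum_i b i q * v1 i q = - (\sum_i (b i q * (q ord0 i - m ord0 i))) * (2 * al * E q).
    rewrite -sumrN mulr_suml; apply: eq_bigr => i _; rewrite /v1; ring.
  rewrite mulNr lerN2.
  have -> : 2 * al * K * (n%:R + t) * E q = K * (n%:R + t) * (2 * al * E q) by ring.
  apply: ler_wpM2r; first by rewrite !mulr_ge0 //; [lra|exact: ltW].
  apply: le_trans (_ : \sum_i K * (1 + (q ord0 i - m ord0 i) ^+ 2) <= _).
    apply: ler_sum => i _; apply: le_trans (ler_norm _) _; rewrite normrM.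
    apply: ler_pM => //.
    set d := q ord0 i - m ord0 i; rewrite -(real_normK (num_real d)).
    by have := sqr_ge0 (`|d| - 1); rewrite !expr2 => ?; nra.
  rewrite -mulr_sumr ler_wpM2l // big_split /= sumr_const card_ord lerD2l.
  exact: mq.
have key : 4 * al ^+ 2 * sqdist m q - 2 * al * n%:R - 2 * al * K * (n%:R + t) <= K.
  rewrite -(ler_pM2r (E0 q)) -(ler_pM2l ep0).
  apply: le_trans (_ : ep * (\sum_i v2 i q + \sum_i b i q * v1 i q) <= _).
    by rewrite ler_pM2l // S3; move: S4; lra.
  by move: L CL S1; rewrite S2; lra.
have : al * (al * t) <= 4 * al ^+ 2 * sqdist m q.
  have al0 : 0 <= al ^+ 2 by exact: sqr_ge0.
  have := ler_wpM2l al0 s4; rewrite expr2; lra.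
rewrite alt => key2.
have : al * (k + t) <= 2 * al * n%:R + 2 * al * K * (n%:R + t) + K by lra.
rewrite {1}/k; nra.
Qed.

(** If the zero set were not open at [a], a nonzero point [y] near [a] would have a nearest zero
    [z]. The ball centred at [y] may touch other zeros, but the ball on the segment from [y] to [z]
    as diameter meets the zero set only at [z], and Hopf's barrier applies to it. *)
Lemma strong_max_principle p : connected N -> N p -> w p = 0 ->
  forall x, N x -> w x = 0.
Proof.
move=> cN Np wp; suff : N `<=` [set x | w x = 0] by [].
apply: connected_clopen_sub => //; first by exists p.
- move=> a Na /= wa; apply: contrapT => nnear.
  have [r0 r00 rN0] := open_sqball oN Na.
  (* All points considered lie within distance [4r] of [a]. *)
  pose r := r0 / 5.
  have r_gt0 : 0 < r by rewrite divr_gt0.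
  have rN x : sqdist a x <= 16 * r ^+ 2 -> N x.
    move=> H; apply: rN0 => /=; apply: le_lt_trans H _.
    have -> : r0 = 5 * r by rewrite /r mulrC divfK.
    have : 0 < r ^+ 2 by rewrite exprn_gt0.
    by rewrite !expr2 => ?; nra.
  have r2 : 0 < r ^+ 2 by rewrite exprn_gt0.
  have [y [ay wy]] : exists y, sqdist a y < r ^+ 2 /\ w y <> 0.
    apply: contrapT => H; apply: nnear.
    have : sqdist a a < r ^+ 2 by rewrite sqdistxx.
    move=> /nbhs_sqball; apply: filterS => x ax /=.
    by apply: contrapT => wx; apply: H; exists x.
  pose K : set V := [set x | sqdist a x <= 4 * r ^+ 2] `&` [set x | w x = 0].
  have KN x : sqdist a x <= 4 * r ^+ 2 -> N x by move=> ?; apply: rN; lra.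
  have cK : compact K.
    suff -> : K = [set x | sqdist a x <= 4 * r ^+ 2] `&` closure K.
      by apply: compact_closedI; [exact: compact_sqball|exact: closed_closure].
    apply/seteqP; split=> x; first by move=> Kx; split; [exact: Kx.1|exact: subset_closure].
    move=> [/= ax clx]; split=> //=; apply: contrapT => /eqP wx.
    have nx : \forall y \near x, w y != 0.
      have /cvgr_neq0 := cw (KN x ax); exact.
    by have [z [[_ /= zz] /=]] := clx _ nx; rewrite zz eqxx.
  (* [z] is a zero nearest to [y]. It is sought within distance [2r] of [a], a region that contains
     every point at distance at most [r] from [y]. *)
  have [||z [/= az wz] Hz] := @compact_min _ _ K (sqdist y) _ cK.
  - by exists a; split=> //=; rewrite sqdistxx; lra.
  - by move=> x _; exact: sqdist_cts.
  pose m : V := 2^-1 *: (y + z).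
  have mE i : m ord0 i = (y ord0 i + z ord0 i) / 2 by rewrite !mxE mulrC.
  have yz : sqdist y z < r ^+ 2.
    apply: le_lt_trans (Hz a _) _; last by rewrite sqdistC.
    by split=> //=; rewrite sqdistxx; lra.
  have tE : sqdist m z = sqdist y z / 4.
    by rewrite /sqdist mulr_suml; apply: eq_bigr => i _; rewrite mE; field.
  have t0 : 0 < sqdist m z.
    rewrite tE divr_gt0 // lt_neqAle sqdist_ge0 andbT eq_sym; apply/eqP => /sqdist_eq0 zy.
    by apply: wy; rewrite -zy.
  (* Median formula for the midpoint [m]: a point of the smaller ball other than [z] is strictly
     closer to [y] than [z] is, so it is no zero. *)
  have par x : sqdist y x + sqdist z x = 2 * sqdist m x + 2 * sqdist m z.
    by rewrite /sqdist !mulr_sumr -!big_split /=; apply: eq_bigr => i _; rewrite !mE; field.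
  apply: (@no_interior_touching m z (sqdist m z) t0 erefl wz).
  - move=> x zx; apply: rN.
    by have := sqdist_tri a z x; lra.
  - move=> x mx zx xz.
    have zx0 : 0 < sqdist z x.
      by rewrite lt_neqAle sqdist_ge0 andbT eq_sym; apply/eqP => /sqdist_eq0.
    have yx : sqdist y x < sqdist y z by have := par x; lra.
    have ax : sqdist a x <= 4 * r ^+ 2 by have := sqdist_tri a y x; lra.
    rewrite lt_neqAle (w_le0 (KN x ax)) andbT; apply/eqP => wx.
    by have := Hz x (conj ax wx); rewrite leNgt yx.
- move=> x Nx clx /=; apply: contrapT => /eqP wx.
  have nx : \forall y \near x, w y != 0 by have /cvgr_neq0 := cw Nx; exact.
  by have [z [[_ /= zz] /=]] := clx _ nx; rewrite zz eqxx.
Qed.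

End StrongMaximum.

(** * Harmonic functions *)

Local Opaque partial.

Section Harmonic.
Context {R : realType} {n : nat}.
Local Notation V := 'rV[R]_n.
Local Notation e_ := (ebasis R).
Implicit Types (U : set V) (h : V -> R).

Definition harmonic_on U h := smooth_on U h /\ forall x, U x -> laplacian h x = 0.

Lemma laplacian_partial U h i x : open U -> smooth_on U h -> U x ->
  laplacian (partial i h) x = partial i (laplacian h) x.
Proof.
move=> oU sh Ux; apply/esym/partial_val.
apply: isd_sum => j.
have E := etrans (partial_open j oU Ux (fun y Uy => partialC j i oU sh Uy))
                 (partialC j i oU (smooth_partial j sh) Ux).
rewrite E; exact: smooth_isd (smooth_partial j (smooth_partial j sh)) Ux.
Qed.

Lemma laplacian_cst_partial U h i c : open U -> smooth_on U h ->
  (forall x, U x -> laplacian h x = c) ->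
  forall x, U x -> laplacian (partial i h) x = 0.
Proof.
move=> oU sh hc x Ux; rewrite (laplacian_partial i oU sh Ux).
by rewrite (partial_open i oU Ux hc); apply: partial_val; exact: isd_cst.
Qed.

Lemma harmonic_partial U h i : open U -> harmonic_on U h -> harmonic_on U (partial i h).
Proof.
by move=> oU [sh lh]; split; [exact: smooth_partial|exact: laplacian_cst_partial oU sh lh].
Qed.

(** Adding [ep * sqdist a x] makes the Laplacian strictly positive, which is impossible at an
    interior maximum. The product [ep * r^2] is half of the supposed gap [f a - m], so the sphere
    stays below [f a]. *)
Lemma ball_max_principle (f : V -> R) (f1 f2 : 'I_n -> V -> R) (a : V) (r m : R) :
  (0 < n)%N -> 0 < r ->
  (forall x, sqdist a x <= r ^+ 2 -> {for x, continuous f}) ->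
  (forall i x, sqdist a x < r ^+ 2 -> is_derive x (e_ i) f (f1 i x)) ->
  (forall i x, sqdist a x < r ^+ 2 -> is_derive x (e_ i) (f1 i) (f2 i x)) ->
  (forall x, sqdist a x < r ^+ 2 -> 0 <= \sum_i f2 i x) ->
  (forall x, sqdist a x = r ^+ 2 -> f x <= m) -> f a <= m.
Proof.
move=> n0 r0 cf df ddf sub bd; rewrite leNgt; apply/negP => am.
have r2 : 0 < r ^+ 2 by rewrite exprn_gt0.
pose ep := (f a - m) / (2 * r ^+ 2).
have ep0 : 0 < ep by rewrite divr_gt0 ?subr_gt0 // mulr_gt0.
have epE : ep * r ^+ 2 = (f a - m) / 2.
  by rewrite /ep; field; rewrite lt0r_neq0.
pose F (x : V) : R := f x + ep * sqdist a x.
have [||q /= Bq Hq] := @compact_max _ _ [set x | sqdist a x <= r ^+ 2] F _ (@compact_sqball _ _ a (r ^+ 2)).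
- by exists a; rewrite /= sqdistxx ltW.
- by move=> x /= /cf cfx; apply: ctsD => //; apply: ctsM; [exact: cts_cst|exact: sqdist_cts].
have Fq : f a <= F q.
  by have := Hq a; rewrite /F sqdistxx mulr0 addr0; apply; rewrite ltW.
have qr : sqdist a q < r ^+ 2.
  rewrite lt_neqAle Bq andbT; apply/eqP => qE.
  have := bd q qE; move: Fq; rewrite /F qE epE; clear -am; lra.
have oB : open [set x | sqdist a x < r ^+ 2].
  apply: (@open_comp _ _ (sqdist a) [set y | y < r ^+ 2]); last exact: open_lt.
  by move=> x _; exact: sqdist_cts.
have crit i : f2 i q + ep * 2 <= 0.
  suff [] : f1 i q + ep * (2 * (q ord0 i - a ord0 i)) = 0 /\ f2 i q + ep * 2 <= 0 by [].
  apply: (@local_max_partials _ _ _ F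
     (fun i x => f1 i x + ep * (2 * (x ord0 i - a ord0 i))) (fun i => f2 i q + ep * 2) q oB qr).
  - by move=> {}i y yr; exact: isdD (df i y yr) (isdMc ep (isd_sqdist a y i)).
  - by move=> {}i; exact: isdD (ddf i q qr) (isdMc ep (isd_sqdist2 a q i)).
  - by apply: filterS (nbhs_sqball qr) => x xr; apply: Hq; exact: ltW.
have : \sum_i (f2 i q + ep * 2) <= 0 by apply: sumr_le0 => i _; exact: crit.
rewrite big_split /= sumr_const card_ord leNgt => /negP; apply.
by apply: ltr_wpDl; [exact: sub|rewrite pmulrn_rgt0 // mulr_gt0].
Qed.

(* Bernstein's trick: [(r^2 - |x-a|^2)^2 (d_i h)^2 + lam h^2] is subharmonic
   for [lam = (12 + 2 n) r^2]. *)
Lemma harmonic_partial_bound U h i a (r M : R) : open U -> harmonic_on U h ->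
  0 < r -> (forall x, sqdist a x <= r ^+ 2 -> U x /\ `|h x| <= M) ->
  `|partial i h a| * r <= (12 + 2 * n%:R) * M.
Proof.
move=> oU hh r0 HM; have [sh lh] := hh.
have [sg lg] := harmonic_partial i oU hh.
have n0 : (0 < n)%N := leq_trans (ltn0Sn i) (ltn_ord i).
pose lam : R := (12 + 2 * n%:R) * r ^+ 2.
have r2 : 0 < r ^+ 2 by rewrite exprn_gt0.
have nn : 0 <= n%:R :> R by rewrite ler0n.
have lam0 : 0 <= lam by rewrite mulr_ge0 // ?addr_ge0 ?mulr_ge0 // ltW.
have HU x : sqdist a x <= r ^+ 2 -> U x by case/HM.
have M0 : 0 <= M.
  by have [|_] := HM a; [rewrite sqdistxx ltW|apply: le_trans].
have := HU.
move: sg lg sh lh; rewrite /laplacian.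
have [g hg] : {g | g = partial i h} by exists (partial i h).
rewrite -hg => sg lg sh lh _.
pose et (x : V) : R := r ^+ 2 - sqdist a x.
pose et1 (j : 'I_n) (x : V) : R := - (2 * (x ord0 j - a ord0 j)).
have det j x : is_derive x (e_ j) et (et1 j x).
  by have := isdB (isd_cst (r ^+ 2) x (e_ j)) (isd_sqdist a x j); rewrite sub0r.
have ddet j x : is_derive x (e_ j) (et1 j) (- 2) := isdN (isd_sqdist2 a x j).
pose f (x : V) : R := (et x * g x) ^+ 2 + lam * h x ^+ 2.
pose p1 (j : 'I_n) (x : V) : R := et1 j x * g x + et x * partial j g x.
pose f1 (j : 'I_n) (x : V) : R := 2 * ((et x * g x) * p1 j x) + lam * (2 * (h x * partial j h x)).
pose f2 (j : 'I_n) (x : V) : R :=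
  2 * (p1 j x ^+ 2 + (et x * g x) * (- 2 * g x + 2 * (et1 j x * partial j g x)
        + et x * partial j (partial j g) x))
  + lam * (2 * (partial j h x ^+ 2 + h x * partial j (partial j h) x)).
have cet x : {for x, continuous et} by apply: ctsB; [exact: cts_cst|exact: sqdist_cts].
have fa : f a <= lam * M ^+ 2.
  apply: (@ball_max_principle f f1 f2 a r _ n0 r0).
  - move=> x /HU Ux; apply: ctsD.
      by apply: ctsX; apply: ctsM; [exact: cet|exact: smooth_continuous sg Ux].
    by apply: ctsM; [exact: cts_cst|apply: ctsX; exact: smooth_continuous sh Ux].
  - move=> j x /ltW /HU Ux.
    have dg := smooth_isd j sg Ux; have dh := smooth_isd j sh Ux.
    have dp := isdM (det j x) dg.
    have /is_derive_eq := isdD (isdX 2 dp) (isdMc lam (isdX 2 dh)); apply.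
    rewrite /f1 /p1 /= !expr1; clear; move: (et x) (et1 j x) (g x) (h x) (partial j g x) (partial j h x).
    by move=> *; ring.
  - move=> j x /ltW /HU Ux.
    have dg := smooth_isd j sg Ux; have dh := smooth_isd j sh Ux.
    have ddg := smooth_isd j (smooth_partial j sg) Ux.
    have ddh := smooth_isd j (smooth_partial j sh) Ux.
    have dp := isdM (det j x) dg.
    have dp1 := isdD (isdM (ddet j x) dg) (isdM (det j x) ddg).
    have /is_derive_eq := isdD (isdMc 2 (isdM dp dp1)) (isdMc lam (isdMc 2 (isdM dh ddh))).
    apply; rewrite /f2 /p1; clear.
    move: (et x) (et1 j x) (g x) (h x) (partial j g x) (partial j h x)
      (partial j (partial j g) x) (partial j (partial j h) x).
    by move=> *; ring.
  - move=> x xr; have Ux := HU x (ltW xr).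
    have e0 : 0 <= et x by rewrite subr_ge0 ltW.
    have er : et x <= r ^+ 2 by rewrite gerBl sqdist_ge0.
    pose S := \sum_j (8 * (x ord0 j - a ord0 j) ^+ 2 * g x ^+ 2
        - 4 * et x * g x ^+ 2 + (2 * et x ^+ 2 * partial j g x ^+ 2
        - 16 * et x * (x ord0 j - a ord0 j) * g x * partial j g x)
        + 2 * lam * partial j h x ^+ 2).
    have -> : \sum_j f2 j x = S.
      transitivity (S + 2 * et x ^+ 2 * g x * (\sum_j partial j (partial j g) x)
          + 2 * lam * h x * (\sum_j partial j (partial j h) x)); last first.
        transitivity (S + 2 * et x ^+ 2 * g x * 0 + 2 * lam * h x * 0).
          by congr (_ + _ * _ + _ * _); [exact: lg|exact: lh].
        by rewrite !mulr0 !addr0.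
      rewrite /S !mulr_sumr -!big_split /=; apply: eq_bigr => j _.
      rewrite /f2 /p1 /et1; clear.
      move: (et x) (x ord0 j - a ord0 j) (g x) (h x) (partial j g x) (partial j h x)
        (partial j (partial j g) x) (partial j (partial j h) x).
      by move=> *; ring.
    (* The square [2 (p s - 4 d q)^2] absorbs the cross term and turns the coefficient 8 into -24.
       The value of [lam] is then just large enough: [|grad h|^2 >= g^2] leaves the nonnegative
       [G (24 (r^2 - |x-a|^2) + 4 n |x-a|^2)], with [G = g^2]. *)
    apply: le_trans (_ : \sum_j (- 24 * g x ^+ 2 * (x ord0 j - a ord0 j) ^+ 2 - 4 * et x * g x ^+ 2
        + 2 * lam * partial j h x ^+ 2) <= _); last first.
      apply: ler_sum => j _; clear.
      move: (et x) (x ord0 j - a ord0 j) (g x) (partial j g x) (2 * lam * partial j h x ^+ 2).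
      move=> p d q s L; have := sqr_ge0 (p * s - 4 * d * q); rewrite !expr2; lra.
    rewrite !big_split /= -!mulr_sumr sumr_const card_ord -[_ *+ n]mulr_natl.
    rewrite -/(sqdist a x).
    have : g x ^+ 2 <= \sum_j partial j h x ^+ 2.
      by rewrite hg (bigD1 i) //= lerDl; apply: sumr_ge0 => j _; exact: sqr_ge0.
    have := sqdist_ge0 a x.
    move: er e0 xr lam0; rewrite /lam /et.
    have := sqr_ge0 (g x).
    move: (\sum_j partial j h x ^+ 2) (g x ^+ 2) (sqdist a x) (r ^+ 2) r2 (n%:R : R) nn; clear.
    move=> S G s q q0 N N0 G0 _ _ sq L0 s0 GS.
    apply: le_trans (_ : 2 * ((12 + 2 * N) * q) * G - 24 * G * s - 4 * N * (q - s) * G <= _).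
      have -> : 2 * ((12 + 2 * N) * q) * G - 24 * G * s - 4 * N * (q - s) * G
        = G * (24 * (q - s) + 4 * N * s) by ring.
      by rewrite mulr_ge0 // addr_ge0 // ?mulr_ge0 // subr_ge0 ltW.
    have := ler_wpM2l L0 GS; lra.
  - move=> x xr; have [Ux hM] := HM x (eq_ind_r (fun s => s <= r ^+ 2) (lexx _) xr).
    rewrite /f /et xr subrr mul0r expr0n /= add0r ler_wpM2l //.
    by rewrite -(real_normK (num_real (h x))) lerXn2r // nnegrE.
have : r ^+ 2 * (r * g a) ^+ 2 <= r ^+ 2 * ((12 + 2 * n%:R) * M ^+ 2).
  apply: le_trans (_ : f a <= _); last first.
    apply: le_trans fa _; rewrite /lam [leRHS]mulrA (mulrC (r ^+ 2)).
    exact: lexx.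
  rewrite /f /et sqdistxx subr0; apply: le_trans (_ : (r ^+ 2 * g a) ^+ 2 <= _).
    have -> : r ^+ 2 * (r * g a) ^+ 2 = (r ^+ 2 * g a) ^+ 2 by ring.
    exact: lexx.
  by rewrite lerDl mulr_ge0 // sqr_ge0.
rewrite ler_pM2l // => H.
rewrite -(ler_pXn2r (n := 2)) ?nnegrE //; last 2 first.
- by rewrite mulr_ge0 // ltW.
- by rewrite mulr_ge0 // addr_ge0 // mulr_ge0.
rewrite exprMn real_normK ?num_real // -exprMn mulrC; apply: le_trans H _.
rewrite [leRHS]exprMn ler_wpM2r ?sqr_ge0 // expr2 ler_peMl //; move: nn; clear; lra.
Qed.

End Harmonic.

(** * Factorial estimates, analyticity on lines and unique continuation *)

Section Taylor.
Context {R : realType}.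

Lemma nonneg_derive_le (f df : R -> R) (s : R) : 0 <= s ->
  (forall t : R, 0 <= t <= s -> is_derive t 1 f (df t)) ->
  (forall t : R, 0 <= t <= s -> 0 <= df t) -> f 0 <= f s.
Proof.
move=> s0 d p; have [|c] := @MVT_sym R f df 0 s.
  by rewrite min_l // max_r //.
rewrite min_l // max_r // => cs E; rewrite -subr_ge0 E subr0 mulr_ge0 //; exact: p.
Qed.

(** The bound on [g k] is integrated [k] times; monotonicity of [B t^(k+1)/(k+1)!] plus or minus
    [g 0] replaces each integral. *)
Lemma taylor_bound (g : nat -> R -> R) (s0 B : R) (k : nat) :
  (forall j (s : R), 0 <= s <= s0 -> is_derive s 1 (g j) (g j.+1 s)) ->
  (forall j, g j 0 = 0) ->
  (forall s, 0 <= s <= s0 -> `|g k s| <= B) ->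
  forall s, 0 <= s <= s0 -> `|g 0%N s| <= B * s ^+ k / (k`!)%:R.
Proof.
elim: k g => [|k ih] g dg g0 gB s ss0.
  by rewrite expr0 fact0 divr1 mulr1; exact: gB.
have H1 t : 0 <= t <= s0 -> `|g 1%N t| <= B * t ^+ k / (k`!)%:R.
  by apply: (ih (fun j => g j.+1)) => // j; exact: dg.
have /andP[s_ge0 ss] := ss0.
have dpow (t : R) : is_derive t 1 (fun t => B / (k.+1`!)%:R * t ^+ k.+1) (B * t ^+ k / (k`!)%:R).
  have /is_derive_eq := isdMc (B / (k.+1`!)%:R) (isdX k.+1 (is_derive_id t (1 : R))).
  apply; rewrite factS natrM /= mulr1; field.
  by rewrite nat1r !pnatr_eq0 -lt0n fact_gt0.
have ts t : 0 <= t <= s -> 0 <= t <= s0.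
  by case/andP => -> ts /=; exact: le_trans ss.
have z0 : B / (k.+1`!)%:R * 0 ^+ k.+1 = 0 by rewrite expr0n /= mulr0.
have E : B * s ^+ k.+1 / (k.+1`!)%:R = B / (k.+1`!)%:R * s ^+ k.+1 by rewrite mulrAC.
rewrite E ler_norml; apply/andP; split.
- have := @nonneg_derive_le (fun t => B / (k.+1`!)%:R * t ^+ k.+1 + g 0%N t) _ s s_ge0
    (fun t tt => isdD (dpow t) (dg 0%N t (ts t tt))).
  rewrite z0 g0 addr0 => H; rewrite lerNl -subr_ge0 opprK H // => t tt.
  by have := H1 t (ts t tt); rewrite ler_norml -subr_ge0 opprK addrC => /andP[].
- have := @nonneg_derive_le (fun t => B / (k.+1`!)%:R * t ^+ k.+1 - g 0%N t) _ s s_ge0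
    (fun t tt => isdB (dpow t) (dg 0%N t (ts t tt))).
  rewrite z0 g0 subr0 => H; rewrite -subr_ge0 H // => t tt.
  by have := H1 t (ts t tt); rewrite ler_norml subr_ge0 => /andP[].
Qed.

(** The induction step is [(1 + 1/k)^k <= e]. It pays for the factor [k^k] that arises when a fixed
    margin is divided among [k] derivatives. *)
Lemma expn_le_fact k : (k%:R : R) ^+ k <= expR 1 ^+ k * (k`!)%:R.
Proof.
elim: k => [|k ih]; first by rewrite !expr0 mulr1 lexx.
case: k ih => [|k] ih.
  by rewrite !expr1 mulr1 -[X in X <= _]expR0 ler_expR ler01.
have k0 : 0 < (k.+1%:R : R) by rewrite ltr0n.
have -> : (k.+2%:R : R) = k.+1%:R * (1 + k.+1%:R^-1).
  by rewrite mulrDr mulr1 divff ?gt_eqF // natr1.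
have H : (1 + k.+1%:R^-1) ^+ k.+1 <= expR 1 :> R.
  have -> : expR 1 = expR (k.+1%:R^-1) ^+ k.+1 :> R.
    by rewrite -expRM_natl divff // gt_eqF.
  by rewrite lerXn2r ?nnegrE ?addr_ge0 ?expR_ge0 ?expR_ge1Dx // invr_ge0 ltW.
have -> : (k.+1%:R * (1 + k.+1%:R^-1)) ^+ k.+2 =
    k.+1%:R * (1 + k.+1%:R^-1) * ((1 + k.+1%:R^-1) ^+ k.+1 * k.+1%:R ^+ k.+1) :> R.
  by rewrite exprS exprMn [X in _ * X]mulrC.
have -> : expR 1 ^+ k.+2 * (k.+2`!)%:R =
    k.+1%:R * (1 + k.+1%:R^-1) * (expR 1 * (expR 1 ^+ k.+1 * (k.+1`!)%:R)) :> R.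
  rewrite factS natrM mulrDr mulr1 divff ?gt_eqF // natr1 (exprS _ k.+1).
  by rewrite mulrCA -!mulrA.
apply: ler_wpM2l; first by rewrite mulr_ge0 ?addr_ge0 ?invr_ge0 // ltW.
by apply: ler_pM => //; rewrite exprn_ge0 // ?addr_ge0 ?invr_ge0 // ltW.
Qed.

End Taylor.

Section UniqueContinuation.
Context {R : realType} {n : nat}.
Local Notation V := 'rV[R]_n.
Local Notation e_ := (ebasis R).
Local Notation C := (12 + 2 * n%:R : R).
Implicit Types (U : set V) (h : V -> R) (a x y z : V).

Definition cube a (rho : R) x := forall j, `|x ord0 j - a ord0 j| <= rho.

Lemma harmonic_iterD U h s : open U -> harmonic_on U h -> harmonic_on U (Defs.iterD s h).
Proof.
by move=> oU hh; elim: s => [|i s ih]; [exact: hh|exact: harmonic_partial oU ih].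
Qed.

(** Each derivative gives up a margin [de] of the cube, so that the ball of radius [de] needed by
    [harmonic_partial_bound] fits, and costs a factor [C / de]. *)
Lemma harmonic_iter_bound U h i a (rho M de : R) k : open U -> harmonic_on U h ->
  0 < de -> (forall x, cube a rho x -> U x /\ `|h x| <= M) ->
  forall x, cube a (rho - k%:R * de) x ->
    `|Defs.iterD (nseq k i) h x| <= (C / de) ^+ k * M.
Proof.
move=> oU hh de0 HM; elim: k => [|k ih] x cx.
  by rewrite expr0 mul1r; have [] := HM x; rewrite // mul0r subr0 in cx.
have := @harmonic_partial_bound _ _ U (Defs.iterD (nseq k i) h) i x de
   ((C / de) ^+ k * M) oU (harmonic_iterD _ oU hh) de0.
rewrite -ler_pdivlMr // => H.
apply: le_trans (H _) _; last by rewrite exprS mulrAC mulrA.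
move=> y xy.
have cy : cube a (rho - k%:R * de) y.
  move=> j; apply: le_trans (ler_distD (x ord0 j) _ _) _.
  apply: le_trans (_ : de + (rho - k.+1%:R * de) <= _).
    apply: lerD; last exact: cx.
    rewrite -(ler_pXn2r (n := 2)) ?nnegrE //; last exact: ltW.
    by rewrite real_normK ?num_real //; apply: le_trans xy; exact: sqdist_coord.
  by rewrite -natr1 mulrDl mul1r; clear; lra.
split; last exact: ih.
have [|//] := HM y; move=> j; apply: le_trans (cy j) _.
by rewrite gerBl mulr_ge0 // ltW.
Qed.

Lemma iterD_zero U h s : open U -> (forall x, U x -> h x = 0) ->
  forall x, U x -> Defs.iterD s h x = 0.
Proof.
move=> oU h0; elim: s => [//|i s ih] x Ux /=.
by rewrite (partial_open i oU Ux ih); apply: partial_val; exact: isd_cst.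
Qed.

(** All Taylor coefficients at [z] along the line vanish, and the remainder of order [k] is at most
    [M (2 e C |s| / rho)^k]. The bound on [|s|] makes the ratio at most 1/4, so the remainder tends
    to 0. *)
Lemma harmonic_line_zero U h i a z (rho M s : R) : open U -> harmonic_on U h ->
  0 < rho -> (forall x, cube a rho x -> U x /\ `|h x| <= M) ->
  (\forall x \near z, h x = 0) ->
  (forall t, `|t| <= `|s| -> cube a (rho / 2) (z + t *: e_ i)) ->
  `|s| <= rho / (8 * C * expR 1) -> h (z + s *: e_ i) = 0.
Proof.
move=> oU hh rho0 HM hz cs sr.
have C0 : 0 < C by apply: ltr_wpDr => //; rewrite mulr_ge0 // ler0n.
have E0 : 0 < expR 1 :> R by exact: expR_gt0.
have M0 : 0 <= M.
  have [|_] := HM (z + 0 *: e_ i); last by apply: le_trans.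
  by move=> j; apply: le_trans (cs 0 _ j) _; rewrite ?normr0 // ler_pdivrMr //; move: rho0; clear; lra.
(* Factoring out the sign of [s] puts the expansion on [[0, |s|]], where [taylor_bound] works. *)
pose sg : R := (-1) ^+ (s < 0)%R.
have sgs : s = sg * `|s| by rewrite /sg -numEsign.
have sg1 : `|sg| = 1 by rewrite /sg normrX normrN1 expr1n.
pose g j t : R := sg ^+ j * Defs.iterD (nseq j i) h (z + (sg * t) *: e_ i).
have Uz t : 0 <= t <= `|s| -> cube a (rho / 2) (z + (sg * t) *: e_ i).
  by move=> /andP[t0 ts]; apply: cs; rewrite normrM sg1 mul1r ger0_norm.
have c2 x : cube a (rho / 2) x -> cube a rho x.
  by move=> H j; apply: le_trans (H j) _; rewrite ler_pdivrMr //; move: rho0; clear; lra.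
have dg j (t : R) : 0 <= t <= `|s| -> is_derive t 1 (g j) (g j.+1 t).
  move=> ts; have [sj _] := harmonic_iterD (nseq j i) oU hh.
  have Ut : U (z + (sg * t) *: e_ i) by have [] := HM _ (c2 _ (Uz t ts)).
  have d1 := is_derive_line (smooth_isd i sj Ut).
  have d2 : is_derive t 1 (fun t => sg * t) (sg * 1) := isdMc sg (is_derive_id t (1 : R)).
  have /is_derive_eq := isdMc (sg ^+ j) (isd_comp d1 d2); apply.
  by rewrite /g /= mulr1 exprS; move: (partial _ _ _) (sg ^+ j) => D S; ring.
have g0 j : g j 0 = 0.
  rewrite /g mulr0 scale0r addr0.
  rewrite (@iterD_zero [set x | h x = 0]° h _ _ _ z) ?mulr0 //; first exact: open_interior.
  by move=> x /interior_subset.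
have bnd k : (0 < k)%N -> `|h (z + s *: e_ i)| <= M / k%:R.
  move=> k0; have k0' : 0 < (k%:R : R) by rewrite ltr0n.
  (* The [k] margins together use up exactly half of [rho]. *)
  pose de := rho / (2 * k%:R).
  have de0 : 0 < de by rewrite divr_gt0 // mulr_gt0.
  have kde : rho - k%:R * de = rho / 2 by rewrite /de; field; rewrite gt_eqF.
  have gk t : 0 <= t <= `|s| -> `|g k t| <= (C / de) ^+ k * M.
    move=> ts; rewrite /g normrM normrX sg1 expr1n mul1r.
    by apply: (harmonic_iter_bound i oU hh de0 HM); rewrite kde; exact: Uz.
  have ss : 0 <= `|s| <= `|s| by rewrite normr_ge0 lexx.
  have := @taylor_bound R g `|s| ((C / de) ^+ k * M) k dg g0 gk `|s| ss.
  rewrite /g /= expr0 mul1r -sgs => H; apply: le_trans H _.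
  have f0 : 0 < ((k`!)%:R : R) by rewrite ltr0n fact_gt0.
  rewrite ler_pdivrMr // mulrAC -exprMn.
  have P0 : 0 <= 2 * C * `|s| / rho by rewrite divr_ge0 ?mulr_ge0 // ltW.
  have -> : C / de * `|s| = k%:R * (2 * C * `|s| / rho).
    by rewrite /de; field; rewrite !gt_eqF.
  rewrite exprMn; apply: le_trans (_ : expR 1 ^+ k * (k`!)%:R * (2 * C * `|s| / rho) ^+ k * M <= _).
    by rewrite ler_wpM2r // ler_wpM2r ?exprn_ge0 // expn_le_fact.
  have -> : expR 1 ^+ k * (k`!)%:R * (2 * C * `|s| / rho) ^+ k * M =
     (expR 1 * (2 * C * `|s| / rho)) ^+ k * (M * (k`!)%:R).
    rewrite [(expR 1 * _) ^+ k]exprMn.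
    by move: (_ ^+ k) (expR 1 ^+ k) (k`!%:R) => q p f; ring.
  have -> : M / k%:R * (k`!)%:R = k%:R^-1 * (M * (k`!)%:R) by ring.
  apply: ler_wpM2r; first by rewrite mulr_ge0 // ltW.
  apply: le_trans (_ : (2^-1) ^+ k <= _).
    apply: lerXn2r; rewrite ?nnegrE ?invr_ge0 ?ler0n //.
      by apply: mulr_ge0 => //; exact: ltW.
    rewrite mulrA ler_pdivrMr //.
    have H8 : 0 < 8 * C * expR 1 by rewrite !mulr_gt0.
    move: sr; rewrite ler_pdivlMr // => sr'.
    move: rho0 C0 E0 sr'; clear; move: (expR 1) (12 + 2 * n%:R) `|s| => e c t r0 c0 e0.
    by nra.
  rewrite exprVn lef_pV2 ?posrE ?exprn_gt0 // -natrX ler_nat.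
  exact/ltnW/ltn_expl.
apply/eqP; rewrite -normr_le0 leNgt; apply/negP => H0.
have := bnd (Num.bound (M / `|h (z + s *: e_ i)|)).+1 isT.
rewrite ler_pdivlMr ?ltr0n // -ler_pdivlMl // mulrC leNgt => /negP; apply.
apply: lt_le_trans (archi_boundP _) _; last by rewrite ler_nat.
by rewrite mulr_ge0 // invr_ge0.
Qed.

(** The points near which [h] vanishes form an open set. It is relatively closed because the
    admissible step [s1] depends only on a bound for [h] on a cube around the limit point [a]: from
    a point of the set within [s1], axis-parallel steps carry the vanishing neighbourhood to [a]. *)
Lemma harmonic_unique_continuation U h p : open U -> connected U ->
  harmonic_on U h -> U p -> (\forall x \near p, h x = 0) ->
  forall x, U x -> h x = 0.
Proof.
move=> oU cU hh Up hp.
suff H : U `<=` [set x | \forall y \near x, h y = 0].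
  by move=> x /H /nbhs_singleton.
apply: connected_clopen_sub => //; first by exists p.
  by move=> x Ux /= /nbhs_interior; apply: filterS => y /=; rewrite /interior.
move=> a Ua cla /=.
have C12 : 12 <= C by rewrite lerDl mulr_ge0 // ler0n.
have E1 : 1 <= expR 1 :> R by rewrite -[X in X <= _]expR0 ler_expR ler01.
have [sh _] := hh.
have nM : \forall x \near a, `|h x| < `|h a| + 1.
  have ca : {for a, continuous (fun x => `|h x|)}.
    by apply: (cts_comp (smooth_continuous sh Ua)); exact: norm_continuous.
  by apply: (cvgr_lt _ ca); rewrite ltrDl.
have /nbhs_ballP[r /= r0 rU] : nbhs a (U `&` [set x | `|h x| < `|h a| + 1]).
  by apply: filterI => //; exact: open_nbhs_nbhs.
pose rho := r / 2.
have rho0 : 0 < rho by rewrite divr_gt0.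
have HM x : cube a rho x -> U x /\ `|h x| <= `|h a| + 1.
  move=> cx; have [] : (U `&` [set x | `|h x| < `|h a| + 1]) x; last by move=> ? /= /ltW.
  apply: rU; apply/rV_ballP; split=> // j; rewrite distrC; apply: le_lt_trans (cx j) _.
  by rewrite ltr_pdivrMr // ltr_pMr // ltr1n.
pose s1 := rho / (8 * C * expR 1).
have CE : 8 <= 8 * C * expR 1.
  by move: E1 C12; clear; move: (expR 1) (12 + 2 * n%:R) => e c e1 c1; nra.
have CE0 : 0 < 8 * C * expR 1 by apply: lt_le_trans CE.
have s10 : 0 < s1 by rewrite divr_gt0.
have s18 : s1 <= rho / 8.
  by rewrite /s1 ler_wpM2l ?(ltW rho0) // lef_pV2 ?posrE.
have [z [[Uz hz] /rV_ballP[_ az]]] := cla _ (nbhsx_ballx a s1 s10).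
suff [] : (\forall y \near a, h y = 0) /\ True by [].
apply: (@coordinate_walk _ _ (fun w => (\forall y \near w, h y = 0) /\ True) z a) => //.
move=> w i [/nbhs_ballP[ep /= ep0 epH] _] wz wi; split=> //.
set s := _ - _.
have s_s1 : `|s| <= s1 by apply/ltW; exact: az.
pose d := Num.min ep (rho / 8).
have d0 : 0 < d by rewrite lt_min ep0 divr_gt0.
apply/nbhs_ballP; exists d => //= y /rV_ballP[_ wy].
have yE : y = (y - s *: e_ i) + s *: e_ i by rewrite subrK.
have wy' : ball w d (y - s *: e_ i).
  apply/rV_ballP; split=> // j; have := wy j; rewrite line_coord !mxE eqxx /=.
  by rewrite opprD opprK addrA addrAC.
rewrite yE; apply: (harmonic_line_zero (a := a) (rho := rho) oU hh rho0 HM _ _ s_s1).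
  have ow : open (ball w d) by exact: ball_open.
  have : nbhs (y - s *: e_ i) (ball w d) by apply: open_nbhs_nbhs; split.
  by apply: filterS => x bx; apply: epH; apply: le_ball bx; rewrite ge_min lexx.
move=> t ts j; rewrite line_coord.
have tj : `|t * (j == i)%:R| <= rho / 8.
  apply: le_trans (_ : `|t| <= _); last exact: le_trans ts (le_trans s_s1 s18).
  by case: (j == i); rewrite ?mulr1 ?mulr0 ?normr0.
have wj : `|w ord0 j - a ord0 j| <= rho / 8.
  case: (wz j) => ->; last by rewrite subrr normr0 divr_ge0 // ltW.
  by rewrite distrC; apply: le_trans (ltW (az j)) s18.
have yj : `|(y - s *: e_ i) ord0 j - w ord0 j| <= rho / 8.
  have /rV_ballP[_ /(_ j)] := wy'; rewrite distrC => H; apply: le_trans (ltW H) _.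
  by rewrite /d ge_min lexx orbT.
move: rho0 tj wj yj; clear; move: rho ((y - s *: e_ i) ord0 j) (t * (j == i)%:R).
move: (w ord0 j) (a ord0 j) => b c k p q r0; rewrite !ler_norml => /andP[? ?] /andP[? ?] /andP[? ?].
by apply/andP; split; lra.
Qed.

End UniqueContinuation.

(** * The P-function *)

Section Bochner.
Context {R : realType} {n : nat}.
Local Notation V := 'rV[R]_n.
Local Notation e_ := (ebasis R).

(** Serves twice: nonnegativity of the left side bounds the Hessian from below in the inequality,
    and the same quantity, [hess_dev], is forced to vanish in the rigidity part. *)
Lemma sum_sqr_hess (H : 'I_n -> 'I_n -> R) (g : 'I_n -> R) (a b : R) :
  \sum_i \sum_j (H i j - a * (i == j)%:R - b * (g i * g j)) ^+ 2 =
  \sum_i \sum_j H i j ^+ 2 - 2 * a * \sum_i H i i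
  - 2 * b * (\sum_i \sum_j H i j * (g i * g j)) + n%:R * a ^+ 2
  + 2 * a * b * (\sum_i g i ^+ 2) + b ^+ 2 * (\sum_i g i ^+ 2) ^+ 2.
Proof.
have diag (c : 'I_n -> 'I_n -> R) i : \sum_j (i == j)%:R * c i j = c i i.
  rewrite (bigD1 i) //= eqxx mul1r big1 ?addr0 // => j /negPf.
  by rewrite eq_sym => ->; rewrite mul0r.
have -> : (\sum_i g i ^+ 2) ^+ 2 = \sum_i \sum_j (g i * g j) ^+ 2.
  rewrite expr2 big_distrlr /=; apply: eq_bigr => i _; apply: eq_bigr => j _.
  by rewrite exprMn.
have -> : \sum_i H i i = \sum_i \sum_j (i == j)%:R * H i j.
  by apply: eq_bigr => i _; rewrite diag.
have -> : \sum_i g i ^+ 2 = \sum_i \sum_j (i == j)%:R * (g i * g j).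
  by apply: eq_bigr => i _; rewrite (diag (fun i j => g i * g j)) expr2.
have -> : n%:R * a ^+ 2 = \sum_(i < n) \sum_(j < n) (i == j)%:R * a ^+ 2.
  rewrite (eq_bigr (fun=> a ^+ 2)) => [|i _]; last by rewrite (diag (fun _ _ => a ^+ 2)).
  by rewrite sumr_const card_ord mulr_natl.
rewrite !mulr_sumr -!sumrN -!big_split /=; apply: eq_bigr => i _.
rewrite !mulr_sumr -!sumrN -!big_split /=; apply: eq_bigr => j _.
by case: (i == j); rewrite /= ?mulr1n ?mulr0n; ring.
Qed.

(** These [a] and [b] give the matrix [a Id + b g g^T] the eigenvalue [k] along [g] and the trace
    [c], the data prescribed for the Hessian. It is the matrix of least norm with these data. *)
Let hess_alg (h W N c k : R) (a := (c - k) / (N - 1)) (b := (k - a) / W) :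
  N - 1 != 0 -> W != 0 ->
  h - 2 * a * c - 2 * b * (k * W) + N * a ^+ 2 + 2 * a * b * W + b ^+ 2 * W ^+ 2
  = h - (k ^+ 2 + (c - k) ^+ 2 / (N - 1)).
Proof. by move=> n0 W0; rewrite /b /a; field; rewrite n0 W0. Qed.

Let crit_alg (b b1 g g1 h W : R) : 0 < b ->
  b1 * W * (W - g) + b * (2 * h - g1 * W) = 0 ->
  h = (g1 - b1 / b * (W - g)) / 2 * W.
Proof.
move=> b0 E; apply: (mulfI (lt0r_neq0 b0)).
have -> : b * h = (b * (2 * h - g1 * W)) / 2 + b * (g1 * W) / 2 by field.
have -> : b * (2 * h - g1 * W) = - (b1 * W * (W - g)).
  by apply/eqP; rewrite -subr_eq0 opprK addrC E.
by field; rewrite gt_eqF.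
Qed.

Let max_alg (b b1 b2 g g1 g2 c h W q K : R) : 0 < b ->
  0 < b2 * W * (W - g) + b1 * c * (W - g) + 2 * b1 * K
      + b * (2 * q - g2 * W - g1 * c) ->
  b2 * W * (W - g) + b1 * c * (W - g) + 2 * b1 * K + b * (2 * h - g2 * W - g1 * c) <= 0 ->
  q <= h -> False.
Proof. by move=> b0 key E2 low; have := ler_wpM2l (ltW b0) low; lra. Qed.

Variables (O : set V) (u : V -> R).
Hypotheses (oO : open O) (su : smooth_on O u).

(** The squared Hilbert-Schmidt norm of the Hessian; [hessg] is the Hessian form evaluated on the
    gradient. *)
Definition hess2 (x : V) : R := \sum_i \sum_j partial i (partial j u) x ^+ 2.
Definition hessg (x : V) : R :=
  \sum_i \sum_j partial i (partial j u) x * (partial i u x * partial j u x).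
Definition W1 (i : 'I_n) (x : V) : R :=
  2 * \sum_j partial j u x * partial i (partial j u) x.
Definition W2 (i : 'I_n) (x : V) : R :=
  2 * \sum_j (partial i (partial j u) x ^+ 2
              + partial j u x * partial i (partial i (partial j u)) x).

Lemma isd_W i x : O x -> is_derive x (e_ i) (Wgrad u) (W1 i x).
Proof.
move=> Ox.
have /is_derive_eq := isd_sum (fun j => isdX 2 (smooth_isd i (smooth_partial j su) Ox)).
apply; rewrite /W1 mulr_sumr; apply: eq_bigr => j _; rewrite expr1.
by rewrite mulrA.
Qed.

Lemma isd_W1 i x : O x -> is_derive x (e_ i) (W1 i) (W2 i x).
Proof.
move=> Ox.
have /is_derive_eq := isdMc 2 (isd_sum (fun j =>
  isdM (smooth_isd i (smooth_partial j su) Ox)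
       (smooth_isd i (smooth_partial i (smooth_partial j su)) Ox))).
by apply; congr (_ * _); apply: eq_bigr => j _; rewrite expr2.
Qed.

Lemma sum_W1 x : \sum_i W1 i x * partial i u x = 2 * hessg x.
Proof.
rewrite /hessg mulr_sumr; apply: eq_bigr => i _; rewrite /W1 -mulrA; congr (_ * _).
rewrite mulr_suml; apply: eq_bigr => j _.
by move: (partial i (partial j u) x) (partial i u x) (partial j u x) => p q r; ring.
Qed.

(** Bochner's formula in flat space: the term pairing the gradient of [u] with that of its Laplacian
    drops out, the Laplacian being constant. *)
Lemma sum_W2 c x : (forall y, O y -> laplacian u y = c) -> O x ->
  \sum_i W2 i x = 2 * hess2 x.
Proof.
move=> lu Ox; rewrite /hess2 /W2 -mulr_sumr; congr (_ * _).
under eq_bigr do rewrite big_split /=.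
rewrite big_split /= [X in _ + X](_ : _ = 0) ?addr0 //.
rewrite exchange_big /= big1 // => j _; rewrite -mulr_sumr.
have := laplacian_cst_partial j oO su lu Ox; rewrite /laplacian => ->.
by rewrite mulr0.
Qed.

Lemma Wgrad_cts x : O x -> {for x, continuous (Wgrad u)}.
Proof.
move=> Ox; apply: cts_sum => i; apply: ctsX.
exact: smooth_continuous (smooth_partial i su) Ox.
Qed.

Variables (T : set R) (be be1 be2 ga ga1 ga2 : R -> R).
Hypotheses (dbe : forall t, T t -> is_derive t 1 be (be1 t))
  (ddbe : forall t, T t -> is_derive t 1 be1 (be2 t))
  (dga : forall t, T t -> is_derive t 1 ga (ga1 t))
  (ddga : forall t, T t -> is_derive t 1 ga1 (ga2 t)).

(** The weight and the comparison function stay abstract: a nontrivial weight yields the inequality,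
    the weight 1 the equation used for rigidity. *)
Definition pfun (x : V) : R := be (u x) * (Wgrad u x - ga (u x)).
Definition pfun1 (i : 'I_n) (x : V) : R :=
  be1 (u x) * partial i u x * (Wgrad u x - ga (u x))
  + be (u x) * (W1 i x - ga1 (u x) * partial i u x).
Definition pfun2 (i : 'I_n) (x : V) : R :=
  be2 (u x) * partial i u x ^+ 2 * (Wgrad u x - ga (u x))
  + be1 (u x) * partial i (partial i u) x * (Wgrad u x - ga (u x))
  + 2 * be1 (u x) * (partial i u x * (W1 i x - ga1 (u x) * partial i u x))
  + be (u x) * (W2 i x - ga2 (u x) * partial i u x ^+ 2
                - ga1 (u x) * partial i (partial i u) x).

Lemma isd_pfun i x : O x -> T (u x) -> is_derive x (e_ i) pfun (pfun1 i x).
Proof.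
move=> Ox Tx; have du := smooth_isd i su Ox.
exact: isdM (isd_comp (dbe Tx) du) (isdB (isd_W i Ox) (isd_comp (dga Tx) du)).
Qed.

Lemma isd_pfun1 i x : O x -> T (u x) -> is_derive x (e_ i) (pfun1 i) (pfun2 i x).
Proof.
move=> Ox Tx; have du := smooth_isd i su Ox.
have ddu := smooth_isd i (smooth_partial i su) Ox.
have dD := isdB (isd_W i Ox) (isd_comp (dga Tx) du).
have d1 := isdM (isdM (isd_comp (ddbe Tx) du) ddu) dD.
have d2 := isdM (isd_comp (dbe Tx) du)
                (isdB (isd_W1 i Ox) (isdM (isd_comp (ddga Tx) du) ddu)).
have /is_derive_eq := isdD d1 d2; apply; rewrite /pfun2; clear.
move: (W1 i x) (W2 i x) (Wgrad u x) (partial i (partial i u) x) (partial i u x).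
move: (be (u x)) (be1 (u x)) (be2 (u x)) (ga (u x)) (ga1 (u x)) (ga2 (u x)).
by move=> *; ring.
Qed.

Lemma sum_pfun1 x : \sum_i pfun1 i x * partial i u x =
  be1 (u x) * Wgrad u x * (Wgrad u x - ga (u x))
  + be (u x) * (2 * hessg x - ga1 (u x) * Wgrad u x).
Proof.
rewrite -sum_W1 {1 3}/Wgrad.
transitivity (\sum_i (be1 (u x) * (Wgrad u x - ga (u x)) * partial i u x ^+ 2
   + be (u x) * (W1 i x * partial i u x) - be (u x) * ga1 (u x) * partial i u x ^+ 2)).
  apply: eq_bigr => i _; rewrite /pfun1; move: (W1 i x) (Wgrad u x) (partial i u x).
  by move=> *; ring.
rewrite !big_split /= sumrN -!mulr_sumr.
move: (Wgrad u x) (\sum_i _ ^+ 2) (\sum_i W1 i x * _) => *; ring.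
Qed.

Lemma sum_pfun2 c x : (forall y, O y -> laplacian u y = c) -> O x ->
  \sum_i pfun2 i x =
  be2 (u x) * Wgrad u x * (Wgrad u x - ga (u x)) + be1 (u x) * c * (Wgrad u x - ga (u x))
  + 2 * be1 (u x) * (2 * hessg x - ga1 (u x) * Wgrad u x)
  + be (u x) * (2 * hess2 x - ga2 (u x) * Wgrad u x - ga1 (u x) * c).
Proof.
move=> lu Ox; have lx := lu x Ox.
rewrite -(sum_W2 lu Ox) -sum_W1 -lx /laplacian.
transitivity (\sum_i (be2 (u x) * (Wgrad u x - ga (u x)) * partial i u x ^+ 2
   + be1 (u x) * (Wgrad u x - ga (u x)) * partial i (partial i u) x
   + 2 * be1 (u x) * (W1 i x * partial i u x) - 2 * be1 (u x) * ga1 (u x) * partial i u x ^+ 2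
   + be (u x) * W2 i x - be (u x) * ga2 (u x) * partial i u x ^+ 2
   - be (u x) * ga1 (u x) * partial i (partial i u) x)).
  apply: eq_bigr => i _; rewrite /pfun2.
  move: (W1 i x) (W2 i x) (Wgrad u x) (partial i (partial i u) x) (partial i u x).
  by move=> *; ring.
rewrite !big_split /= !sumrN -!mulr_sumr -/(Wgrad u x).
move: (\sum_i W2 i x) (\sum_i W1 i x * _) (\sum_i partial i (partial i u) x) (Wgrad u x).
by move=> *; ring.
Qed.

(* The eigenvalue of the Hessian along the gradient at a critical point of the
   P-function is [k]; the other eigenvalues only enter through their sum. *)
Lemma hess2_lower_bound x c k : (1 < n)%N -> 0 < Wgrad u x -> laplacian u x = c ->
  hessg x = k * Wgrad u x -> k ^+ 2 + (c - k) ^+ 2 / (n%:R - 1) <= hess2 x.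
Proof.
move=> n1 W0 lx hk.
have nz : n%:R - 1 != 0 :> R by rewrite subr_eq0 pnatr_eq1 gtn_eqF.
pose a := (c - k) / (n%:R - 1); pose b := (k - a) / Wgrad u x.
have := sum_sqr_hess (fun i j => partial i (partial j u) x) (fun i => partial i u x) a b.
rewrite -/(hess2 x) -/(hessg x) -/(laplacian u x) -/(Wgrad u x) lx hk.
move=> E; have : 0 <= \sum_i \sum_j (partial i (partial j u) x - a * (i == j)%:R
    - b * (partial i u x * partial j u x)) ^+ 2.
  by apply: sumr_ge0 => i _; apply: sumr_ge0 => j _; exact: sqr_ge0.
rewrite E.
have -> : hess2 x - 2 * a * c - 2 * b * (k * Wgrad u x) + n%:R * a ^+ 2
    + 2 * a * b * Wgrad u x + b ^+ 2 * Wgrad u x ^+ 2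
    = hess2 x - (k ^+ 2 + (c - k) ^+ 2 / (n%:R - 1)).
  by move: nz (lt0r_neq0 W0); exact: hess_alg.
by rewrite subr_ge0.
Qed.

(** A maximum is reduced to real numbers: [D] stands for [W - ga], so [W = D + ga]; the vanishing
    gradient determines [k], and [hess2_lower_bound] bounds the Laplacian below by the displayed
    expression, against the second-derivative test. *)
Lemma pfun_no_max c x (O' : set V) : (1 < n)%N ->
  (forall y, O y -> laplacian u y = c) -> open O' -> O' `<=` O -> O' x ->
  (forall y, O' y -> T (u y)) -> (\forall y \near x, pfun y <= pfun x) ->
  0 < be (u x) -> 0 <= ga (u x) -> 0 < pfun x ->
  (forall D, 0 < D -> let k := (ga1 (u x) - be1 (u x) / be (u x) * D) / 2 in
     0 < be2 (u x) * (D + ga (u x)) * D + be1 (u x) * c * D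
         + 2 * be1 (u x) * ((2 * k - ga1 (u x)) * (D + ga (u x)))
         + be (u x) * (2 * (k ^+ 2 + (c - k) ^+ 2 / (n%:R - 1))
             - ga2 (u x) * (D + ga (u x)) - ga1 (u x) * c)) -> False.
Proof.
move=> n1 lu oO' O'O O'x O'T mx b0 g0 p0 scal.
have Ox := O'O x O'x.
have crit : forall i, pfun1 i x = 0 /\ pfun2 i x <= 0.
  apply: (@local_max_partials _ _ O' pfun pfun1 (pfun2^~ x) x oO' O'x _ _ mx).
  - by move=> i y O'y; exact: isd_pfun (O'O y O'y) (O'T y O'y).
  - by move=> i; exact: isd_pfun1 (O'O x O'x) (O'T x O'x).
have D0 : 0 < Wgrad u x - ga (u x) by rewrite -(pmulr_rgt0 _ b0).
have W0 : 0 < Wgrad u x by apply: le_lt_trans g0 _; rewrite -subr_gt0.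
have E1 : be1 (u x) * Wgrad u x * (Wgrad u x - ga (u x))
  + be (u x) * (2 * hessg x - ga1 (u x) * Wgrad u x) = 0.
  by rewrite -sum_pfun1 big1 // => i _; rewrite (crit i).1 mul0r.
have E2 : be2 (u x) * Wgrad u x * (Wgrad u x - ga (u x)) + be1 (u x) * c * (Wgrad u x - ga (u x))
  + 2 * be1 (u x) * (2 * hessg x - ga1 (u x) * Wgrad u x)
  + be (u x) * (2 * hess2 x - ga2 (u x) * Wgrad u x - ga1 (u x) * c) <= 0.
  by rewrite -(sum_pfun2 lu Ox); apply: sumr_le0 => i _; exact: (crit i).2.
have := scal _ D0; set k := (_ / 2) => /= key.
have hk : hessg x = k * Wgrad u x.
  exact: crit_alg b0 E1.
have low := hess2_lower_bound n1 W0 (lu x Ox) hk.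
move: key E2 low; rewrite subrK hk [2 * (k * _)]mulrA -mulrBl; exact: max_alg.
Qed.

End Bochner.

(** * The torsion problem on a bounded domain *)

Lemma compact_levelset (R : realType) (T : topologicalType) (A : set T) (f : T -> R) (c : R) :
  compact A -> (forall x, A x -> {for x, continuous f}) ->
  compact (A `&` [set x | f x <= c]).
Proof.
move=> cA cf.
suff -> : A `&` [set x | f x <= c] = A `&` closure (A `&` [set x | f x <= c]).
  by apply: compact_closedI => //; exact: closed_closure.
apply/seteqP; split=> x; first by move=> H; split; [exact: H.1|exact: subset_closure].
move=> [Ax clx]; split=> //=; rewrite leNgt; apply/negP => cx.
have nx : \forall y \near x, c < f y by exact: (cvgr_gt _ (cf x Ax)).
by have [y [[_ /= fy] /=]] := clx _ nx; rewrite ltNge fy.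
Qed.

(** A Lebesgue number: half the radius of a ball inside [O] serves for all nearby centres, and
    compactness makes it uniform. *)
Lemma compact_open_radius (R : realType) (V : normedModType R) (K O : set V) :
  compact K -> open O -> K `<=` O ->
  exists2 r : R, 0 < r & forall x, K x -> ball x r `<=` O.
Proof.
move=> /compact_near_coveringP cK oO KO.
have H : \forall r \near 0^'+, K `<=` [set x | ball x r `<=` O].
  apply: cK => x Kx.
  have /nbhs_ballP[e /= e0 eO] : nbhs x O by apply: open_nbhs_nbhs; split=> //; exact: KO.
  have e20 : 0 < e / 2 by rewrite divr_gt0.
  exists (ball x (e / 2), [set r | r < e / 2]).
    by split; [exact: nbhsx_ballx|exact: nbhs_right_lt].
  move=> [y r] /= [xy re] z yz; apply: eO.
  by rewrite (splitr e); apply: ball_triangle xy _; apply: le_ball yz; exact: ltW.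
have : \forall r \near (0 : R)^'+, 0 < r /\ K `<=` [set x | ball x r `<=` O].
  by apply: filterI => //; exact: nbhs_right_gt.
by move=> /filter_ex[r [r0 Hr]]; exists r.
Qed.

Lemma second_order_alg (R : realType) (p q a b m M t : R) :
  a - b = p * t -> a <= m -> - (M * (m - b)) <= (p - q) * t ->
  q * t <= (1 + M) * (m - b).
Proof. by move=> E am; rewrite mulrBl -E => bd; lra. Qed.

Section Torsion.
Context {R : realType} {n : nat}.
Local Notation V := 'rV[R]_n.
Local Notation e_ := (ebasis R).
Variables (Om U : set V) (u : V -> R).
Hypotheses (n1 : (1 < n)%N) (oOm : open Om) (bOm : bounded_set Om)
  (OmU : closure Om `<=` U) (su : smooth_on U u)
  (lu : forall x, Om x -> laplacian u x = - n%:R)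
  (u0 : forall x, bdry Om x -> u x = 0).

Lemma Om_sub_U : Om `<=` U.
Proof. by move=> x Ox; apply: OmU; exact: subset_closure. Qed.

Lemma smooth_Om : smooth_on Om u.
Proof. exact: smooth_sub Om_sub_U su. Qed.

Lemma compact_closure_Om : compact (closure Om).
Proof.
apply: bounded_closed_compact; last exact: closed_closure.
have [M [Mr HM]] := bOm; exists M; split=> // x Mx y.
have cl : closed [set z : V | `|z| <= x].
  apply: (@closed_comp _ _ (fun z : V => `|z|) [set t | t <= x]); last exact: closed_le.
  by move=> z _; exact: norm_continuous.
by move=> cly; apply: cl; apply: closure_subset cly => z Oz; exact: HM.
Qed.

Lemma closure_Om_split x : closure Om x -> Om x \/ bdry Om x.
Proof. by move=> cx; have [Ox|nOx] := pselect (Om x); [left|right]. Qed.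

Lemma u_cts x : closure Om x -> {for x, continuous u}.
Proof. by move=> /OmU Ux; exact: smooth_continuous su Ux. Qed.

Lemma no_interior_min m : Om m -> (forall x, closure Om x -> u m <= u x) -> False.
Proof.
move=> Omm Hm.
have crit : forall i, - partial i u m = 0 /\ - partial i (partial i u) m <= 0.
  apply: (@local_max_partials _ _ Om (fun x => - u x) (fun i x => - partial i u x)
     (fun i => - partial i (partial i u) m) m oOm Omm).
  - by move=> i y Oy; exact: isdN (smooth_isd i smooth_Om Oy).
  - by move=> i; exact: isdN (smooth_isd i (smooth_partial i smooth_Om) Omm).
  - have : nbhs m Om by exact: open_nbhs_nbhs.
    by apply: filterS => y Oy; rewrite lerN2; apply: Hm; exact: subset_closure.
have : 0 <= laplacian u m.
  by apply: sumr_ge0 => i _; have := (crit i).2; rewrite oppr_le0.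
by rewrite lu // oppr_ge0 leNgt ltr0n ltnW.
Qed.

Lemma u_pos x : Om x -> 0 < u x.
Proof.
move=> Ox.
have cne : closure Om !=set0 by exists x; exact: subset_closure.
have [m cm Hm] := compact_min cne compact_closure_Om u_cts.
have [Omm|bm] := closure_Om_split cm; first by case: (no_interior_min Omm Hm).
have um := u0 bm.
rewrite lt_neqAle; apply/andP; split; last by rewrite -um; apply: Hm; exact: subset_closure.
apply/eqP => ux; apply: (no_interior_min Ox) => y /Hm.
by rewrite um ux.
Qed.

Lemma u_ge0 x : closure Om x -> 0 <= u x.
Proof. by move=> /closure_Om_split[/u_pos/ltW//|/u0 ->]. Qed.

Lemma u_le_umax x : Om x -> u x <= umax Om u.
Proof.
move=> Ox; apply: ub_le_sup; last by exists x.
have [M _ HM] := compact_norm_bound compact_closure_Om u_cts.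
exists M => _ [y Oy <-]; apply: le_trans (ler_norm _) _.
by apply: HM; exact: subset_closure.
Qed.

Hypothesis um0 : 0 < umax Om u.

(* A nonnegative function [umax - u] with bounded second derivatives has
   [|grad|^2] bounded by a multiple of itself. *)
Lemma Wgrad_near_max : exists C d : R, [/\ 0 <= C, 0 < d &
  forall x, Om x -> 0 < umax Om u - u x < d -> Wgrad u x <= C * (umax Om u - u x)].
Proof.
(* Where [u >= umax / 2] the boundary is excluded, so this compact set lies in [Om] and leaves a
   uniform room [rho] for moving along the axes. *)
pose K := closure Om `&` [set x | - u x <= - (umax Om u / 2)].
have cK : compact K.
  by apply: compact_levelset compact_closure_Om _ => x cx; apply: ctsN; exact: u_cts.
have KO : K `<=` Om.
  move=> x [cx /=]; rewrite lerN2 => ux; have [//|/u0 bx] := closure_Om_split cx.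
  by move: ux; rewrite bx leNgt divr_gt0.
have [rho rho0 Hrho] := compact_open_radius cK oOm KO.
have HM i : exists M : R, 0 <= M /\ forall x, closure Om x -> `|partial i (partial i u) x| <= M.
  have [|M M0 H] := @compact_norm_bound _ _ _ (partial i (partial i u)) compact_closure_Om.
    by move=> x /OmU Ux; exact: smooth_continuous (smooth_partial i (smooth_partial i su)) Ux.
  by exists M.
have {HM}[M HM] := choice HM.
have M0 i : 0 <= M i := (HM i).1.
exists (\sum_i (1 + M i) ^+ 2), (Num.min (umax Om u / 2) (rho ^+ 2)); split.
- by apply: sumr_ge0 => i _; exact: sqr_ge0.
- by rewrite lt_min divr_gt0 // exprn_gt0.
move=> x Ox; set v := umax Om u - u x => /andP[v0]; rewrite lt_min => /andP[v2 vr].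
have Kx : K x.
  split; first exact: subset_closure.
  by rewrite /= lerN2; move: v2; rewrite /v; lra.
rewrite mulr_suml; apply: ler_sum => i _.
(* A step of length [sqrt v] balances the available rise [v] of [u] against the second-order error
   [M * s^2], which is also of size [v]. *)
pose s := Num.sqrt v.
have s0 : 0 < s by rewrite sqrtr_gt0.
have s2 : s ^+ 2 = v by rewrite sqr_sqrtr // ltW.
have sr : s < rho by rewrite -(ltr_pXn2r (n := 2)) ?nnegrE ?s2 // ltW.
have line t : `|t| <= s -> Om (x + t *: e_ i).
  move=> ts; apply: (Hrho x Kx); apply: ball_line; first exact: ballxx.
  by rewrite opprD addrA subrr sub0r normrN; exact: le_lt_trans ts sr.
have key t : `|t| = s -> partial i u x * t <= (1 + M i) * v.
  move=> ts.
  have [|c ct E] := @MVT_norm R (fun r => u (x + r *: e_ i)) (fun r => partial i u (x + r *: e_ i)) t.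
    move=> r; rewrite ts => /line Or; apply: is_derive_line.
    exact: smooth_isd su (Om_sub_U Or).
  have [|d dc E'] := @MVT_norm R (fun r => partial i u (x + r *: e_ i))
      (fun r => partial i (partial i u) (x + r *: e_ i)) c.
    move=> r rc; have /line Or : `|r| <= s by rewrite -ts; exact: le_trans rc ct.
    apply: is_derive_line; exact: smooth_isd (smooth_partial i su) (Om_sub_U Or).
  rewrite !scale0r !addr0 in E E'.
  have Ot : Om (x + t *: e_ i) by apply: line; rewrite ts.
  have Od : Om (x + d *: e_ i) by apply: line; rewrite -ts; exact: le_trans dc ct.
  have ut := u_le_umax Ot.
  have uxx := (HM i).2 _ (subset_closure Od).
  have bd : `|partial i (partial i u) (x + d *: e_ i) * c * t| <= M i * v.
    rewrite !normrM -mulrA -s2 expr2; apply: ler_pM => //.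
    by rewrite -ts; apply: ler_wpM2r.
  move: bd; rewrite -E' ler_norml => /andP[bd _].
  exact: second_order_alg E ut bd.
have k1 := key s (ger0_norm (ltW s0)); have k2 := key (- s) (etrans (normrN s) (ger0_norm (ltW s0))).
have : `|partial i u x| * s <= (1 + M i) * v.
  rewrite -[X in _ * X](ger0_norm (ltW s0)) -normrM ler_norml k1 andbT lerNl -mulrN; exact: k2.
rewrite -s2 expr2 mulrA ler_pM2r // => H.
rewrite -(real_normK (num_real (partial i u x))) -expr2 -exprMn lerXn2r ?nnegrE // mulr_ge0 //.
  by rewrite addr_ge0.
exact: ltW.
Qed.

Variable N : set V.
Hypothesis cN : is_component (Om `\` MAXset Om u) N.

Lemma MAX_open : open (Om `\` MAXset Om u).
Proof.
rewrite openE => x [Ox nx]; have ux : u x != umax Om u by apply/eqP => E; exact: nx.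
have cu := u_cts (subset_closure Ox).
have n1x : \forall y \near x, u y != umax Om u.
  have /cvgr_neq0 : {for x, continuous (fun y => u y - umax Om u)}.
    by apply: ctsB => //; exact: cts_cst.
  by rewrite subr_eq0 => /(_ ux); apply: filterS => y; rewrite subr_eq0.
have n2x : nbhs x Om by exact: open_nbhs_nbhs.
apply: filterS2 n1x n2x => y uy Oy; split=> // -[_ E]; by rewrite E eqxx in uy.
Qed.

Lemma N_open : open N.
Proof. by have [x [_ ->]] := cN; apply: open_component; exact: MAX_open. Qed.

Lemma N_connected : connected N.
Proof. by have [x [_ ->]] := cN; exact: component_connected. Qed.

Lemma N_sub x : N x -> Om x /\ 0 < u x < umax Om u.
Proof.
have [x0 [_ ->]] := cN => /connected_component_sub [Ox nx]; split=> //.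
rewrite u_pos //= lt_neqAle u_le_umax // andbT; apply/eqP => E; exact: nx.
Qed.

Lemma closure_N x : closure N x -> closure Om x.
Proof. by apply: closure_subset => y /N_sub[]. Qed.

Lemma closure_N_in x : closure N x -> Om x -> u x < umax Om u -> N x.
Proof.
have [x0 [Ax ->]] := cN => clx Ox ux.
apply: (closure_component MAX_open); split=> //; split=> // -[_ E].
by rewrite E ltxx in ux.
Qed.

Variables (be be1 be2 ga ga1 ga2 : R -> R).
Local Notation T := [set t : R | 0 <= t < umax Om u].
Hypotheses (dbe : forall t : R, T t -> is_derive t 1 be (be1 t))
  (ddbe : forall t : R, T t -> is_derive t 1 be1 (be2 t))
  (dga : forall t : R, T t -> is_derive t 1 ga (ga1 t))
  (ddga : forall t : R, T t -> is_derive t 1 ga1 (ga2 t))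
  (be_gt0 : forall t, T t -> 0 < be t) (ga_ge0 : forall t, T t -> 0 <= ga t).

(** [be] may blow up at the maximum set, so a maximum of [F] must be kept away from it. There
    [F <= be * C * v] with [v = umax - u], and the hypothesis on [B] gives [F^2 <= C^2 * B * v]. *)
Lemma gradient_bound (B : R) :
  (forall t, T t -> be t ^+ 2 * (umax Om u - t) <= B) ->
  (forall x, bdry Om x -> closure N x -> Wgrad u x <= ga 0) ->
  (forall t, T t -> forall D, 0 < D -> let k := (ga1 t - be1 t / be t * D) / 2 in
     0 < be2 t * (D + ga t) * D + be1 t * (- n%:R) * D
         + 2 * be1 t * ((2 * k - ga1 t) * (D + ga t))
         + be t * (2 * (k ^+ 2 + (- n%:R - k) ^+ 2 / (n%:R - 1))
             - ga2 t * (D + ga t) - ga1 t * (- n%:R))) ->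
  forall p, N p -> Wgrad u p <= ga (u p).
Proof.
move=> HB Hbd scal p Np; rewrite leNgt; apply/negP => gW.
have [Op /andP[up0 upm]] := N_sub Np.
pose F := pfun u be ga.
have Tu x : N x -> T (u x) by move=> /N_sub[_ /andP[h0 hm]]; rewrite /= (ltW h0) hm.
have Fp : 0 < F p by rewrite /F /pfun mulr_gt0 ?subr_gt0 // be_gt0 //; exact: Tu.
have [C [d0 [C0 d00 HC]]] := Wgrad_near_max.
have B0 : 0 <= B.
  apply: le_trans (HB (u p) (Tu p Np)); rewrite mulr_ge0 ?sqr_ge0 // subr_ge0 ltW //.
pose v x := umax Om u - u x.
have small x : N x -> v x < d0 -> 0 < F x -> F x ^+ 2 <= C ^+ 2 * B * v x.
  move=> Nx vx Fx; have [Ox /andP[ux0 uxm]] := N_sub Nx.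
  have v0 : 0 < v x by rewrite subr_gt0.
  have bx := be_gt0 (Tu x Nx).
  have FW : F x <= be (u x) * (C * v x).
    rewrite /F /pfun ler_pM2l //; apply: le_trans (_ : Wgrad u x <= _).
      by rewrite gerBl ga_ge0 //; exact: Tu.
    by apply: HC => //; rewrite -/(v x) v0 vx.
  apply: le_trans (_ : (be (u x) * (C * v x)) ^+ 2 <= _).
    by rewrite lerXn2r ?nnegrE ?(ltW Fx) // (le_trans (ltW Fx)).
  have -> : (be (u x) * (C * v x)) ^+ 2 = (C ^+ 2 * v x) * (be (u x) ^+ 2 * v x) by ring.
  have -> : C ^+ 2 * B * v x = (C ^+ 2 * v x) * B by ring.
  apply: ler_wpM2l; first by rewrite mulr_ge0 ?sqr_ge0 // ltW.
  exact: HB (Tu x Nx).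
pose q := C ^+ 2 * B + 1.
have q0 : 0 < q by rewrite ltr_wpDl // mulr_ge0 // sqr_ge0.
(* Below the depth [d] the function [F] cannot reach [F p], while [d <= v p] keeps [p] in the
   compact set [K]. *)
pose d := Num.min (v p) (Num.min d0 (F p ^+ 2 / q)).
have dpos : 0 < d.
  by rewrite !lt_min subr_gt0 upm d00 divr_gt0 // exprn_gt0.
have smallF x : N x -> v x < d -> F x < F p.
  move=> Nx; rewrite !lt_min => /and3P[_ vd0 vq].
  have [Fx|Fx] := ltP 0 (F x); last exact: le_lt_trans Fx Fp.
  rewrite -(ltr_pXn2r (n := 2)) ?nnegrE ?ltW //.
  apply: le_lt_trans (small x Nx vd0 Fx) _.
  have v0 : 0 < v x by have [_ /andP[_ ?]] := N_sub Nx; rewrite subr_gt0.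
  apply: lt_trans (_ : q * v x < _); first by rewrite ltr_pM2r // ltrDl.
  by rewrite mulrC -ltr_pdivlMr.
pose K := closure N `&` [set x | u x <= umax Om u - d].
have clNU x : closure N x -> {for x, continuous u} by move=> /closure_N; exact: u_cts.
have ccN : compact (closure N).
  suff -> : closure N = closure Om `&` closure N.
    by apply: compact_closedI; [exact: compact_closure_Om|exact: closed_closure].
  by apply/seteqP; split=> x => [cx|[]//]; split=> //; exact: closure_N.
have cK : compact K by exact: compact_levelset ccN clNU.
have Kp : K p.
  split; first exact: subset_closure.
  by rewrite /= lerBrDr -lerBrDl /d ge_min lexx.
have TK x : K x -> T (u x).
  move=> [/closure_N cx /= ux]; rewrite /= u_ge0 //=; apply: le_lt_trans ux _.
  by rewrite ltrBlDr ltrDl.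
have FK x : K x -> {for x, continuous F}.
  move=> Kx; have Tx := TK x Kx; have [cx _] := Kx.
  have cu := clNU x cx.
  apply: ctsM; first by apply: cts_comp => //; exact: isd1_continuous (dbe Tx).
  apply: ctsB; first by apply: (Wgrad_cts su); apply: OmU; exact: closure_N.
  by apply: cts_comp => //; exact: isd1_continuous (dga Tx).
have [|x0 Kx0 Hx0] := @compact_max _ _ K F _ cK FK; first by exists p.
have [cx0 ux0] := Kx0.
have Fx0 : 0 < F x0 by apply: lt_le_trans Fp _; exact: Hx0.
have Tx0 := TK x0 Kx0.
have Ox0 : Om x0.
  have [//|bx0] := closure_Om_split (closure_N cx0).
  have := Hbd x0 bx0 cx0; move: Fx0; rewrite /F /pfun.
  rewrite pmulr_rgt0; last exact: be_gt0.
  by rewrite (u0 bx0) subr_gt0 ltNge => /negP h1 /h1.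
have Nx0 : N x0 by apply: closure_N_in => //; case/andP: Tx0.
apply: (@pfun_no_max _ _ Om u oOm smooth_Om T be be1 be2 ga ga1 ga2 dbe ddbe dga ddga
   (- n%:R) x0 N n1 lu N_open _ Nx0 Tu _ (be_gt0 Tx0) (ga_ge0 Tx0) Fx0).
- by move=> x /N_sub[].
(* [x0] may lie on the edge of [K]; points of [N] outside [K] satisfy [F < F p <= F x0], so it is
   still a maximum over [N]. *)
- have : nbhs x0 N by apply: open_nbhs_nbhs; split=> //; exact: N_open.
  apply: filterS => y Ny; rewrite -/F.
  have [yd|yd] := leP (u y) (umax Om u - d).
    by apply: Hx0; split=> //; exact: subset_closure.
  apply: le_trans (Hx0 p Kp); apply/ltW/smallF => //.
  by rewrite /v ltrBlDr -ltrBlDl.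
- exact: scal Tx0.
Qed.

End Torsion.

(** * The model solutions *)

Section ScalarInequalities.
Context {R : realFieldType}.
Variables (N y q : R).

(** Everything is rational in [y] and [q]. With [be * D > 0] factored out, [1 - q] occurs only in
    even powers, so for [q > 0] positivity holds on both branches at once, [s] being the sign of
    [1 - q]. At [q = 0] the right side is zero. *)
Lemma ring_pfun_identity (s D : R) : y != 0 -> 1 - q != 0 -> N - 1 != 0 -> s != 0 ->
  let be := s / (1 - q) in
  let be1 := s * (N * q / (y * (1 - q) ^+ 3)) in
  let be2 := s * (N * q * (N + 2 + (2 * N - 2) * q) / (y ^+ 2 * (1 - q) ^+ 5)) in
  let ga := y * (1 - q) ^+ 2 in
  let ga1 := - 2 - 2 * (N - 1) * q in
  let ga2 := - (2 * (N - 1) * (N * q / (y * (1 - q)))) in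
  let k := (ga1 - be1 / be * D) / 2 in
  be2 * (D + ga) * D + be1 * (- N) * D + 2 * be1 * ((2 * k - ga1) * (D + ga))
    + be * (2 * (k ^+ 2 + (- N - k) ^+ 2 / (N - 1)) - ga2 * (D + ga) - ga1 * (- N)) =
  be * D * (2 * N ^+ 2 * q / (y * (1 - q) ^+ 2)
     + D * N * q / (y ^+ 2 * (1 - q) ^+ 4)
       * (2 + N + q * (N - 2) ^+ 2 / (2 * (N - 1)))).
Proof.
move=> y0 q0 N0 s0 /=; field.
by rewrite N0 y0 q0 s0.
Qed.

(** The case [q = 0], where [W_R = 1 - 2t]: the weight [1/(1+2t)] restores strict positivity. *)
Lemma ball_pfun_identity (t D : R) : 1 + 2 * t != 0 -> N - 1 != 0 ->
  let be := (1 + 2 * t)^-1 in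
  let be1 := - 2 / (1 + 2 * t) ^+ 2 in
  let be2 := 8 / (1 + 2 * t) ^+ 3 in
  let ga := 1 - 2 * t in let ga1 := - 2 in let ga2 := 0 in
  let k := (ga1 - be1 / be * D) / 2 in
  be2 * (D + ga) * D + be1 * (- N) * D + 2 * be1 * ((2 * k - ga1) * (D + ga))
    + be * (2 * (k ^+ 2 + (- N - k) ^+ 2 / (N - 1)) - ga2 * (D + ga) - ga1 * (- N)) =
  2 * N * be ^+ 2 * D + 2 * be ^+ 3 * D ^+ 2 * (N / (N - 1)).
Proof. by move=> t0 N0 /=; field; rewrite N0 t0. Qed.

(** [A Id + B du du^T] is the Hessian of the model, with [A] the tangential eigenvalue. The left
    side therefore vanishes at [W = ga]; the factor [W - ga] makes the equation for [W - W_R]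
    homogeneous. *)
Lemma hopf_identity (W : R) : y != 0 -> 1 - q != 0 ->
  let A := - (1 - q) in let B := - (N * q / (y * (1 - q) ^+ 2)) in
  let ga := y * (1 - q) ^+ 2 in
  let ga1 := - 2 - 2 * (N - 1) * q in
  let ga2 := - (2 * (N - 1) * (N * q / (y * (1 - q)))) in
  - 4 * N * A - 2 * N * A ^+ 2 + N * ga1 + W * (2 * B * ga1 - 4 * A * B - ga2)
    - 2 * B ^+ 2 * W ^+ 2 =
  (W - ga) * (2 * B * ga1 - 4 * A * B - ga2 - 2 * B ^+ 2 * (W + ga)).
Proof. by move=> y0 q0 /=; field; rewrite y0 q0. Qed.

End ScalarInequalities.

Lemma xget_eq (T : choiceType) (x0 x : T) (A : set T) :
  A x -> (forall y, A y -> y = x) -> xget x0 A = x.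
Proof. by move=> Ax H; case: xgetP => [y _ /H //|/(_ x)]. Qed.

Section Profile.
Context {R : realType}.
Variables (n : nat) (Rc : R).
Hypotheses (n3 : (3 <= n)%N) (Rc0 : 0 <= Rc).
Local Notation N := (n%:R : R).
Local Notation ur := (uRr n Rc).
Local Notation um := (uRmax n Rc).

Lemma natr_ge3 : 3 <= N.
Proof. by rewrite ler_nat. Qed.

Lemma natr_sub2_gt0 : 0 < N - 2.
Proof. by have := natr_ge3; lra. Qed.

Lemma uRrE r : ur r = (1 - r ^+ 2) / 2 - Rc ^+ n / ((N - 2) * r ^+ (n - 2)).
Proof.
rewrite /uRr; case: eqP => // ->.
by rewrite expr0n gtn_eqF ?(leq_trans _ n3) //= mul0r subr0.
Qed.

Lemma fRE r : fR n Rc r = 2 * ur r.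
Proof.
rewrite /fR uRrE mulrBr mulrCA divff ?mulr1 ?pnatr_eq0 //.
by rewrite mulrA.
Qed.

Lemma expr_sub2 (x : R) : x ^+ n = x ^+ (n - 2) * x ^+ 2.
Proof. by rewrite -exprD subnK // (leq_trans _ n3). Qed.

Lemma isd_ur (r : R) : 0 < r \/ Rc = 0 ->
  is_derive r 1 ur (- (r * (1 - Rc ^+ n / r ^+ n))).
Proof.
have N2 := natr_sub2_gt0.
have d1 : is_derive r 1 (fun r : R => (1 - r ^+ 2) / 2) (- r).
  have := isdB (isd_cst 1 r (1 : R)) (isdX 2 (is_derive_id r (1 : R))).
  move=> /(isdMc 2^-1) /is_derive_eq; rewrite /= expr1 mulr1 sub0r => /(_ (- r)) H.
  have -> : (fun r : R => (1 - r ^+ 2) / 2) = (fun y => 2^-1 * (1 - y ^+ 2)).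
    by apply/funext => x; rewrite mulrC.
  by apply: H; field.
have [Rz _|Rnz] := eqVneq Rc 0.
  have -> : ur = (fun r => (1 - r ^+ 2) / 2).
    by apply/funext => x; rewrite /uRr Rz eqxx.
  by rewrite Rz expr0n gtn_eqF ?(leq_trans _ n3) //= mul0r subr0 mulr1.
case=> [r0|/eqP]; last by rewrite (negPf Rnz).
have -> : ur = (fun r => (1 - r ^+ 2) / 2 - Rc ^+ n / (N - 2) * (r ^+ (n - 2))^-1).
  by apply/funext => x; rewrite uRrE invfM mulrA.
have rn0 : r ^+ (n - 2) != 0 by rewrite expf_neq0 // gt_eqF.
have d2 := isdMc (Rc ^+ n / (N - 2)) (@isdV R _ (fun x : R => x ^+ (n - 2)) r 1 _ rn0 (isdX (n - 2) (is_derive_id r (1 : R)))).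
have /is_derive_eq := isdB d1 d2; apply.
have [k ->] : exists k, n = k.+3 by exists (n - 3)%N; rewrite -addn3 subnK.
rewrite subn2 /= -[k.+3%:R]natr1 -[k.+2%:R]natr1 !exprS mulr1.
have r0' : r != 0 by rewrite gt_eqF.
have rk : r ^+ k != 0 by rewrite expf_neq0.
have k1 : k.+1%:R != 0 :> R by rewrite pnatr_eq0.
move: (r ^+ k) (Rc ^+ k) rk (k.+1%:R) k1 => p s p0 K K0.
field; rewrite r0' p0 /=.
by rewrite (_ : K + 1 + 1 - 2 = K) //; ring.
Qed.

Lemma ur_top : ur Rc = um.
Proof.
have N2 := natr_sub2_gt0.
have [Rz|Rnz] := eqVneq Rc 0.
  by rewrite /uRr /uRmax Rz eqxx expr0n /= mulr0.
rewrite uRrE /uRmax expr_sub2; have : Rc ^+ (n - 2) != 0 by rewrite expf_neq0.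
by move: (Rc ^+ (n - 2)) => p p0; field; rewrite p0 gt_eqF.
Qed.

(* [s = true] is the branch [(Rc, +oo)] and [s = false] the branch [(0, Rc)]
   of the model solution; both continue past the zeros [r1] and [r2]. *)
Definition branch (s : bool) : set R :=
  if s then [set r | Rc < r] else [set r | 0 < r < Rc].

Lemma branch_gt0 s r : branch s r -> 0 < r.
Proof. by case: s => /= [|/andP[]//]; apply: le_lt_trans. Qed.

Definition qr (r : R) := Rc ^+ n / r ^+ n.

Lemma dim_gt0 : (0 < n)%N. Proof. exact: leq_trans n3. Qed.

Lemma qr_lt1 r : Rc < r -> qr r < 1.
Proof.
move=> rR; have r0 := le_lt_trans Rc0 rR.
rewrite /qr ltr_pdivrMr ?exprn_gt0 // mul1r ltr_pXn2r ?nnegrE ?dim_gt0 //; exact: ltW.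
Qed.

Lemma qr_gt1 r : 0 < r < Rc -> 1 < qr r.
Proof.
case/andP=> r0 rR; rewrite /qr ltr_pdivlMr ?exprn_gt0 // mul1r.
by rewrite ltr_pXn2r ?nnegrE ?dim_gt0 //; exact: ltW.
Qed.

Lemma qr_neq1 s r : branch s r -> 1 - qr r != 0.
Proof.
case: s => /= [/qr_lt1 h|/qr_gt1 h]; first by rewrite subr_eq0 eq_sym lt_eqF.
by rewrite subr_eq0 lt_eqF.
Qed.

Lemma sgn_branch s r : branch s r -> 0 < (if s then 1 else -1) / (1 - qr r).
Proof.
case: s => /= [/qr_lt1 h|/qr_gt1 h]; first by rewrite divr_gt0 // subr_gt0.
by rewrite mulN1r oppr_gt0 invr_lt0 subr_lt0.
Qed.

Lemma ur_decr a b : Rc <= a -> a < b -> ur b < ur a.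
Proof.
move=> Ra ab; have [||c] := @MVT _ ur (fun r => - (r * (1 - qr r))) a b ab.
- move=> x; rewrite in_itv /= => /andP[ax _]; apply: isd_ur; left.
  exact: le_lt_trans (le_trans Rc0 Ra) ax.
- have [Rz|Rnz] := eqVneq Rc 0.
    apply: derivable_within_continuous => x _.
    by have [] := @isd_ur x (or_intror Rz).
  apply: derivable_within_continuous => x; rewrite in_itv /= => /andP[ax _].
  have [|//] := @isd_ur x; left; apply: lt_le_trans ax; apply: lt_le_trans Ra.
  by rewrite lt_neqAle eq_sym Rnz.
rewrite in_itv /= => /andP[ac cb] E; rewrite -subr_lt0 E pmulr_llt0 ?subr_gt0 //.
have Rc_c : Rc < c by exact: le_lt_trans Ra ac.
by rewrite oppr_lt0 mulr_gt0 ?subr_gt0 ?qr_lt1 // (le_lt_trans Rc0).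
Qed.

Lemma ur_incr a b : 0 < a -> a < b -> b <= Rc -> ur a < ur b.
Proof.
move=> a0 ab bR; have [||c] := @MVT _ ur (fun r => - (r * (1 - qr r))) a b ab.
- by move=> x; rewrite in_itv /= => /andP[ax _]; apply: isd_ur; left; exact: lt_trans ax.
- apply: derivable_within_continuous => x; rewrite in_itv /= => /andP[ax _].
  by have [|//] := @isd_ur x; left; exact: lt_le_trans ax.
rewrite in_itv /= => /andP[ac cb] E; rewrite -subr_gt0 E pmulr_lgt0 ?subr_gt0 //.
have c0 : 0 < c by exact: lt_trans ac.
rewrite oppr_gt0 pmulr_rlt0 // subr_lt0 qr_gt1 // c0; exact: lt_le_trans bR.
Qed.

Lemma ur_inj s r r' : branch s r -> branch s r' -> ur r = ur r' -> r = r'.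
Proof.
have [rr|rr|//] := ltgtP r r'; case: s => /= h h' E.
- by have := ur_decr (ltW h) rr; rewrite E ltxx.
- by case/andP: h h' => h _ /andP[_ /ltW h']; have := ur_incr h rr h'; rewrite E ltxx.
- by have := ur_decr (ltW h') rr; rewrite E ltxx.
- by case/andP: h' h => h' _ /andP[_ /ltW h]; have := ur_incr h' rr h; rewrite E ltxx.
Qed.

Lemma ur_surj s t : (~~ s -> 0 < Rc) -> t < um -> exists2 r, branch s r & ur r = t.
Proof.
have N2 := natr_sub2_gt0.
case: s => [_|/(_ isT) R0] tu.
(* Since [b >= 1] and [b >= |1 - 2t|], also [b^2 >= 1 - 2t], so the quadratic part alone is at most
   [t]. *)
- pose b := Rc + 1 + `|1 - 2 * t|.
  have bR : Rc < b by rewrite /b -addrA ltrDl ltr_pwDl.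
  have b1 : 1 <= b by rewrite /b -addrA addrCA lerDl addr_ge0.
  have ub : ur b <= t.
    rewrite uRrE; apply: le_trans (_ : (1 - b ^+ 2) / 2 <= _).
      by rewrite gerBl divr_ge0 ?mulr_ge0 ?exprn_ge0 ?(ltW N2) // (le_trans _ b1).
    have : 1 - 2 * t <= b ^+ 2.
      apply: le_trans (ler_norm _) _; apply: le_trans (_ : b <= _).
        by rewrite lerDr addr_ge0.
      by rewrite expr2 ler_peMl // (le_trans _ b1).
    by clear; lra.
  have cts : {within `[Rc, b], continuous ur}.
    apply: derivable_within_continuous => x; rewrite in_itv /= => /andP[ax _].
    have [Rz|Rnz] := eqVneq Rc 0; first by have [] := @isd_ur x (or_intror Rz).
    have [|//] := @isd_ur x; left; apply: lt_le_trans ax.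
    by rewrite lt_neqAle eq_sym Rnz.
  have [|c] := @IVT _ ur Rc b t (ltW bR) cts.
    rewrite ur_top; rewrite ge_min ub orbT /=; rewrite le_max (ltW tu) //.
  rewrite in_itv /= => /andP[Rcc cb] E; exists c => //=.
  rewrite lt_neqAle Rcc andbT; apply/eqP => cR.
  by move: tu; rewrite -E -cR ur_top ltxx.
- pose M := `|1 / 2 - t| + 1.
  have M0 : 0 < M by rewrite ltr_wpDl.
  (* [a <= 1] gives [a^(n-2) <= a], and the last entry then makes the singular term at least [M],
     which pushes [ur a] below [t]. *)
  pose a := Num.min (Rc / 2) (Num.min 1 (Rc ^+ n / ((N - 2) * M))).
  have a0 : 0 < a by rewrite !lt_min divr_gt0 // ltr01 divr_gt0 ?exprn_gt0 // mulr_gt0.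
  have [a1 aM] : a <= 1 /\ a <= Rc ^+ n / ((N - 2) * M).
    by split; rewrite /a !ge_min lexx ?orbT.
  have aR : a < Rc.
    apply: le_lt_trans (_ : Rc / 2 < _); first by rewrite /a ge_min lexx.
    by rewrite ltr_pdivrMr // ltr_pMr // ltr1n.
  have ua : ur a <= t.
    rewrite uRrE.
    have pa : 0 < a ^+ (n - 2) by rewrite exprn_gt0.
    have : M <= Rc ^+ n / ((N - 2) * a ^+ (n - 2)).
      rewrite ler_pdivlMr ?mulr_gt0 //.
      apply: le_trans (_ : M * ((N - 2) * a) <= _); last first.
        have -> : M * ((N - 2) * a) = a * ((N - 2) * M) by clear; ring.
        by move: aM; rewrite ler_pdivlMr // mulr_gt0.
      apply: ler_wpM2l (ltW M0) _ _ _; apply: ler_wpM2l (ltW N2) _ _ _.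
      rewrite -[leRHS]expr1; apply: ler_wiXn2l; rewrite ?(ltW a0) //.
      by rewrite ltn_subRL.
    have := ler_norm (1 / 2 - t); have := sqr_ge0 a; rewrite /M; clear.
    move: (_ / (_ * _)) `|_| => X Y; lra.
  have cts : {within `[a, Rc], continuous ur}.
    apply: derivable_within_continuous => x; rewrite in_itv /= => /andP[ax _].
    by have [|//] := @isd_ur x; left; exact: lt_le_trans ax.
  have [|c] := @IVT _ ur a Rc t (ltW aR) cts.
    rewrite ur_top ge_min ua /= le_max (ltW tu) orbT //.
  rewrite in_itv /= => /andP[ac cR] E; exists c => //=.
  rewrite (lt_le_trans a0 ac) /= lt_neqAle cR andbT; apply/eqP => cE.
  by move: tu; rewrite -E cE ur_top ltxx.
Qed.

Variable s : bool.
Hypothesis sR : ~~ s -> 0 < Rc.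

(** The inverse is taken on the whole open branch, not only between the zeros of the model: it
    exists for all [t < um], negative ones included, so it has a two-sided derivative at the
    boundary value [t = 0]. The default 0 is not reached in that range. *)
Definition profile (t : R) : R := xget 0 [set r | branch s r /\ ur r = t].

Lemma profileP t : t < um -> branch s (profile t) /\ ur (profile t) = t.
Proof.
move=> tu; rewrite /profile; have [r h E] := ur_surj sR tu.
by case: xgetP => [y _ //|/(_ r)]; case.
Qed.

Lemma profileK r : branch s r -> profile (ur r) = r.
Proof.
move=> h; apply: xget_eq => // y [h' E]; exact: ur_inj h' h E.
Qed.

Lemma branch_near r : branch s r -> \forall x \near r, branch s x.
Proof.
case: s => /= [h|/andP[h1 h2]]; first exact: lt_nbhsr.
by near=> x; apply/andP; split; near: x; [exact: lt_nbhsr|exact: lt_nbhsl].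
Unshelve. all: by end_near. Qed.

(* In the notation of the header, [yt], [qt] and [gat] are [y], [q] and [W_R]
   as functions of [t]; [bet] is the weight of the P-function. *)
Definition yt t := profile t ^+ 2.
Definition qt t := qr (profile t).

Lemma profile_gt0 t : t < um -> 0 < profile t.
Proof. by move=> /profileP[/branch_gt0]. Qed.

Lemma yt_gt0 t : t < um -> 0 < yt t.
Proof. by move=> /profile_gt0 h; rewrite exprn_gt0. Qed.

Lemma qt_neq1 t : t < um -> 1 - qt t != 0.
Proof. by move=> /profileP[/qr_neq1]. Qed.

Lemma isd_profile (t : R) : t < um -> is_derive t 1 profile (- (profile t * (1 - qt t))^-1).
Proof.
move=> tu; have [h E] := profileP tu; rewrite -invrN -{1}E.
apply: is_derive_inverse.
- by apply: filterS (branch_near h) => x hx; exact: profileK.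
- apply: filterS (branch_near h) => x hx.
  apply: isd1_continuous; apply: isd_ur; left; exact: branch_gt0 hx.
- apply: isd_ur; left; exact: branch_gt0 h.
- by rewrite oppr_eq0 mulf_neq0 // ?(qr_neq1 h) // gt_eqF // (branch_gt0 h).
Qed.

Lemma isd_yt (t : R) : t < um -> is_derive t 1 yt (- 2 / (1 - qt t)).
Proof.
move=> tu; have /is_derive_eq := isdX 2 (isd_profile tu); apply.
rewrite /= expr1; have := qt_neq1 tu; have := lt0r_neq0 (profile_gt0 tu).
by move: (profile t) (qt t) => p q p0 q0; field; rewrite p0 q0.
Qed.

Lemma isd_qt (t : R) : t < um -> is_derive t 1 qt (N * qt t / (yt t * (1 - qt t))).
Proof.
move=> tu; have p0 := lt0r_neq0 (profile_gt0 tu).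
have pn0 : profile t ^+ n != 0 by rewrite expf_neq0.
have /is_derive_eq := isdMc (Rc ^+ n) (@isdV R _ (fun t : R => profile t ^+ n) t 1 _ pn0 (isdX n (isd_profile tu))).
apply; have q0 := qt_neq1 tu.
have pE : profile t ^+ n = profile t * profile t ^+ n.-1 by rewrite -exprS prednK // dim_gt0.
have SE : Rc ^+ n = qt t * (profile t * profile t ^+ n.-1) by rewrite /qt /qr -pE divfK.
have : profile t ^+ n.-1 != 0 by rewrite expf_neq0.
rewrite /yt pE SE; move: (profile t ^+ n.-1) (qt t) (profile t) q0 p0 => P q p q0 p0 P0.
by field; rewrite p0 P0 q0.
Qed.

Lemma qt_gt0 t : 0 < Rc -> t < um -> 0 < qt t.
Proof. by move=> R0 /profile_gt0 h; rewrite divr_gt0 // exprn_gt0. Qed.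

Definition gat t := yt t * (1 - qt t) ^+ 2.
Definition gat1 t := - 2 - 2 * (N - 1) * qt t.
Definition gat2 t := - (2 * (N - 1) * (N * qt t / (yt t * (1 - qt t)))).

Lemma isd_gat (t : R) : t < um -> is_derive t 1 gat (gat1 t).
Proof.
move=> tu.
have /is_derive_eq := isdM (isd_yt tu) (isdX 2 (isdB (isd_cst 1 t (1 : R)) (isd_qt tu))).
apply; rewrite /gat1 /=; have := qt_neq1 tu; have := lt0r_neq0 (yt_gt0 tu).
by move: (yt t) (qt t) => y q y0 q0; field; rewrite y0 q0.
Qed.

Lemma isd_gat1 (t : R) : t < um -> is_derive t 1 gat1 (gat2 t).
Proof.
move=> tu.
have /is_derive_eq := isdB (isd_cst (- 2) t (1 : R)) (isdMc (2 * (N - 1)) (isd_qt tu)).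
by apply; rewrite /gat2 sub0r.
Qed.

Lemma gat_ge0 t : t < um -> 0 <= gat t.
Proof. by move=> /yt_gt0/ltW h; rewrite mulr_ge0 // sqr_ge0. Qed.

Local Notation sg := (if s then 1 else -1 : R).
Definition bet t := sg / (1 - qt t).
Definition bet1 t := sg * (N * qt t / (yt t * (1 - qt t) ^+ 3)).
Definition bet2 t := sg * (N * qt t * (N + 2 + (2 * N - 2) * qt t)
                          / (yt t ^+ 2 * (1 - qt t) ^+ 5)).

Lemma isd_bet (t : R) : t < um -> is_derive t 1 bet (bet1 t).
Proof.
move=> tu; have q0 := qt_neq1 tu.
have /is_derive_eq := isdMc sg (@isdV R _ (fun t : R => 1 - qt t) t 1 _ q0
  (isdB (isd_cst 1 t (1 : R)) (isd_qt tu))).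
apply; rewrite /bet1; move: q0 (lt0r_neq0 (yt_gt0 tu)).
by move: sg (yt t) (qt t) => S y q q0 y0; field; rewrite y0 q0.
Qed.

Lemma isd_bet1 (t : R) : t < um -> is_derive t 1 bet1 (bet2 t).
Proof.
move=> tu; have q0 := qt_neq1 tu; have y0 := lt0r_neq0 (yt_gt0 tu).
have d0 : yt t * (1 - qt t) ^+ 3 != 0 by rewrite mulf_neq0 // expf_neq0.
have /is_derive_eq := isdMc sg (isdM (isdMc N (isd_qt tu))
  (@isdV R _ (fun t : R => yt t * (1 - qt t) ^+ 3) t 1 _ d0
     (isdM (isd_yt tu) (isdX 3 (isdB (isd_cst 1 t (1 : R)) (isd_qt tu)))))).
apply; rewrite /bet2 /=; move: q0 y0; clear.
by move: sg (yt t) (qt t) => S y q q0 y0; field; rewrite y0 q0.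
Qed.

Lemma bet_gt0 t : t < um -> 0 < bet t.
Proof. by move=> /profileP[/sgn_branch]. Qed.

Lemma profile_le1 t : 0 <= t -> t < um -> profile t <= 1.
Proof.
move=> t0 tu; have p0 := profile_gt0 tu; have [_ E] := profileP tu.
have : 0 <= (1 - profile t ^+ 2) / 2.
  apply: le_trans t0 _; rewrite -{1}E uRrE gerBl divr_ge0 ?exprn_ge0 // mulr_ge0 //.
    by have := natr_ge3; lra.
  by rewrite exprn_ge0 // ltW.
rewrite pmulr_lge0 // subr_ge0 => h.
by rewrite -(ler_pXn2r (n := 2)) ?nnegrE ?expr1n // ltW.
Qed.

(* [d/dt (1-q)^2 = - 2 n q / y] and [q / y >= Rc^n] because [r <= 1]. *)
Lemma qt_growth t : 0 < Rc -> 0 <= t -> t < um ->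
  2 * N * Rc ^+ n * (um - t) <= (1 - qt t) ^+ 2.
Proof.
move=> R0 t0 tu; pose K := 2 * N * Rc ^+ n.
have K0 : 0 < K by rewrite !mulr_gt0 ?exprn_gt0 // ltr0n dim_gt0.
rewrite -/K -subr_ge0; apply/ler_addgt0Pl => e e0.
pose f x := - ((1 - qt x) ^+ 2 - K * (um - x)).
pose df x := 2 * N * (qt x / yt x) - K.
(* The derivative formulas stop short of [um], so the comparison is made with a nearby [t'] at the
   cost of [e]. *)
have [t' [tt' t'u te]] : exists t', [/\ t <= t', t' < um & K * (um - t') <= e].
  pose d := Num.min ((um - t) / 2) (e / K).
  have d0 : 0 < d by rewrite lt_min !divr_gt0 // subr_gt0.
  exists (um - d); split.
  - have : d <= (um - t) / 2 by rewrite ge_min lexx.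
    by move: tu; clear; lra.
  - by rewrite ltrBlDr ltrDl.
  - by rewrite opprB addrCA subrr addr0 mulrC -ler_pdivlMr // ge_min lexx orbT.
have : f t <= f t'.
  have dF (x : R) : t <= x <= t' -> is_derive x 1 f (df x).
    move=> /andP[tx xt']; have xu : x < um := le_lt_trans xt' t'u.
    have /is_derive_eq := isdN (isdB (isdX 2 (isdB (isd_cst 1 x (1 : R)) (isd_qt xu)))
       (isdMc K (isdB (isd_cst um x (1 : R)) (is_derive_id x (1 : R))))).
    apply; rewrite /df /=; have := qt_neq1 xu; have := lt0r_neq0 (yt_gt0 xu).
    by clear; move: (yt x) (qt x) K => y q k y0 q0; field; rewrite y0 q0.
  have [|c] := @MVT_sym R f df t t'; rewrite (min_l tt') (max_r tt'); first exact: dF.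
  move=> /andP[tc ct'] E; rewrite -subr_ge0 E; apply: mulr_ge0; last by rewrite subr_ge0.
  rewrite subr_ge0.
  have cu : c < um := le_lt_trans ct' t'u.
  rewrite /K; apply: ler_wpM2l; first by rewrite mulr_ge0 // ler0n.
  have p1 := profile_le1 (le_trans t0 tc) cu; have p0 := profile_gt0 cu.
  rewrite ler_pdivlMr ?yt_gt0 // /qt /qr ler_pdivlMr ?exprn_gt0 //.
  rewrite -mulrA ger_pMr ?exprn_gt0 // mulr_ile1 ?exprn_ge0 ?exprn_ile1 // ltW //.
rewrite /f => H.
have : 0 <= (1 - qt t') ^+ 2 by exact: sqr_ge0.
move: H te; clear; lra.
Qed.

(** Supplies the constant [B] of [gradient_bound]. *)
Lemma bet_growth t : 0 < Rc -> 0 <= t -> t < um ->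
  bet t ^+ 2 * (um - t) <= (2 * N * Rc ^+ n)^-1.
Proof.
move=> R0 t0 tu; have := qt_growth R0 t0 tu; have := qt_neq1 tu.
have : 0 < 2 * N * Rc ^+ n by rewrite !mulr_gt0 ?exprn_gt0 // ltr0n dim_gt0.
move: (2 * N * Rc ^+ n) => K K0 q0 H.
have -> : bet t ^+ 2 = ((1 - qt t) ^+ 2)^-1.
  by rewrite /bet exprMn exprVn; case: s; rewrite ?sqrrN expr1n mul1r.
rewrite mulrC ler_pdivrMr ?exprn_even_gt0 // mulrC -ler_pdivrMr ?invr_gt0 // invrK.
by rewrite mulrC.
Qed.

Lemma scal_ring t D : 0 < Rc -> t < um -> 0 < D ->
  let k := (gat1 t - bet1 t / bet t * D) / 2 in
     0 < bet2 t * (D + gat t) * D + bet1 t * (- N) * D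
         + 2 * bet1 t * ((2 * k - gat1 t) * (D + gat t))
         + bet t * (2 * (k ^+ 2 + (- N - k) ^+ 2 / (N - 1))
             - gat2 t * (D + gat t) - gat1 t * (- N)).
Proof.
move=> R0 tu D0; have y0 := yt_gt0 tu; have q0 := qt_neq1 tu; have qp := qt_gt0 R0 tu.
have N1 : 0 < N - 1 by have := natr_ge3; lra.
have Np : 0 < N by have := natr_ge3; lra.
have s0 : sg != 0 by case: s; rewrite ?oppr_eq0 oner_neq0.
have := ring_pfun_identity D (lt0r_neq0 y0) q0 (lt0r_neq0 N1) s0.
rewrite /= -/(bet t) -/(bet1 t) -/(bet2 t) -/(gat t) -/(gat1 t) -/(gat2 t) => ->.
have q2 : 0 < (1 - qt t) ^+ 2 by rewrite exprn_even_gt0.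
have q4 : 0 < (1 - qt t) ^+ 4 by rewrite exprn_even_gt0.
apply: mulr_gt0; first by rewrite mulr_gt0 // bet_gt0.
apply: addr_gt0; first by rewrite divr_gt0 // mulr_gt0 // mulr_gt0 // exprn_gt0.
have y2 : 0 < yt t ^+ 2 by rewrite exprn_gt0.
apply: mulr_gt0.
  by apply: divr_gt0; [apply: mulr_gt0 => //; apply: mulr_gt0|apply: mulr_gt0].
apply: ltr_wpDr; last by rewrite addr_gt0.
apply: divr_ge0; apply: mulr_ge0; rewrite ?sqr_ge0 //; exact: ltW.
Qed.

End Profile.

(** * The gradient inequality *)

Section ModelRadii.
Context {R : realType}.
Variables (n : nat) (Rc : R).
Hypotheses (n3 : (3 <= n)%N) (RcM : 0 <= Rc < Rmax R n).
Local Notation N := (n%:R : R).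
Local Notation ur := (uRr n Rc).
Local Notation um := (uRmax n Rc).

Let Rc0 : 0 <= Rc. Proof. by case/andP: RcM. Qed.

Lemma uRmax_gt0 : 0 < um.
Proof.
have N2 := @natr_sub2_gt0 R n n3; have N0 : 0 < N by have := @natr_ge3 R n n3; lra.
rewrite /uRmax divr_gt0 // subr_gt0.
have /andP[_] := RcM; rewrite /Rmax => h.
have : Rc ^+ 2 < (N - 2) / N.
  rewrite -[ltRHS]sqr_sqrtr; last by rewrite divr_ge0 // ltW.
  by rewrite ltr_pXn2r ?nnegrE // sqrtr_ge0.
rewrite ltr_pdivlMr // => h2.
by rewrite mulrAC ltr_pdivrMr // mul1r mulrC.
Qed.

Lemma r2E : r2 n Rc = profile n Rc true 0.
Proof.
have u0 := uRmax_gt0; rewrite /r2; case: eqP => [Rz|_].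
  have <- : ur 1 = 0 by rewrite /uRr Rz eqxx expr1n subrr mul0r.
  by rewrite profileK //= Rz ltr01.
have [//|h E] := profileP n3 Rc0 (s := true) _ u0.
apply: xget_eq => /= [|y [Ry /eqP]]; first by rewrite fRE // E mulr0.
rewrite fRE // mulf_eq0 pnatr_eq0 /= => /eqP yE.
by apply: (ur_inj n3 Rc0 (s := true)) => //; rewrite yE.
Qed.

Lemma r1E : 0 < Rc -> r1 n Rc = profile n Rc false 0.
Proof.
move=> R0; have u0 := uRmax_gt0.
have [//|h E] := profileP n3 Rc0 (s := false) _ u0.
apply: xget_eq => /= [|y [Ry /eqP]]; first by rewrite fRE // E mulr0.
rewrite fRE // mulf_eq0 pnatr_eq0 /= => /eqP yE.
by apply: (ur_inj n3 Rc0 (s := false)) => //; rewrite yE.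
Qed.

Let sqrtE : Num.sqrt (1 - N * Rc ^+ 2 / (N - 2)) = Num.sqrt (2 * um).
Proof.
have N2 := @natr_sub2_gt0 R n n3.
by congr Num.sqrt; rewrite /uRmax; field; rewrite gt_eqF.
Qed.

(** As [|u_R'| = r |1 - q|], the product is the slope of the model at its outer radius; [tau1_gat]
    is the same at the inner one. *)
Lemma tau2_gat : (tau2 n Rc * Num.sqrt (2 * um)) ^+ 2 = gat n Rc true 0.
Proof.
have u0 := uRmax_gt0; have s0 : 0 < Num.sqrt (2 * um) by rewrite sqrtr_gt0 mulr_gt0.
rewrite /tau2 sqrtE r2E; case: eqP => [Rz|_].
  have h2 : 0 <= 2 * um by rewrite mulr_ge0 // ltW.
  rewrite mul1r (sqr_sqrtr h2) /gat /yt /qt /qr -r2E /r2 Rz eqxx.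
  rewrite expr0n gtn_eqF ?(leq_trans _ n3) //= mul0r subr0 !expr1n /uRmax expr0n /=.
  by field; rewrite gt_eqF // (@natr_sub2_gt0 R n n3).
by rewrite divfK ?gt_eqF // exprMn.
Qed.

Lemma tau1_gat : 0 < Rc -> (tau1 n Rc * Num.sqrt (2 * um)) ^+ 2 = gat n Rc false 0.
Proof.
move=> R0; have u0 := uRmax_gt0; have s0 : 0 < Num.sqrt (2 * um) by rewrite sqrtr_gt0 mulr_gt0.
rewrite /tau1 sqrtE r1E // lt_eqF; last by case/andP: RcM.
by rewrite divfK ?gt_eqF // exprMn /gat; congr (_ * _); rewrite -sqrrN opprB.
Qed.

Lemma psi_plusE t : 0 <= t < um -> psi_plus n Rc t = profile n Rc true t.
Proof.
move=> /andP[t0 tu]; have [//|h E] := profileP n3 Rc0 (s := true) _ tu.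
have [//|h2 E2] := profileP n3 Rc0 (s := true) _ uRmax_gt0.
apply: xget_eq => [|y [/andP[Ry _] yE]].
  split=> //; rewrite (ltW h) r2E /= leNgt; apply/negP => lt.
  have := ur_decr n3 Rc0 (ltW h2) lt; rewrite E E2 ltNge t0 //.
apply: (ur_inj n3 Rc0 (s := true)) => //=; last by rewrite yE.
rewrite lt_neqAle Ry andbT; apply/eqP => RE.
by move: tu; rewrite -yE -RE ur_top // ltxx.
Qed.

Lemma psi_minusE t : 0 < Rc -> 0 <= t < um -> psi_minus n Rc t = profile n Rc false t.
Proof.
move=> R0 /andP[t0 tu]; have [//|h E] := profileP n3 Rc0 (s := false) _ tu.
have [//|h2 E2] := profileP n3 Rc0 (s := false) _ uRmax_gt0.
have [/andP[h1 h1'] /andP[h3 h3']] := (h, h2).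
apply: xget_eq => [|y [/andP[Ry yR] yE]].
  split=> //; rewrite (ltW h1') andbT r1E // leNgt; apply/negP => lt.
  have := ur_incr n3 Rc0 h1 lt (ltW h3'); rewrite E E2 ltNge t0 //.
apply: (ur_inj n3 Rc0 (s := false)) => //=; last by rewrite yE.
have y0 : 0 < y by apply: lt_le_trans Ry; rewrite r1E.
rewrite y0 lt_neqAle yR andbT; apply/eqP => RE.
by move: tu; rewrite -yE RE ur_top // ltxx.
Qed.

Lemma WR_formula s t : (~~ s -> 0 < Rc) -> t < um ->
  ((profile n Rc s t ^+ n - Rc ^+ n) / profile n Rc s t ^+ (n - 1)) ^+ 2 = gat n Rc s t.
Proof.
move=> sR tu; have p0 := lt0r_neq0 (profile_gt0 n3 Rc0 sR tu).
rewrite /gat /yt /qt /qr subn1 -exprMn; congr (_ ^+ 2).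
have -> : profile n Rc s t ^+ n = profile n Rc s t * profile n Rc s t ^+ n.-1.
  by rewrite -exprS prednK // dim_gt0.
have : profile n Rc s t ^+ n.-1 != 0 by rewrite expf_neq0.
move: (profile n Rc s t ^+ n.-1) (profile n Rc s t) p0 => P p p0 P0.
by field; rewrite p0 P0.
Qed.

End ModelRadii.

Section BoundaryTau.
Context {R : realType} {n : nat}.
Local Notation V := 'rV[R]_n.
Variables (Om U : set V) (u : V -> R) (N : set V).
Hypotheses (bOm : bounded_set Om)
  (OmU : closure Om `<=` U) (su : smooth_on U u) (um0 : 0 < umax Om u).

(** A real [sup] dominates only sets that are bounded above. One bound for the gradient on the
    compact closure serves both the supremum over a component and the supremum over all
    components. *)
Lemma gradnorm_bound x : bdry Om x -> closure N x ->
  gradnorm u x <= tauN Om u N * Num.sqrt (2 * umax Om u).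
Proof.
move=> bx cx; pose A := bdry Om `&` closure N.
have [M M0 HM] : exists2 M : R, 0 <= M & forall y, A y -> gradnorm u y <= M.
  have [|M M0 H] := @compact_norm_bound _ _ _ (Wgrad u) (compact_closure_Om bOm).
    by move=> y /OmU Uy; apply: (Wgrad_cts su).
  exists (Num.sqrt M); first exact: sqrtr_ge0.
  move=> y [[cy _] _]; rewrite ler_sqrt //.
  exact: le_trans (ler_norm _) (H y cy).
have s0 : 0 < Num.sqrt (2 * umax Om u) by rewrite sqrtr_gt0 mulr_gt0.
rewrite -ler_pdivrMr //; pose S := connected_component A x.
have Ax : A x by [].
have Sx : S x by exact: connected_component_refl.
apply: le_trans (_ : tauS Om u S <= _).
  rewrite /tauS ler_pM2r ?invr_gt0 //; apply: ub_le_sup; last by exists x.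
  by exists M => _ [y Sy <-]; apply: HM; exact: connected_component_sub Sy.
apply: ub_le_sup; last by exists S => //; exists x.
exists (M / Num.sqrt (2 * umax Om u)) => _ [S' [y [Ay ->]] <-].
rewrite /tauS ler_pM2r ?invr_gt0 //; apply: ge_sup.
  by exists (gradnorm u y), y => //; exact: connected_component_refl.
by move=> _ [z Sz <-]; apply: HM; exact: connected_component_sub Sz.
Qed.

Lemma Wgrad_bdry x : bdry Om x -> closure N x ->
  Wgrad u x <= (tauN Om u N * Num.sqrt (2 * umax Om u)) ^+ 2.
Proof.
move=> bx cx.
have W0 : 0 <= Wgrad u x by apply: sumr_ge0 => i _; exact: sqr_ge0.
rewrite -(sqr_sqrtr W0); apply: lerXn2r; rewrite ?nnegrE ?sqrtr_ge0 //.
  by apply: le_trans (gradnorm_bound bx cx); exact: sqrtr_ge0.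
exact: gradnorm_bound.
Qed.

End BoundaryTau.

Section Inequality.
Context {R : realType} {n : nat}.
Local Notation V := 'rV[R]_n.
Variables (Om U : set V) (u : V -> R) (N : set V) (Rc : R).
Hypotheses (n3 : (3 <= n)%N) (oOm : open Om) (bOm : bounded_set Om)
  (OmU : closure Om `<=` U) (su : smooth_on U u)
  (lu : forall x, Om x -> laplacian u x = - n%:R)
  (u0 : forall x, bdry Om x -> u x = 0)
  (cN : is_component (Om `\` MAXset Om u) N)
  (core : is_core_radius Om u N Rc) (RcM : 0 <= Rc < Rmax R n)
  (umE : umax Om u = uRmax n Rc).
Local Notation s := (tauN Om u N < Num.sqrt n%:R).

Let n1 : (1 < n)%N. Proof. exact: leq_trans n3. Qed.
Let Rc0 : 0 <= Rc. Proof. by case/andP: RcM. Qed.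
Let um0 : 0 < umax Om u. Proof. by rewrite umE uRmax_gt0. Qed.

Lemma core_branch : ~~ s -> 0 < Rc.
Proof. by move=> ns; case: core => -[h]; [rewrite h in ns|case=> /andP[]]. Qed.

(** The choice of core radius becomes the boundary value of [W_R], which makes the P-function
    nonpositive where [u = 0]. *)
Lemma core_gat : (tauN Om u N * Num.sqrt (2 * umax Om u)) ^+ 2 = gat n Rc s 0.
Proof.
rewrite umE; case: core => -[h [hR tE]]; first by rewrite h -tE tau2_gat.
by rewrite ltNge h /= -tE tau1_gat //; case/andP: hR.
Qed.

Lemma WR_gat x : N x -> WR Om u N Rc x = gat n Rc s (u x).
Proof.
move=> Nx; have [_ /andP[ux0 uxm]] := N_sub n1 oOm bOm OmU su lu u0 cN Nx.
rewrite umE in uxm; have sR := core_branch.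
rewrite -(WR_formula n3 RcM sR uxm) /WR /Psi.
case: ifP sR => [_ _|_ /(_ isT) R0]; first by rewrite psi_plusE // (ltW ux0).
by rewrite psi_minusE // (ltW ux0).
Qed.

Lemma Wgrad_le_gat p : N p -> Wgrad u p <= gat n Rc s (u p).
Proof.
have sR := core_branch.
have bd x : bdry Om x -> closure N x -> Wgrad u x <= gat n Rc s 0.
  by rewrite -core_gat; exact: Wgrad_bdry bOm OmU su um0 x.
have tT t : 0 <= t < umax Om u -> t < uRmax n Rc by rewrite umE => /andP[].
have dg t tt := isd_gat n3 Rc0 sR (tT t tt).
have dg1 t tt := isd_gat1 n3 Rc0 sR (tT t tt).
have g0 t tt := gat_ge0 n3 Rc0 sR (tT t tt).
have [R0|R0] := ltP 0 Rc.
  have db t tt := isd_bet n3 Rc0 sR (tT t tt).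
  have db1 t tt := isd_bet1 n3 Rc0 sR (tT t tt).
  have b0 t tt := bet_gt0 n3 Rc0 sR (tT t tt).
  apply: (@gradient_bound _ _ Om U u n1 oOm bOm OmU su lu u0 um0 N cN _ _ _ _ _ _
    db db1 dg dg1 b0 g0 (2 * n%:R * Rc ^+ n)^-1 _ bd).
    by move=> t /= /[dup] tt /andP[t0 _]; rewrite umE; apply: bet_growth => //; exact: tT.
  by move=> t tt D D0; apply: scal_ring => //; exact: tT.
(* A vanishing core radius forces the outer branch with [q = 0]; the weight is then [1/(1+2t)], at
   most 1, so [umax] serves as the constant [B]. *)
have Rz : Rc = 0 by apply/eqP; rewrite eq_le R0.
have st : s by apply: contraT => /sR; rewrite Rz ltxx.
have qz t : qt n Rc s t = 0.
  by rewrite /qt /qr Rz expr0n gtn_eqF ?(leq_trans _ n3) //= mul0r.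
have gE t : t < uRmax n Rc -> gat n Rc s t = 1 - 2 * t.
  move=> tu; rewrite /gat qz subr0 expr1n mulr1 /yt.
  have [_] := profileP n3 Rc0 sR tu; rewrite {1}/uRr Rz eqxx => E.
  by rewrite -[in RHS]E mulrC divfK ?pnatr_eq0 // opprB addrC subrK.
have gE1 t : gat1 n Rc s t = - 2 by rewrite /gat1 qz mulr0 subr0.
have gE2 t : gat2 n Rc s t = 0 by rewrite /gat2 qz !(mulr0, mul0r) oppr0.
have tz t : 0 <= t < umax Om u -> 1 + 2 * t != 0.
  by case/andP=> t0 _; rewrite gt_eqF // ltr_wpDr // mulr_ge0.
have dl (t : R) : is_derive t 1 (fun t : R => 1 + 2 * t) 2.
  by have /is_derive_eq := isdD (isd_cst 1 t (1 : R)) (isdMc 2 (is_derive_id t (1 : R))); apply; rewrite mulr1 add0r.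
pose be (t : R) := (1 + 2 * t)^-1.
pose be1 (t : R) := - 2 / (1 + 2 * t) ^+ 2.
pose be2 (t : R) := 8 / (1 + 2 * t) ^+ 3.
have db (t : R) : 0 <= t < umax Om u -> is_derive t 1 be (be1 t).
  by move=> tt; exact: (@isdV R _ (fun t : R => 1 + 2 * t) t 1 _ (tz t tt) (dl t)).
have db1 (t : R) : 0 <= t < umax Om u -> is_derive t 1 be1 (be2 t).
  move=> tt; have t2 : (1 + 2 * t) ^+ 2 != 0 by rewrite expf_neq0 // tz.
  have /is_derive_eq := isdMc (- 2) (@isdV R _ (fun t : R => (1 + 2 * t) ^+ 2) t 1 _ t2 (isdX 2 (dl t))).
  by apply; rewrite /be2 /=; field; exact: tz.
have b0 t : 0 <= t < umax Om u -> 0 < be t.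
  by case/andP=> t0 _; rewrite invr_gt0 ltr_wpDr // mulr_ge0.
apply: (@gradient_bound _ _ Om U u n1 oOm bOm OmU su lu u0 um0 N cN _ _ _ _ _ _
    db db1 dg dg1 b0 g0 (umax Om u) _ bd).
- move=> t /= tt; have /andP[t0 tu] := tt.
  apply: le_trans (_ : 1 * (umax Om u - t) <= _); last by rewrite mul1r gerBl.
  apply: ler_wpM2r; first by rewrite subr_ge0 ltW.
  apply: exprn_ile1; first exact: ltW (b0 t tt).
  by rewrite invf_le1 ?ltr_wpDr ?mulr_ge0 // lerDl mulr_ge0.
move=> t tt D D0 /=; rewrite gE1 gE2 (gE t (tT t tt)).
have n0 : 0 < (n%:R : R) - 1 by have := @natr_ge3 R n n3; lra.
have := @ball_pfun_identity R n%:R t D (tz t tt) (lt0r_neq0 n0).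
rewrite /= -/(be t) -/(be1 t) -/(be2 t) => ->.
have bt := b0 t tt; have nn : 0 < (n%:R : R) by rewrite ltr0n (leq_trans _ n3).
apply: addr_gt0.
  by apply: mulr_gt0 => //; rewrite mulr_gt0 ?mulr_gt0 ?exprn_gt0.
by rewrite mulr_gt0 ?divr_gt0 // mulr_gt0 ?mulr_gt0 ?exprn_gt0.
Qed.

End Inequality.

(** * Rigidity *)

Section Rigidity.
Context {R : realType} {n : nat}.
Local Notation V := 'rV[R]_n.
Local Notation e_ := (ebasis R).
Variables (N : set V) (u : V -> R) (Rc : R) (s : bool).
Hypotheses (n3 : (3 <= n)%N) (Rc0 : 0 <= Rc) (sR : ~~ s -> 0 < Rc)
  (oN : open N) (cN : connected N) (su : smooth_on N u)
  (lu : forall x, N x -> laplacian u x = - n%:R)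
  (uN : forall x, N x -> u x < uRmax n Rc).

Local Notation y := (yt n Rc s).
Local Notation q := (qt n Rc s).
Local Notation ga := (gat n Rc s).
Local Notation ga1 := (gat1 n Rc s).
Local Notation ga2 := (gat2 n Rc s).
Local Notation T := [set t | t < uRmax n Rc].

(** The model has Hessian [A Id + B du du^T]; its radial eigenvalue is
    [A + B W_R = -(1-q) - n q]. *)
Let A t := - (1 - q t).
Let B t := - (n%:R * q t / (y t * (1 - q t) ^+ 2)).
Let w := pfun u (fun=> 1) ga.
Let w1 := pfun1 u (fun=> 1) (fun=> 0) ga ga1.
Let w2 := pfun2 u (fun=> 1) (fun=> 0) (fun=> 0) ga ga1 ga2.

Let dy (t : R) : T t -> is_derive t 1 y (- 2 / (1 - q t)).
Proof. by move=> tu; exact: (isd_yt n3 Rc0 sR tu). Qed.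
Let dq (t : R) : T t -> is_derive t 1 q (n%:R * q t / (y t * (1 - q t))).
Proof. by move=> tu; exact: (isd_qt n3 Rc0 sR tu). Qed.
Let dga (t : R) : T t -> is_derive t 1 ga (ga1 t).
Proof. by move=> tu; exact: (isd_gat n3 Rc0 sR tu). Qed.
Let dga1 (t : R) : T t -> is_derive t 1 ga1 (ga2 t).
Proof. by move=> tu; exact: (isd_gat1 n3 Rc0 sR tu). Qed.
Let y0 t : T t -> y t != 0.
Proof. by move=> tu; rewrite lt0r_neq0 // (yt_gt0 n3 Rc0 sR tu). Qed.
Let q0 t : T t -> 1 - q t != 0.
Proof. by move=> tu; exact: (qt_neq1 n3 Rc0 sR tu). Qed.

Let dw i x : N x -> is_derive x (e_ i) w (w1 i x).
Proof.
move=> Nx; exact: (@isd_pfun _ _ N u su T _ _ _ _ (fun t _ => isd_cst 1 t 1) dga i x Nx (uN Nx)).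
Qed.

Let ddw i x : N x -> is_derive x (e_ i) (w1 i) (w2 i x).
Proof.
move=> Nx; exact: (@isd_pfun1 _ _ N u su T _ _ _ _ _ _ (fun t _ => isd_cst 1 t 1)
  (fun t _ => isd_cst 0 t 1) dga dga1 i x Nx (uN Nx)).
Qed.

Let sum_w1 x : \sum_i w1 i x * partial i u x = 2 * hessg u x - ga1 (u x) * Wgrad u x.
Proof. by rewrite sum_pfun1 !mul0r add0r mul1r. Qed.

Let sum_w2 x : N x ->
  \sum_i w2 i x = 2 * hess2 u x - ga2 (u x) * Wgrad u x + ga1 (u x) * n%:R.
Proof.
move=> Nx; rewrite /w2 (sum_pfun2 oN su _ _ _ _ _ _ lu Nx) !(mul0r, mulr0, add0r) mul1r.
by rewrite mulrN opprK.
Qed.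

Definition hess_dev (x : V) : R := \sum_i \sum_j (partial i (partial j u) x
  - A (u x) * (i == j)%:R - B (u x) * (partial i u x * partial j u x)) ^+ 2.

Let C x := 2 * B (u x) * ga1 (u x) - 4 * A (u x) * B (u x) - ga2 (u x)
  - 2 * B (u x) ^+ 2 * (Wgrad u x + ga (u x)).

Let dev_alg (h g W a b m G G1 G2 : R) (dev : R) :
  dev = h - 2 * a * (- m) - 2 * b * g + m * a ^+ 2 + 2 * a * b * W + b ^+ 2 * W ^+ 2 ->
  - 4 * m * a - 2 * m * a ^+ 2 + m * G1 + W * (2 * b * G1 - 4 * a * b - G2)
    - 2 * b ^+ 2 * W ^+ 2 = (W - G) * (2 * b * G1 - 4 * a * b - G2 - 2 * b ^+ 2 * (W + G)) ->
  2 * h - G2 * W + G1 * m + - (2 * b) * (2 * g - G1 * W) =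
  (2 * b * G1 - 4 * a * b - G2 - 2 * b ^+ 2 * (W + G)) * (1 * (W - G)) + 2 * dev.
Proof. by move=> -> E; rewrite mul1r (mulrC _ (W - G)) -E; ring. Qed.

(** The drift [-2 B du] is the one that completes the square in [hess_dev]; by [hopf_identity] the
    remaining terms are a multiple of [w]. As [hess_dev >= 0], this is the differential inequality
    asked by [strong_max_principle]. *)
Lemma hopf_equation x : N x ->
  \sum_i w2 i x + \sum_i (- (2 * B (u x)) * partial i u x) * w1 i x =
  C x * w x + 2 * hess_dev x.
Proof.
move=> Nx; have Tx := uN Nx.
have -> : \sum_i (- (2 * B (u x)) * partial i u x) * w1 i x =
    - (2 * B (u x)) * (2 * hessg u x - ga1 (u x) * Wgrad u x).
  by rewrite -sum_w1 mulr_sumr; apply: eq_bigr => i _; rewrite -mulrA [partial i u x * _]mulrC.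
rewrite (sum_w2 Nx); apply: dev_alg.
  rewrite /hess_dev (sum_sqr_hess (fun i j => partial i (partial j u) x)
     (fun i => partial i u x)).
  by have := lu Nx; rewrite /laplacian => ->.
exact: hopf_identity (y0 Tx) (q0 Tx).
Qed.

Let hess_dev_ge0 x : 0 <= hess_dev x.
Proof. by apply: sumr_ge0 => i _; apply: sumr_ge0 => j _; exact: sqr_ge0. Qed.

Let cB t : T t -> {for t, continuous B}.
Proof.
move=> tu.
have d0 : y t * (1 - q t) ^+ 2 != 0 by rewrite mulf_neq0 ?y0 // expf_neq0 // q0.
exact: isd1_continuous (isdN (isdM (isdMc n%:R (dq tu))
  (@isdV R _ (fun t : R => y t * (1 - q t) ^+ 2) t 1 _ d0
     (isdM (dy tu) (isdX 2 (isdB (isd_cst 1 t (1 : R)) (dq tu))))))).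
Qed.

Let cA t : T t -> {for t, continuous A}.
Proof.
move=> tu; exact: isd1_continuous (isdN (isdB (isd_cst 1 t (1 : R)) (dq tu))).
Qed.

Let cga2 t : T t -> {for t, continuous ga2}.
Proof.
move=> tu.
have d0 : y t * (1 - q t) != 0 by rewrite mulf_neq0 ?y0 // q0.
exact: isd1_continuous (isdN (isdMc (2 * (n%:R - 1)) (isdM (isdMc n%:R (dq tu))
  (@isdV R _ (fun t : R => y t * (1 - q t)) t 1 _ d0
     (isdM (dy tu) (isdB (isd_cst 1 t (1 : R)) (dq tu))))))).
Qed.

Lemma touching_implies_equality p : (forall x, N x -> Wgrad u x <= ga (u x)) -> N p ->
  Wgrad u p = ga (u p) -> forall x, N x -> Wgrad u x = ga (u x).
Proof.
move=> le Np eqp.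
have cu x : N x -> {for x, continuous u} by move=> Nx; exact: smooth_continuous su Nx.
have cfu (f : R -> R) x : N x -> {for u x, continuous f} -> {for x, continuous (fun x => f (u x))}.
  by move=> Nx cf; exact: cts_comp (cu x Nx) cf.
have cW x : N x -> {for x, continuous (Wgrad u)} by move=> Nx; apply: (Wgrad_cts su).
have cg x : N x -> {for x, continuous (fun x => ga (u x))}.
  by move=> Nx; apply: cfu => //; exact: isd1_continuous (dga (uN Nx)).
have cg1 x : N x -> {for x, continuous (fun x => ga1 (u x))}.
  by move=> Nx; apply: cfu => //; exact: isd1_continuous (dga1 (uN Nx)).
have cg2 x : N x -> {for x, continuous (fun x => ga2 (u x))}.
  by move=> Nx; apply: cfu => //; exact: cga2 (uN Nx).
have cAu x : N x -> {for x, continuous (fun x => A (u x))}.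
  by move=> Nx; apply: cfu => //; exact: cA (uN Nx).
have cBu x : N x -> {for x, continuous (fun x => B (u x))}.
  by move=> Nx; apply: cfu => //; exact: cB (uN Nx).
have c1 (a : R) x : {for x : V, continuous (fun=> a : R)} by exact: cts_cst.
have cw x : N x -> {for x, continuous w}.
  by move=> Nx; apply: ctsM; [exact: c1|apply: ctsB; [exact: cW|exact: cg]].
have cb i x : N x -> {for x, continuous (fun x => - (2 * B (u x)) * partial i u x)}.
  move=> Nx; apply: ctsM; last exact: smooth_continuous (smooth_partial i su) Nx.
  by apply: ctsN; apply: ctsM; [exact: c1|exact: cBu].
have cC x : N x -> {for x, continuous C}.
  move=> Nx; apply: ctsB.
    apply: ctsB; last exact: cg2.
    apply: ctsB; first by apply: ctsM; [apply: ctsM; [exact: c1|exact: cBu]|exact: cg1].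
    by apply: ctsM; [apply: ctsM; [exact: c1|exact: cAu]|exact: cBu].
  apply: ctsM; first by apply: ctsM; [exact: c1|apply: ctsX; exact: cBu].
  by apply: ctsD; [exact: cW|exact: cg].
have wE x : w x = Wgrad u x - ga (u x) by rewrite /w /pfun mul1r.
have wle x : N x -> w x <= 0 by move=> Nx; rewrite wE subr_le0; exact: le.
have wp : w p = 0 by rewrite wE eqp subrr.
have := @strong_max_principle _ _ N w C w1 w2 (fun i x => - (2 * B (u x)) * partial i u x)
  oN dw ddw cw cb cC wle _ p cN Np wp.
move=> H x Nx; apply/eqP; rewrite -subr_eq0 -wE H // => z Nz.
by rewrite (hopf_equation Nz) lerDl mulr_ge0 // hess_dev_ge0.
Qed.

Hypothesis eqW : forall x, N x -> Wgrad u x = ga (u x).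

(** With [w] zero on the open set [N], its partials vanish there too, and [hopf_equation] leaves a
    vanishing sum of squares. *)
Lemma rigid_hessian x i j : N x -> partial i (partial j u) x =
  A (u x) * (i == j)%:R + B (u x) * (partial i u x * partial j u x).
Proof.
move=> Nx.
have w0 z : N z -> w z = 0 by move=> Nz; rewrite /w /pfun mul1r eqW // subrr.
have w10 k z : N z -> w1 k z = 0.
  move=> Nz; have dz := isd_open oN Nz w0 (dw k Nz).
  by rewrite -(partial_val dz); apply: partial_val; exact: isd_cst.
have w20 k z : N z -> w2 k z = 0.
  move=> Nz; have dz := isd_open oN Nz (w10 k) (ddw k Nz).
  by rewrite -(partial_val dz); apply: partial_val; exact: isd_cst.
have := hopf_equation Nx; rewrite (w0 x Nx) mulr0 add0r.
rewrite big1 => [|k _]; last exact: w20.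
rewrite big1 => [|k _]; last by rewrite w10 ?mulr0.
rewrite add0r => /esym/eqP; rewrite mulf_eq0 pnatr_eq0 /= => /eqP dev0.
have sq0 k l : 0 <= (partial k (partial l u) x - A (u x) * (k == l)%:R
    - B (u x) * (partial k u x * partial l u x)) ^+ 2 by exact: sqr_ge0.
have r0 k : 0 <= \sum_l (partial k (partial l u) x - A (u x) * (k == l)%:R
    - B (u x) * (partial k u x * partial l u x)) ^+ 2 by apply: sumr_ge0 => l _.
have /eqP := dev0; rewrite /hess_dev psumr_eq0 // => /allP /(_ i); rewrite mem_index_enum.
move=> /(_ isT) /=; rewrite psumr_eq0 // => /allP /(_ j); rewrite mem_index_enum.
move=> /(_ isT) /=; rewrite sqrf_eq0 -addrA -opprD subr_eq0 => /eqP //.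
Qed.

Lemma rigid_center : exists c : V, forall x, N x -> sqdist c x = y (u x) /\
  forall i, partial i u x = - (1 - q (u x)) * (x ord0 i - c ord0 i).
Proof.
have [[p Np]|nN] := pselect (exists p, N p); last first.
  by exists 0 => x Nx; case: nN; exists x.
pose X (i : 'I_n) (x : V) : R := x ord0 i + partial i u x * (1 - q (u x))^-1.
have dX i j x : N x -> is_derive x (e_ j) (X i) 0.
  move=> Nx; have Tx := uN Nx; have qn := q0 Tx; have yn := y0 Tx.
  have du := smooth_isd j su Nx; have ddu := smooth_isd j (smooth_partial i su) Nx.
  have d1 := isdB (isd_cst 1 x (e_ j)) (isd_comp (dq Tx) du).
  have d2 := isdD (isd_coord x j i) (isdM ddu (isdV (f := fun x => 1 - q (u x)) qn d1)).
  have /is_derive_eq := d2; apply.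
  rewrite (rigid_hessian j i Nx) (eq_sym j i) /A /B.
  move: (partial i u x) (partial j u x) (y (u x)) (q (u x)) qn yn (i == j)%:R.
  by move=> a b Y Q Q0 Y0 d; field; rewrite Q0 Y0.
exists (\row_i X i p) => x Nx; have Tx := uN Nx; have qn := q0 Tx.
have E i : x ord0 i - (\row_i X i p) ord0 i = - (partial i u x * (1 - q (u x))^-1).
  rewrite mxE (zero_grad_cst oN cN (fun z j Nz => dX i j z Nz) Np Nx) /X.
  by rewrite opprD addrA subrr sub0r.
split; last by move=> i; rewrite E mulrNN mulrC divfK.
rewrite /sqdist (eq_bigr (fun i => partial i u x ^+ 2 * ((1 - q (u x))^-1) ^+ 2)).
  by rewrite -mulr_suml -/(Wgrad u x) eqW // /gat exprVn mulfK // expf_neq0.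
by move=> i _; rewrite E sqrrN exprMn.
Qed.

End Rigidity.

(** * Computing Laplacians, then continuing identities from [N] to the domain *)

Section LaplacianAlgebra.
Context {R : realType} {n : nat}.
Local Notation V := 'rV[R]_n.
Local Notation e_ := (ebasis R).
Variable O : set V.
Hypothesis oO : open O.
Implicit Types (f g L M : V -> R) (c : V).

Definition has_laplacian f L := smooth_on O f /\ forall x, O x -> laplacian f x = L x.

Lemma laplacian_eq f (f1 : 'I_n -> V -> R) (f2 : 'I_n -> R) x : O x ->
  (forall i y, O y -> is_derive y (e_ i) f (f1 i y)) ->
  (forall i, is_derive x (e_ i) (f1 i) (f2 i)) -> laplacian f x = \sum_i f2 i.
Proof.
move=> Ox d1 d2; apply: eq_bigr => i _.
by rewrite (partial_open i oO Ox (fun y Oy => partial_val (d1 i y Oy))) (partial_val (d2 i)).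
Qed.

Lemma has_lap_cst (c : R) : has_laplacian (fun=> c) (fun=> 0).
Proof.
split; first exact: smooth_cst.
by move=> x Ox; rewrite (@laplacian_eq _ (fun _ _ => 0) (fun=> 0)) ?big1.
Qed.

Lemma has_lapD f g L M : has_laplacian f L -> has_laplacian g M ->
  has_laplacian (fun x => f x + g x) (fun x => L x + M x).
Proof.
move=> [sf lf] [sg lg]; split; first exact: smoothD.
move=> x Ox; rewrite -(lf x Ox) -(lg x Ox) -big_split /=.
apply: (@laplacian_eq _ (fun i x => partial i f x + partial i g x)) => //.
- by move=> i y Oy; exact: isdD (smooth_isd i sf Oy) (smooth_isd i sg Oy).
- move=> i; exact: isdD (smooth_isd i (smooth_partial i sf) Ox)
                        (smooth_isd i (smooth_partial i sg) Ox).
Qed.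

Lemma has_lapZ (c : R) f L : has_laplacian f L -> has_laplacian (fun x => c * f x) (fun x => c * L x).
Proof.
move=> [sf lf]; split; first exact: smoothM oO (smooth_cst c oO) sf.
move=> x Ox; rewrite -(lf x Ox) mulr_sumr.
apply: (@laplacian_eq _ (fun i x => c * partial i f x)) => //.
- by move=> i y Oy; exact: isdMc (smooth_isd i sf Oy).
- by move=> i; exact: isdMc (smooth_isd i (smooth_partial i sf) Ox).
Qed.

Lemma smooth_coordB c (j : 'I_n) : smooth_on O (fun x : V => x ord0 j - c ord0 j).
Proof. exact: smoothD oO (smooth_coord j oO) (smooth_cst (- c ord0 j) oO). Qed.

(** Leibniz' rule: a coordinate is affine, so its only trace is the cross term [2 partial j f]. *)
Lemma has_lap_coordM c j f L : has_laplacian f L ->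
  has_laplacian (fun x : V => (x ord0 j - c ord0 j) * f x)
                (fun x : V => 2 * partial j f x + (x ord0 j - c ord0 j) * L x).
Proof.
move=> [sf lf]; split; first exact: smoothM oO (smooth_coordB c j) sf.
move=> x Ox; rewrite -(lf x Ox).
pose f1 (i : 'I_n) (x : V) : R := (j == i)%:R * f x + (x ord0 j - c ord0 j) * partial i f x.
apply: etrans (@laplacian_eq _ f1 (fun i => 2 * ((j == i)%:R * partial i f x)
  + (x ord0 j - c ord0 j) * partial i (partial i f) x) x Ox _ _) _; last first.
- rewrite big_split /= -!mulr_sumr; congr (2 * _ + _).
  rewrite (bigD1 j) //= eqxx mul1r big1 ?addr0 // => i.
  by rewrite eq_sym => /negPf ->; rewrite mul0r.
- move=> i; rewrite /f1; have df := smooth_isd i sf Ox; have ddf := smooth_isd i (smooth_partial i sf) Ox.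
  have /is_derive_eq := isdD (isdMc (j == i)%:R df) (isdM (isd_coordB c x i j) ddf).
  apply; move: (partial i (partial i f) x) (partial i f x) (x ord0 j - c ord0 j).
  by move=> a b e; ring.
- by move=> i y Oy; exact: isdM (isd_coordB c y i j) (smooth_isd i sf Oy).
Qed.

Lemma has_lap_sum (I : finType) (f L : I -> V -> R) :
  (forall i, has_laplacian (f i) (L i)) ->
  has_laplacian (fun x => \sum_i f i x) (fun x => \sum_i L i x).
Proof.
move=> H; elim: (index_enum I) => [|i r ih].
  have -> : (fun x => \sum_(i <- [::]) f i x) = (fun=> 0).
    by apply/funext => x; rewrite big_nil.
  have -> : (fun x => \sum_(i <- [::]) L i x) = (fun=> 0).
    by apply/funext => x; rewrite big_nil.
  exact: has_lap_cst.
have -> : (fun x => \sum_(j <- i :: r) f j x) = (fun x => f i x + \sum_(j <- r) f j x).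
  by apply/funext => x; rewrite big_cons.
have -> : (fun x => \sum_(j <- i :: r) L j x) = (fun x => L i x + \sum_(j <- r) L j x).
  by apply/funext => x; rewrite big_cons.
exact: has_lapD.
Qed.

Lemma smooth_sqdist c : smooth_on O (sqdist c).
Proof.
have -> : sqdist c = (fun x => \sum_i (x ord0 i - c ord0 i) * (x ord0 i - c ord0 i)).
  by apply/funext => x; apply: eq_bigr => i _; rewrite expr2.
by apply: smooth_sum => // i; exact: smoothM oO (smooth_coordB c i) (smooth_coordB c i).
Qed.

Lemma has_lap_sqdist c : has_laplacian (sqdist c) (fun=> 2 * n%:R).
Proof.
split; first exact: smooth_sqdist.
move=> x Ox; apply: etrans (@laplacian_eq _ (fun i x => 2 * (x ord0 i - c ord0 i))
  (fun=> 2) x Ox (fun i y _ => isd_sqdist c y i) (fun i => isd_sqdist2 c x i)) _.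
by rewrite sumr_const card_ord mulr_natr.
Qed.

Lemma has_lap_harmonic f L : has_laplacian f L -> (forall x, O x -> L x = 0) ->
  harmonic_on O f.
Proof. by move=> [sf lf] L0; split=> // x Ox; rewrite lf // L0. Qed.

End LaplacianAlgebra.

Section EuclideanNorm.
Context {R : realType} {n : nat}.
Local Notation V := 'rV[R]_n.
Local Notation e_ := (ebasis R).
Implicit Types (x c : V).

Lemma enorm_sqdist c x : enorm (x - c) = Num.sqrt (sqdist c x).
Proof. by congr Num.sqrt; apply: eq_bigr => i _; rewrite !mxE. Qed.

Lemma sqr_enorm c x : enorm (x - c) ^+ 2 = sqdist c x.
Proof. by rewrite enorm_sqdist sqr_sqrtr // sqdist_ge0. Qed.

Lemma enorm_ge0 x : 0 <= enorm x.
Proof. exact: sqrtr_ge0. Qed.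

Lemma enorm_cts c x : {for x, continuous (fun x => enorm (x - c))}.
Proof.
have -> : (fun x => enorm (x - c)) = (fun x => Num.sqrt (sqdist c x)).
  by apply/funext => z; exact: enorm_sqdist.
by apply: (cts_comp (@sqdist_cts _ _ c x)); exact: sqrt_continuous.
Qed.

Lemma isd_enorm c x i : 0 < enorm (x - c) ->
  is_derive x (e_ i) (fun x => enorm (x - c)) ((x ord0 i - c ord0 i) / enorm (x - c)).
Proof.
move=> r0.
have -> : (fun x => enorm (x - c)) = (fun x => Num.sqrt (sqdist c x)).
  by apply/funext => z; exact: enorm_sqdist.
have D0 : 0 < sqdist c x by rewrite -sqr_enorm exprn_gt0.
have /is_derive_eq := isd_comp (is_derive1_sqrt D0) (isd_sqdist c x i); apply.
rewrite -enorm_sqdist; move: r0; move: (x ord0 i - c ord0 i) (enorm (x - c)) => d r r0.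
by field; rewrite gt_eqF.
Qed.

End EuclideanNorm.

Section Globalization.
Context {R : realType} {n : nat}.
Local Notation V := 'rV[R]_n.
Local Notation e_ := (ebasis R).
Variables (Om : set V) (u : V -> R) (c p : V) (Rc : R).
Hypotheses (n3 : (3 <= n)%N) (oOm : open Om) (cOm : connected Om) (su : smooth_on Om u)
  (lu : forall x, Om x -> laplacian u x = - n%:R) (Op : Om p).
Local Notation d x i := ((x : V) ord0 i - c ord0 i).
Local Notation rho x := (enorm (x - c)).

Lemma lap_u : has_laplacian Om u (fun=> - n%:R).
Proof. by []. Qed.

Lemma lap_partial_u i : has_laplacian Om (partial i u) (fun=> 0).
Proof.
by split; [exact: smooth_partial|exact: laplacian_cst_partial oOm su lu].
Qed.

(** Here the model is a polynomial, so its difference with [u] is itself harmonic on the whole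
    domain. *)
Lemma ball_globalization : Rc = 0 -> (\forall x \near p, u x = uRr n Rc (rho x)) ->
  forall x, Om x -> u x = uRr n Rc (rho x).
Proof.
move=> Rz up.
have uE x : uRr n Rc (rho x) = 2^-1 - 2^-1 * sqdist c x.
  by rewrite /uRr Rz eqxx sqr_enorm; field.
pose h (x : V) : R := u x + (- 2^-1 + 2^-1 * sqdist c x).
have hE x : (h x = 0) <-> (u x = uRr n Rc (rho x)).
  rewrite uE /h; split=> [/eqP|->]; last by ring.
  by rewrite addr_eq0 => /eqP ->; ring.
have hh : harmonic_on Om h.
  apply: (has_lap_harmonic (has_lapD oOm lap_u (has_lapD oOm (has_lap_cst oOm (- 2^-1))
     (has_lapZ oOm 2^-1 (has_lap_sqdist oOm c))))).
  by move=> x _; field.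
move=> x Ox; apply/hE; apply: (harmonic_unique_continuation oOm cOm hh Op) => //.
by apply: filterS up => z /hE.
Qed.

Let E (x : V) : R := \sum_i d x i * partial i u x.

Let n2 : 0 < n%:R - 2 :> R := @natr_sub2_gt0 R n n3.

(** For the model, adding [(n-2) u_R] to [r u_R'] cancels the term in [Rc^n / r^(n-2)] and leaves a
    polynomial. The combination is harmonic because the Laplacian of [E] is
    [2 laplacian u = -2n]. *)
Lemma euler_globalization :
  (\forall x \near p, E x = - ((n%:R - 2) * u x) + (n%:R - 2) / 2 - n%:R / 2 * sqdist c x) ->
  forall x, Om x -> E x = - ((n%:R - 2) * u x) + (n%:R - 2) / 2 - n%:R / 2 * sqdist c x.
Proof.
move=> Ep.
pose h (x : V) : R := E x + ((n%:R - 2) * u x + (- ((n%:R - 2) / 2) + n%:R / 2 * sqdist c x)).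
have hE x : (h x = 0) <-> (E x = - ((n%:R - 2) * u x) + (n%:R - 2) / 2 - n%:R / 2 * sqdist c x).
  rewrite /h; move: (E x) (u x) (sqdist c x) => a b D.
  by split=> [/eqP|->]; [rewrite addr_eq0 => /eqP ->|]; ring.
have hh : harmonic_on Om h.
  apply: (has_lap_harmonic (has_lapD oOm
     (has_lap_sum oOm (fun i => has_lap_coordM oOm c i (lap_partial_u i)))
     (has_lapD oOm (has_lapZ oOm (n%:R - 2) lap_u)
        (has_lapD oOm (has_lap_cst oOm (- ((n%:R - 2) / 2)))
           (has_lapZ oOm (n%:R / 2) (has_lap_sqdist oOm c)))))).
  move=> x Ox; rewrite (eq_bigr (fun i => 2 * partial i (partial i u) x)).
    by rewrite -mulr_sumr -/(laplacian u x) lu //; field.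
  by move=> i _; rewrite mulr0 addr0.
move=> x Ox; apply/hE; apply: (harmonic_unique_continuation oOm cOm hh Op) => //.
by apply: filterS Ep => z /hE.
Qed.

(** Infinitesimal rotations commute with the Laplacian: the cross terms cancel by symmetry of the
    Hessian. The identity says that the gradient is radial. *)
Lemma rotation_globalization i j :
  (\forall x \near p, d x i * partial j u x = d x j * partial i u x) ->
  forall x, Om x -> d x i * partial j u x = d x j * partial i u x.
Proof.
move=> Ep; pose h (x : V) : R := d x i * partial j u x + (-1) * (d x j * partial i u x).
have hE x : (h x = 0) <-> (d x i * partial j u x = d x j * partial i u x).
  rewrite /h mulN1r; split=> [/eqP|->]; last by rewrite subrr.
  by rewrite subr_eq0 => /eqP.
have hh : harmonic_on Om h.
  apply: (has_lap_harmonic (has_lapD oOm (has_lap_coordM oOm c i (lap_partial_u j))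
     (has_lapZ oOm (-1) (has_lap_coordM oOm c j (lap_partial_u i))))).
  have alg (a b D1 D2 : R) : a = b -> 2 * a + D1 * 0 + (-1) * (2 * b + D2 * 0) = 0.
    by move=> ->; ring.
  by move=> x Ox; exact: alg (partialC i j oOm su Ox).
move=> x Ox; apply/hE; apply: (harmonic_unique_continuation oOm cOm hh Op) => //.
by apply: filterS Ep => z /hE.
Qed.

Let w (x : V) : R := rho x ^+ (n - 2) * (u x - (1 - sqdist c x) / 2).

Let w_alg (m r D U dj uj EE pw pw1 : R) : r != 0 -> D = r ^+ 2 -> pw = r * pw1 ->
  EE = - (m * U) + m / 2 - (m + 2) / 2 * D -> D * uj = dj * EE ->
  (m * pw1 * (dj / r)) * (U - (1 - D) / 2) + pw * (uj - 2^-1 * (0 - 2 * dj)) = 0.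
Proof.
move=> r0 DE -> EE_ H.
have -> : uj = dj * EE / r ^+ 2 by rewrite -H DE mulrAC divff ?mul1r // expf_neq0.
by rewrite EE_ DE; field.
Qed.

(* Away from the core the flux [r^(n-2) (u - (1-r^2)/2)] is locally constant. *)
Lemma ring_globalization : 0 < Rc ->
  (forall x, Om x -> E x = - ((n%:R - 2) * u x) + (n%:R - 2) / 2 - n%:R / 2 * sqdist c x) ->
  (forall i j x, Om x -> d x i * partial j u x = d x j * partial i u x) ->
  0 < rho p -> u p = uRr n Rc (rho p) ->
  forall x, Om x -> 0 < rho x /\ u x = uRr n Rc (rho x).
Proof.
move=> R0 HE Hrot rp up.
pose k := - (Rc ^+ n / (n%:R - 2)).
have k0 : k != 0 by rewrite oppr_eq0 mulf_neq0 ?invr_eq0 ?gt_eqF ?exprn_gt0.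
have n20 : (0 < n - 2)%N by rewrite subn_gt0.
have wE x : 0 < rho x -> (w x = k) <-> (u x = uRr n Rc (rho x)).
  move=> r0; have P0 : rho x ^+ (n - 2) != 0 by rewrite expf_neq0 // gt_eqF.
  rewrite uRrE // sqr_enorm /w /k; move: P0 (lt0r_neq0 n2).
  move: (rho x ^+ (n - 2)) (u x) (sqdist c x) (Rc ^+ n) (n%:R - 2) => P U D S m P0 m0.
  split=> [H|->]; last by field; rewrite P0 m0.
  apply/eqP; rewrite -subr_eq0; apply/eqP.
  have -> : U - ((1 - D) / 2 - S / (m * P)) = P^-1 * (P * (U - (1 - D) / 2)) + S / (m * P) by field; rewrite P0 m0.
  by rewrite H; field; rewrite P0 m0.
(* [w] vanishes at [c] since [n > 2], while [k] is nonzero; the level set thus avoids the centre. *)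
have w0 x : w x = k -> 0 < rho x.
  move=> wk; rewrite lt_neqAle enorm_ge0 andbT eq_sym; apply/eqP => r0.
  by move: k0; rewrite -wk /w r0 expr0n gtn_eqF //= mul0r eqxx.
have dw x j : Om x -> 0 < rho x -> is_derive x (e_ j) w 0.
  move=> Ox r0; have du := smooth_isd j su Ox.
  have d1 := isdX (n - 2) (isd_enorm j r0).
  have d2 := isdMc 2^-1 (isdB (isd_cst 1 x (e_ j)) (isd_sqdist c x j)).
  have -> : w = (fun x => rho x ^+ (n - 2) * (u x - 2^-1 * (1 - sqdist c x))).
    by apply/funext => z; rewrite /w [_ / 2]mulrC.
  have /is_derive_eq := isdM d1 (isdB du d2); apply.
  rewrite [2^-1 * (1 - _)]mulrC.
  apply: (@w_alg _ _ _ _ _ _ (E x)).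
  - by rewrite gt_eqF.
  - by rewrite sqr_enorm.
  - by rewrite -exprS prednK.
  - rewrite natrB ?(leq_trans _ n3) // subrK; exact: HE.
  (* The rotation identities, summed against the coordinates, recover each partial derivative of [u]
     from the radial one. *)
  - rewrite /E /sqdist mulr_suml mulr_sumr; apply: eq_bigr => i _.
    by rewrite expr2 -mulrA (Hrot i j x Ox) mulrCA.
have cw x : Om x -> {for x, continuous w}.
  move=> Ox; apply: ctsM; first by apply: ctsX; exact: enorm_cts.
  apply: ctsB; first exact: smooth_continuous su Ox.
  by apply: ctsM; [apply: ctsB; [exact: cts_cst|exact: sqdist_cts]|exact: cts_cst].
suff H : Om `<=` [set x | w x = k].
  by move=> x /H /= wk; split; [exact: w0|apply/(wE x (w0 x wk))].
apply: connected_clopen_sub => //; first by exists p; split=> //; apply/wE.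
- move=> x Ox /= wx.
  have oP : open (Om `&` [set z | 0 < rho z]).
    apply: openI => //; apply: (@open_comp _ _ (fun z : V => rho z) [set r | 0 < r]).
      by move=> z _; exact: enorm_cts.
    exact: open_gt.
  have /nbhs_ballP[e /= e0 eP] : nbhs x (Om `&` [set z | 0 < rho z]).
    by apply: open_nbhs_nbhs; split=> //; split=> //; exact: w0.
  apply/nbhs_ballP; exists e => //= z xz; rewrite /= -wx.
  apply: ball_zero_grad xz => v i /eP[Ov rv]; exact: dw.
- move=> x Ox clx /=; apply: contrapT => /eqP wx.
  have nx : \forall z \near x, w z - k != 0.
    have cwk : {for x, continuous (fun z => w z - k)}.
      by apply: ctsB; [exact: cw|exact: cts_cst].
    by have /cvgr_neq0 := cwk; apply; rewrite subr_eq0.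
  by have [z [[_ /= zz] /=]] := clx _ nx; rewrite zz subrr eqxx.
Qed.

End Globalization.

(** * Connectedness of Euclidean balls and annuli *)

Section Annulus.
Context {R : realType} {n : nat}.
Local Notation V := 'rV[R]_n.
Local Notation e_ := (ebasis R).

Lemma connected_eball (c : V) (r : R) : connected [set x | enorm (x - c) < r].
Proof.
have [r0|r0] := ltP 0 r; last first.
  suff -> : [set x | enorm (x - c) < r] = set0 by exact: connected0.
  apply/seteqP; split=> // x /= xr.
  by have := le_lt_trans (enorm_ge0 _) xr; rewrite ltNge r0.
have E (x : V) : (enorm (x - c) < r) = (sqdist c x < r ^+ 2).
  by rewrite -sqr_enorm ltr_pXn2r // nnegrE ?enorm_ge0 // ltW.
apply: (@star_connected _ _ _ c); first by rewrite /= E sqdistxx exprn_gt0.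
move=> x t /=; rewrite !E => xr /andP[t0 t1].
have -> : sqdist c (c + t *: (x - c)) = t ^+ 2 * sqdist c x.
  rewrite /sqdist mulr_sumr; apply: eq_bigr => i _.
  by rewrite !mxE -exprMn; congr (_ ^+ 2); ring.
apply: le_lt_trans xr; rewrite ler_piMl ?sqdist_ge0 //.
by rewrite exprn_ile1.
Qed.

Let H (s : R) (i : 'I_n) : set V := [set x | 0 < s * x ord0 i].

Let H_connected s i : s != 0 -> connected (H s i).
Proof.
move=> s0; apply: (@star_connected _ _ _ (s *: e_ i)).
  by rewrite /H /= mxE ebasisE eqxx mulr1 -expr2 exprn_even_gt0.
move=> x t; rewrite /H /= => Hx /andP[t0 t1].
have -> : s * (s *: e_ i + t *: (x - s *: e_ i)) ord0 i
    = (1 - t) * s ^+ 2 + t * (s * x ord0 i).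
  by rewrite !mxE !eqxx /= mulr1; ring.
have s2 : 0 < s ^+ 2 by rewrite exprn_even_gt0.
have [->|tn0] := eqVneq t 0; first by rewrite subr0 mul1r mul0r addr0.
apply: ltr_wpDl; first by rewrite mulr_ge0 ?subr_ge0 // ltW.
by rewrite mulr_gt0 // lt_neqAle eq_sym tn0.
Qed.

Let H_meet s t i j : i != j -> s != 0 -> t != 0 -> H s i `&` H t j !=set0.
Proof.
move=> ij s0 t0; exists (s *: e_ i + t *: e_ j); split; rewrite /H /=.
- by rewrite !mxE !eqxx (negPf ij) mulr0 addr0 mulr1 -expr2 exprn_even_gt0.
- by rewrite !mxE !eqxx eq_sym (negPf ij) mulr0 add0r mulr1 -expr2 exprn_even_gt0.
Qed.

(* The punctured space is a chain of open half-spaces. *)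
Lemma connected_punctured : (1 < n)%N -> connected [set x : V | x != 0].
Proof.
move=> n1; have n0 : (0 < n)%N := ltnW n1.
pose i0 : 'I_n := Ordinal n0; pose j0 : 'I_n := Ordinal n1.
have ij : i0 != j0 by [].
have one : (1 : R) != 0 := oner_neq0 R.
have nz s i x : H s i x -> x != 0.
  by rewrite /H /=; apply: contraTneq => ->; rewrite mxE mulr0 ltxx.
pose A : set V := H 1 i0.
have -> : [set x : V | x != 0] = connected_component [set x : V | x != 0] (e_ i0).
  have e0 : A (e_ i0) by rewrite /A /H /= ebasisE eqxx mulr1 ltr01.
  apply/seteqP; split; last by move=> x /connected_component_sub.
  move=> x /= x0.
  have [i xi] : exists i, x ord0 i != 0.
    apply: contrapT => h; move/eqP: x0; apply; apply/rowP => i; rewrite mxE.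
    by apply: contrapT => /eqP xi; apply: h; exists i.
  have Hx : H (x ord0 i) i x by rewrite /H /= -expr2 exprn_even_gt0.
  (* Opposite half-spaces of the same coordinate are disjoint; a half-space of another coordinate
     links them. *)
  have [ii0|ii0] := eqVneq i i0.
    apply: (@connected_component_max _ _ ((A `|` H 1 j0) `|` H (x ord0 i) i)).
    - by left; left.
    - by move=> z [[|]|] /nz.
    - apply: connectedU; last exact: H_connected.
        have [z [z1 z2]] : H 1 j0 `&` H (x ord0 i) i !=set0.
          by apply: H_meet => //; rewrite ii0 eq_sym.
        by exists z; split=> //; right.
      by apply: connectedU; [exact: H_meet|exact: H_connected|exact: H_connected].
    - by right.
  apply: (@connected_component_max _ _ (A `|` H (x ord0 i) i)).
  - by left.
  - by move=> z [|] /nz.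
  - apply: connectedU; [|exact: H_connected|exact: H_connected].
    by apply: H_meet => //; rewrite eq_sym.
  - by right.
exact: component_connected.
Qed.

Lemma enormZ (k : R) (x : V) : enorm (k *: x) = `|k| * enorm x.
Proof.
rewrite /enorm -sqrtr_sqr -sqrtrM ?sqr_ge0 //; congr Num.sqrt.
by rewrite mulr_sumr; apply: eq_bigr => i _; rewrite mxE exprMn.
Qed.

Lemma enorm_gt0 (x : V) : x != 0 -> 0 < enorm x.
Proof.
move=> x0; rewrite lt_neqAle enorm_ge0 andbT eq_sym; apply: contraNneq x0 => E.
by apply/eqP; apply: sqdist_eq0; rewrite -sqr_enorm subr0 E expr0n.
Qed.

(** The annulus is the image of the punctured space under a radial map, with
    [t -> a + (b-a) t/(1+t)] carrying the positive half-line onto the interval from [a] to [b]. *)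
Lemma connected_annulus (c : V) (a b : R) : (1 < n)%N -> 0 <= a -> a < b ->
  connected [set x : V | a < enorm (x - c) < b].
Proof.
move=> n1 a0 ab.
pose g (t : R) := a + (b - a) * (t * (1 + t)^-1).
pose k (x : V) : R := g (enorm x) * (enorm x)^-1.
pose F (x : V) : V := c + k x *: x.
have -> : [set x : V | a < enorm (x - c) < b] = F @` [set x : V | x != 0].
  apply/seteqP; split=> [z /= /andP[az zb]|_ [x /= x0 <-]].
    pose r := enorm (z - c); pose t := (r - a) / (b - r).
    have r0 : 0 < r by exact: le_lt_trans az.
    have t0 : 0 < t by rewrite divr_gt0 // subr_gt0.
    have nE : enorm ((t / r) *: (z - c)) = t.
      have tr0 : 0 <= t / r by apply/ltW; rewrite divr_gt0.
      by rewrite enormZ (ger0_norm tr0) divfK // gt_eqF.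
    exists ((t / r) *: (z - c)).
      rewrite /= scaler_eq0 mulf_eq0 invr_eq0 !gt_eqF //=.
      apply: contraTneq r0 => zc; rewrite /r zc /enorm big1 ?sqrtr0 ?ltxx // => i _.
      by rewrite mxE expr0n.
    rewrite /F /k nE scalerA.
    have -> : g t = r.
      rewrite /g /t; have br : b - r != 0 by rewrite subr_eq0 gt_eqF.
      have ba : b - a != 0 by rewrite subr_eq0 gt_eqF.
      have -> : 1 + (r - a) / (b - r) = (b - a) / (b - r) by field.
      by field; rewrite br ba.
    have -> : r / t * (t / r) = 1 by field; rewrite !gt_eqF.
    by rewrite scale1r addrC subrK.
  have e0 := enorm_gt0 x0.
  have g0 : a < g (enorm x) < b.
    rewrite /g; move: (enorm x) e0 => t t0.
    have : 0 < t * (1 + t)^-1 < 1.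
      by rewrite divr_gt0 ?addr_gt0 //= ltr_pdivrMr ?addr_gt0 // mul1r ltrDr.
    move: (t * _) => s /andP[s0 s1]; apply/andP; split.
      by rewrite ltrDl mulr_gt0 // subr_gt0.
    by rewrite -ltrBrDl gtr_pMr // subr_gt0.
  rewrite /F addrC addKr enormZ ger0_norm; last first.
    by rewrite /k divr_ge0 ?enorm_ge0 // ltW // (le_lt_trans a0) //; case/andP: g0.
  by rewrite /k divfK ?gt_eqF.
apply: connected_continuous_connected; first exact: connected_punctured.
apply: continuous_in_subspaceT => x; rewrite inE /= => x0.
have ne := enorm_gt0 x0.
have cn : {for x, continuous (@enorm R n)}.
  have -> : @enorm R n = (fun x => enorm (x - 0)) by apply/funext => z; rewrite subr0.
  exact: enorm_cts.
have cinv (f : V -> R) : {for x, continuous f} -> f x != 0 -> {for x, continuous (fun z => (f z)^-1)}.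
  by move=> cf f0; exact: (cvgV f0 cf).
have ck : {for x, continuous k}.
  apply: ctsM; last by apply: cinv => //; rewrite gt_eqF.
  apply: ctsD; first exact: cts_cst.
  apply: ctsM; first exact: cts_cst.
  apply: ctsM; first exact: cn.
  apply: cinv; first by apply: ctsD; [exact: cts_cst|exact: cn].
  by rewrite gt_eqF // addr_gt0.
have cZ : (fun z : V => k z *: z) @ x --> k x *: x.
  have ck' : k @ x --> k x by exact: ck.
  have ci : id @ x --> x by exact: cvg_id.
  exact: (cvgZ ck' ci).
exact: (cvgD (cvg_cst c) cZ).
Qed.

End Annulus.

(** * Conclusion *)

Section Conclusion.
Context {R : realType} {n : nat}.
Local Notation V := 'rV[R]_n.
Variable (Rc : R).
Hypotheses (n3 : (3 <= n)%N) (RcM : 0 <= Rc < Rmax R n).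
Local Notation ur := (uRr n Rc).

Let Rc0 : 0 <= Rc. Proof. by case/andP: RcM. Qed.

(** The model domain is where the profile is positive. For [Rc > 0] the origin has to be set apart:
    division by zero gives the profile the value 1/2 there. *)
Lemma OmegaR_pos (x : V) : (0 < Rc -> 0 < enorm x) ->
  OmegaR Rc x <-> 0 < ur (enorm x).
Proof.
move=> x0; have u0 := uRmax_gt0 n3 RcM; rewrite /OmegaR; case: eqP => [Rz|/eqP Rnz].
  rewrite /uRr Rz eqxx /= pmulr_lgt0 ?invr_gt0 // subr_gt0.
  by rewrite -{2}(expr1n R 2) ltr_pXn2r // ?nnegrE ?enorm_ge0.
have R0 : 0 < Rc by rewrite lt_neqAle eq_sym Rnz.
have {x0}r0 := x0 R0; rewrite /= (r1E n3 RcM R0) (r2E n3 RcM).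
have [//|/= /andP[a0 aR] ua] := profileP n3 Rc0 (s := false) _ u0.
have [//|/= bR ub] := profileP n3 Rc0 (s := true) _ u0.
move: (profile n Rc false 0) (profile n Rc true 0) (enorm x) a0 aR ua bR ub r0 => a b r a0 aR ua bR ub r0.
split=> [/andP[ar rb]|ur0].
  have [rR|rR] := leP r Rc; first by rewrite -ua; exact: ur_incr.
  by rewrite -ub; apply: ur_decr => //; exact: ltW.
rewrite !ltNge; apply/andP; split; apply/negP; rewrite le_eqVlt => /orP[/eqP e|lt].
- by move: ur0; rewrite e ua ltxx.
- by have := ur_incr n3 Rc0 r0 lt (ltW aR); rewrite ua ltNge ltW.
- by move: ur0; rewrite -e ub ltxx.
- by have := ur_decr n3 Rc0 (ltW bR) lt; rewrite ub ltNge ltW.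
Qed.

Lemma connected_OmegaR (c : V) : connected [set x | OmegaR Rc (x - c)].
Proof.
rewrite /OmegaR; case: eqP => [Rz|/eqP Rnz] /=; first exact: connected_eball.
have R0 : 0 < Rc by rewrite lt_neqAle eq_sym Rnz.
have u0 := uRmax_gt0 n3 RcM.
rewrite (r1E n3 RcM R0) (r2E n3 RcM).
have [//|/= /andP[a0 aR] ua] := profileP n3 Rc0 (s := false) _ u0.
have [//|/= bR ub] := profileP n3 Rc0 (s := true) _ u0.
apply: connected_annulus; [exact: leq_trans n3|exact: ltW|exact: lt_trans aR bR].
Qed.

(** Positivity of [u] puts [Om] inside the translated model domain. A point of [closure Om] there
    but outside [Om] would have [u = 0], whereas by continuity [u] equals the positive model value;
    connectedness then gives equality. *)
Lemma equivalent_model (Om U : set V) (u : V -> R) (c : V) :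
  Om !=set0 -> open Om -> closure Om `<=` U -> smooth_on U u ->
  (forall x, bdry Om x -> u x = 0) -> (forall x, Om x -> 0 < u x) ->
  (forall x, Om x -> (0 < Rc -> 0 < enorm (x - c)) /\ u x = ur (enorm (x - c))) ->
  equivalent Om u (OmegaR Rc) (uR Rc).
Proof.
move=> [x0 Ox0] oOm OmU su u0 upos uE.
pose D : set V := [set x | OmegaR Rc (x - c)].
have OmD : Om `<=` D.
  by move=> x Ox; have [h1 h2] := uE x Ox; apply/OmegaR_pos => //; rewrite -h2; exact: upos.
have DOm : D `<=` Om.
  apply: connected_clopen_sub; first exact: connected_OmegaR.
  - by exists x0; split=> //; exact: OmD.
  - by move=> x _ Ox; exact: open_nbhs_nbhs.
  - move=> x Dx clx; apply: contrapT => nOx.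
    have cOx : closure Om x by apply: closure_subset clx => z [].
    have xr : 0 < Rc -> 0 < enorm (x - c).
      move=> R0; move: Dx; rewrite /D /= /OmegaR gt_eqF //= => /andP[+ _].
      apply: le_lt_trans; rewrite (r1E n3 RcM R0).
      by have [//|/= /andP[/ltW]] := profileP n3 Rc0 (s := false) _ (uRmax_gt0 n3 RcM).
    have /(OmegaR_pos xr) pos := Dx.
    have ux : u x = 0 by apply: u0.
    suff ueq : u x - ur (enorm (x - c)) = 0.
      by move: pos; rewrite -(subr0_eq ueq) ux ltxx.
    apply: contrapT => /eqP nz.
    have cf : {for x, continuous (fun z => u z - ur (enorm (z - c)))}.
      apply: ctsB; first exact: smooth_continuous su (OmU x cOx).
      apply: (cts_comp (@enorm_cts _ _ c x)); apply: isd1_continuous; apply: isd_ur => //.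
      by have [R0|R0] := ltP 0 Rc; [left; exact: xr|right; apply/eqP; rewrite eq_le R0].
    have nf : \forall z \near x, u z - ur (enorm (z - c)) != 0.
      by have /cvgr_neq0 := cf; exact.
    by have [z [Oz /=]] := cOx _ nf; rewrite (uE z Oz).2 subrr eqxx.
(* The normalisation of [umax] has already fixed the scale, so only a translation remains. *)
exists 1, (- c); split=> //; split.
  apply/seteqP; split=> [y Dy|_ [x Ox <-]].
    exists (y + c); last by rewrite scale1r addrK.
    by apply: DOm; rewrite /D /= addrK.
  by rewrite scale1r; exact: OmD.
move=> y Dy; rewrite expr1n mul1r invr1 scale1r opprK.
have Oy : Om (y + c) by apply: DOm; rewrite /D /= addrK.
by rewrite (uE _ Oy).2 addrK.
Qed.

End Conclusion.

Lemma model_euler_alg (R : realType) (k P S q y U : R) :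
  k - 2 != 0 -> P != 0 -> y != 0 -> q = S / (P * y) ->
  U = (1 - y) / 2 - S / ((k - 2) * P) ->
  - (1 - q) * y = - ((k - 2) * U) + (k - 2) / 2 - k / 2 * y.
Proof. by move=> m0 P0 y0 -> ->; field; rewrite m0 P0 y0. Qed.

Theorem theorem4p4 (R : realType) (n : nat) (Om : set 'rV[R]_n)
  (u : 'rV[R]_n -> R) (N : set 'rV[R]_n) (Rc : R) :
  (3 <= n)%N ->
  smooth_bounded_domain Om ->
  solves_torsion Om u ->
  is_component (Om `\` MAXset Om u) N ->
  is_core_radius Om u N Rc ->
  0 <= Rc < Rmax R n ->
  umax Om u = uRmax n Rc ->
  (forall p, N p -> Wgrad u p <= WR Om u N Rc p) /\
  ((exists p, N p /\ Wgrad u p = WR Om u N Rc p) ->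
     equivalent Om u (OmegaR Rc) (uR Rc)).
Proof.
move=> n3 [oOm [cOm [Om0 [bOm _]]]] [[U [oU [OmU su]]] [lu u0]] cN core RcM umE.
have n1 : (1 < n)%N := ltnW n3.
have Rc0 : 0 <= Rc by case/andP: RcM.
have um0 : 0 < umax Om u by rewrite umE uRmax_gt0.
have le := Wgrad_le_gat n3 oOm bOm OmU su lu u0 cN core RcM umE.
have WE := WR_gat n3 oOm bOm OmU su lu u0 cN core RcM umE.
split=> [p Np|[p [Np]]]; first by rewrite WE //; exact: le.
rewrite (WE p Np) => eqp.
have sR := core_branch core.
move: (tauN Om u N < Num.sqrt n%:R) sR le eqp => s sR le eqp.
have NOm := N_sub n1 oOm bOm OmU su lu u0 cN.
have oN : open N := N_open oOm OmU su cN.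
have coN : connected N := N_connected cN.
have suOm : smooth_on Om u := smooth_sub (fun x Ox => OmU x (subset_closure Ox)) su.
have suN : smooth_on N u by apply: smooth_sub suOm => x /NOm[].
have luN x : N x -> laplacian u x = - n%:R by move=> /NOm[/lu].
have uN x : N x -> u x < uRmax n Rc by move=> /NOm[_ /andP[_]]; rewrite umE.
have eqW := touching_implies_equality n3 Rc0 sR oN coN suN luN uN le Np eqp.
have [c Hc] := rigid_center n3 Rc0 sR oN coN suN luN uN eqW.
have rN x : N x -> enorm (x - c) = profile n Rc s (u x).
  move=> Nx; rewrite enorm_sqdist (Hc x Nx).1 sqrtr_sqr gtr0_norm //.
  exact: (profile_gt0 n3 Rc0 sR (uN x Nx)).
have uE x : N x -> u x = uRr n Rc (enorm (x - c)).
  by move=> Nx; rewrite rN // (profileP n3 Rc0 sR (uN x Nx)).2.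
have Op : Om p := (NOm p Np).1.
have nearN : nbhs p N by exact: open_nbhs_nbhs.
apply: (equivalent_model n3 RcM (c := c) Om0 oOm OmU su u0).
  by move=> x Ox; exact: (u_pos n1 oOm bOm OmU su lu u0 Ox).
have [R0|R0] := ltP 0 Rc; last first.
  have Rz : Rc = 0 by apply/eqP; rewrite eq_le R0.
  move=> x Ox; split=> //.
  apply: (ball_globalization oOm cOm suOm lu Op Rz) => //.
  by apply: filterS nearN => z /uE.
move=> x Ox.
have n2 : n%:R - 2 != 0 :> R by rewrite gt_eqF // natr_sub2_gt0.
have HE : forall x, Om x -> \sum_i (x ord0 i - c ord0 i) * partial i u x =
    - ((n%:R - 2) * u x) + (n%:R - 2) / 2 - n%:R / 2 * sqdist c x.
  apply: (euler_globalization oOm cOm suOm lu Op); apply: filterS nearN => z Nz.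
  have [Dz gz] := Hc z Nz; have zu := uN z Nz.
  have pz := profile_gt0 n3 Rc0 sR zu; have [_ uz] := profileP n3 Rc0 sR zu.
  (* This is [r u_R'] in the variables [y] and [q], since the gradient is [-(1-q) (x - c)] on
     [N]. *)
  transitivity (- (1 - qt n Rc s (u z)) * yt n Rc s (u z)).
    rewrite -Dz /sqdist mulr_sumr; apply: eq_bigr => i _.
    by rewrite gz expr2 mulrCA.
  rewrite Dz; apply: (@model_euler_alg _ _ (profile n Rc s (u z) ^+ (n - 2)) (Rc ^+ n)) => //.
  - by rewrite expf_neq0 // gt_eqF.
  - by rewrite gt_eqF // yt_gt0.
  - by rewrite /qt /qr /yt -expr_sub2.
  - by rewrite -{1}uz uRrE.
have Hrot i j : forall x, Om x -> (x ord0 i - c ord0 i) * partial j u x =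
    (x ord0 j - c ord0 j) * partial i u x.
  apply: (rotation_globalization oOm cOm suOm lu Op); apply: filterS nearN => z Nz.
  by have [_ gz] := Hc z Nz; rewrite !gz mulrCA [RHS]mulrCA [X in _ * X]mulrC.
have rp : 0 < enorm (p - c) by rewrite rN //; exact: (profile_gt0 n3 Rc0 sR (uN p Np)).
by have [rx ux] := ring_globalization n3 oOm cOm suOm Op R0 HE Hrot rp (uE p Np) Ox.
Qed.
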